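(* Let $(\lambda_1,\dots,\lambda_v)$ and $(\mu_1,\dots,\mu_m)$ be positive real numbers with $$\mathrm{span}_{\mathbb{Q}_0^+}\{\lambda_j\}_{j=1}^v\cap\mathrm{span}_{\mathbb{Q}_0^+}\{\mu_l\}_{l=1}^m=\{0\}.$$ Let $B$ be a small ball centered at $0\in\mathbb{C}^n$ and let $F_l:B\to\mathbb{C}^{N_l}$, $G_j:B\to\mathbb{C}^{N'_j}$ be non-constant holomorphic maps with $F_l(0)=0$, $G_j(0)=0$, satisfying $$\prod_{l=1}^m\big(1+F_l(z)\cdot\bar F_l(\xi)\big)^{\mu_l}\prod_{j=1}^v\big(1+G_j(z)\cdot\bar G_j(\xi)\big)^{-\lambda_j}=\phi(z,\xi)\quad\text{on }B\times B,$$ where $\phi(z,\xi)$ is holomorphic and algebraic on $B\times B$. Then every $F_l$ and every $G_j$ is Nash algebraic.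
   Context: $\mathbb{Q}_0^+$ is the set of nonnegative rationals; $\mathrm{span}_{\mathbb{Q}_0^+}$ denotes nonnegative rational linear combinations. For a holomorphic map $F$, $\bar F(\xi):=\overline{F(\bar\xi)}$; $a\cdot b=\sum_ia_ib_i$. Powers are principal branches. A holomorphic map is Nash algebraic if each component satisfies a nontrivial polynomial equation with polynomial coefficients in $z$. *)

(* Defs.v *)
From HB Require Import structures.
From mathcomp Require Import all_boot all_order all_algebra.
From mathcomp Require Import mpoly.
From mathcomp Require Import all_classical all_reals all_analysis.
From mathcomp Require Import complex.

Set Implicit Arguments.
Unset Strict Implicit.
Unset Printing Implicit Defensive.

Import Order.TTheory GRing.Theory Num.Theory.
Local Open Scope ring_scope.
Local Open Scope classical_set_scope.

Section Defs.
Variable R : realType.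
Local Notation C := R[i].

Definition cnorm2 (n : nat) (z : 'rV[C]_n) : R :=
  \sum_(k < n) ((complex.Re (z ord0 k)) ^+ 2 + (complex.Im (z ord0 k)) ^+ 2).

Definition cball (n : nat) (r : R) : set 'rV[C]_n :=
  [set z | cnorm2 z < r ^+ 2].

Definition cball2 (n : nat) (r : R) : set 'rV[C]_(n + n) :=
  [set w | cball r (lsubmx w) /\ cball r (rsubmx w)].

Definition holomorphic_on (k : nat) (D : set 'rV[C]_k) (f : 'rV[C]_k -> C) :=
  forall z, D z ->
    {for (z : 'rV[C^o]_k), continuous (f : 'rV[C^o]_k -> C^o)} /\
    forall i : 'I_k,
      derivable (fun w : C^o => (f (z + w *: delta_mx ord0 i) : C^o)) 0 1.

Definition holomorphic_map_on (k N : nat) (D : set 'rV[C]_k)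
    (F : 'rV[C]_k -> 'rV[C]_N) :=
  forall i : 'I_N, holomorphic_on D (fun z => F z ord0 i).

Definition barmap (k N : nat) (F : 'rV[C]_k -> 'rV[C]_N) : 'rV[C]_k -> 'rV[C]_N :=
  fun xi => map_mx (@conjc R) (F (map_mx (@conjc R) xi)).

Definition cdot (N : nat) (a b : 'rV[C]_N) : C := \sum_(i < N) a ord0 i * b ord0 i.

Definition cmod (w : C) : R :=
  Num.sqrt ((complex.Re w) ^+ 2 + (complex.Im w) ^+ 2).

(* principal argument, with values in (-pi, pi]  (Arg 0 := 0) *)
Definition carg (w : C) : R :=
  if (complex.Im w == 0) && (complex.Re w < 0) then pi
  else 2 * atan (complex.Im w / (cmod w + complex.Re w)).

(* principal power w^a = exp (a * Log w), for w <> 0 and real exponent a;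
   by convention 0^a := 0 *)
Definition cpow (w : C) (a : R) : C :=
  if w == 0 then 0
  else Complex (cmod w `^ a) 0 * (Complex (cos (a * carg w)) (sin (a * carg w))).

Definition qspan_nonneg (k : nat) (x : 'I_k -> R) : set R :=
  [set y | exists a : 'I_k -> rat,
      (forall j, (0 <= a j)%R) /\ y = \sum_(j < k) ratr (a j) * x j].

Definition algebraic_on (k : nat) (D : set 'rV[C]_k) (f : 'rV[C]_k -> C) :=
  exists P : {poly {mpoly C[k]}}, P != 0 /\
    forall z, D z -> (map_poly (meval (fun j => z ord0 j)) P).[f z] = 0.

Definition nash_algebraic_on (k N : nat) (D : set 'rV[C]_k)
    (F : 'rV[C]_k -> 'rV[C]_N) :=
  forall i : 'I_N, algebraic_on D (fun z => F z ord0 i).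

End Defs.

Arguments cball {R} n r.
Arguments cball2 {R} n r.

(* Main.v *)
Require Import Defs.
From HB Require Import structures.
From mathcomp Require Import all_boot all_order all_algebra.
From mathcomp Require Import mpoly.
From mathcomp Require Import all_classical all_reals all_analysis.
From mathcomp Require Import complex.
From mathcomp Require Import ring_quotient generic_quotient ring lra.
Import Order.TTheory GRing.Theory Num.Theory.
Import numFieldNormedType.Exports.
Local Open Scope ring_scope.
Local Open Scope classical_set_scope.

(** Write H_s for the maps F_l and G_j, e_s for the exponents mu_l and -lambda_j, and
    U_s(z,xi) = 1 + H_s(z).Hbar_s(xi). The hypothesis on the spans says that
    sum_s e_s k_s = 0 has no solution in natural numbers except k = 0.

    If a component x of some H_s0 is not algebraic, x is transcendental over C(z), and there is
    a valuation ring containing C(z) but not x. It contains all elements algebraic over C(z),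
    in particular the Taylor coefficients of phi in any coordinate of xi. Scale each U_s by its
    dominant coefficient and reduce modulo the maximal ideal: u_s(xi) is then a nonzero
    residue-field combination of 1 and the components of Hbar_s, which does not vanish
    identically because a hermitian form is nondegenerate.
    The logarithmic derivative of the functional equation along xi_i survives the reduction; it
    shows that the vanishing orders k_s of the u_s at xi_i = 0 satisfy sum_s e_s k_s = 0, so
    all of them vanish. Starting from a common non-zero of the u_s and setting the
    coordinates to 0 one by one, u_s(0) <> 0 for all s. But Hbar_s(0) = 0, and the
    coefficient of 1 in u_s0 is the residue of the inverse of an element outside the valuation
    ring, hence 0. *)

Set Implicit Arguments.
Unset Strict Implicit.
Unset Printing Implicit Defensive.

(** * Complex derivatives *)

Section ComplexModulus.
Variable R : realType.
Local Notation C := R[i].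
Implicit Types (w a b h : C).

(** The exponents are arbitrary reals, so the product of powers has no meaning in an abstract field
    of functions of z. Its logarithmic derivative, once denominators are cleared, is a polynomial
    identity ([Lam]) between Taylor polynomials in one coordinate of xi, and ring morphisms can
    carry it anywhere. What analysis must supply is a one-variable Taylor expansion whose remainder
    may be differentiated; Goursat's lemma and Cauchy's formula on a square provide it. The
    functions of z form a ring with zero divisors. Hence [K] is the fraction field of this ring
    modulo the functions that vanish on a member of an ultrafilter; the ultrafilter contains every
    set where P(z, x(z)) <> 0 with P a nonzero polynomial, which makes x transcendental. The residue
    ring carries no topology. Zeros of the u_s are controlled by complex linear forms: that a
    residue combination of complex numbers is nonzero is witnessed by a combination with
    coefficients in C ([separating_functional]). A polynomial relation for phi may degenerate on a
    special coordinate line; such a line is treated as a limit of generic ones. *)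

Lemma cmodE w : cmod w = Normc.normc w. Proof. by case: w. Qed.

Lemma cmod_normE w : (cmod w)%:C%C = `|w|.
Proof. by rewrite normc_def. Qed.

Lemma cmodM a b : cmod (a * b) = cmod a * cmod b.
Proof. by rewrite !cmodE Normc.normcM. Qed.

Lemma cmod_ge0 w : 0 <= cmod w. Proof. exact: sqrtr_ge0. Qed.

Lemma cmodD a b : cmod (a + b) <= cmod a + cmod b.
Proof. by rewrite !cmodE; exact: le_normcD. Qed.

Lemma cmodN a : cmod (- a) = cmod a.
Proof. by rewrite !cmodE normcN. Qed.

Lemma cmodB a b : cmod (a - b) <= cmod a + cmod b.
Proof. by rewrite -(cmodN b) cmodD. Qed.

Lemma cmodC a b : cmod (a - b) = cmod (b - a).
Proof. by rewrite -cmodN opprB. Qed.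

Lemma cmod0 : cmod (0 : C) = 0. Proof. by rewrite cmodE Normc.normc0. Qed.
Lemma cmod1 : cmod (1 : C) = 1. Proof. by rewrite cmodE Normc.normc1. Qed.

Lemma cmod_eq0 w : (cmod w == 0) = (w == 0).
Proof.
apply/eqP/eqP => [|->]; last exact: cmod0.
by rewrite cmodE; exact: Normc.eq0_normc.
Qed.

Lemma cmod_gt0 w : (0 < cmod w) = (w != 0).
Proof. by rewrite lt_neqAle cmod_ge0 andbT eq_sym cmod_eq0. Qed.

Lemma cmodV w : cmod w^-1 = (cmod w)^-1.
Proof. by rewrite !cmodE Normc.normcV. Qed.

Lemma cmodX w n : cmod (w ^+ n) = cmod w ^+ n.
Proof. by elim: n => [|n IHn]; rewrite ?expr0 ?cmod1 // !exprS cmodM IHn. Qed.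

Lemma cmod_prod (I : Type) (s : seq I) (P : pred I) (f : I -> C) :
  cmod (\prod_(i <- s | P i) f i) = \prod_(i <- s | P i) cmod (f i).
Proof. by apply: (big_morph (@cmod R)); [exact: cmodM|exact: cmod1]. Qed.

Lemma cmod_sum (I : Type) (s : seq I) (P : pred I) (f : I -> C) :
  cmod (\sum_(i <- s | P i) f i) <= \sum_(i <- s | P i) cmod (f i).
Proof.
elim/big_rec2: _ => [|i x y _ le_yx]; first by rewrite cmod0.
by apply: le_trans (cmodD _ _) _; rewrite lerD2l.
Qed.

Lemma cmod_real (x : R) : cmod x%:C%C = `|x|.
Proof. by rewrite /cmod /= expr0n addr0 sqrtr_sqr. Qed.

Lemma cmod_i : cmod ('i%C : C) = 1.
Proof. by rewrite /cmod /= expr0n add0r expr1n sqrtr1. Qed.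

Lemma cmod_sqr w : cmod w ^+ 2 = complex.Re w ^+ 2 + complex.Im w ^+ 2.
Proof. by rewrite /cmod sqr_sqrtr // addr_ge0 ?sqr_ge0. Qed.

Lemma normr_Re_le w : `|complex.Re w| <= cmod w.
Proof. by rewrite -sqrtr_sqr ler_sqrt ?addr_ge0 ?sqr_ge0 // lerDl sqr_ge0. Qed.

Lemma normr_Im_le w : `|complex.Im w| <= cmod w.
Proof. by rewrite -sqrtr_sqr ler_sqrt ?addr_ge0 ?sqr_ge0 // lerDr sqr_ge0. Qed.

Lemma cmod_leD w : cmod w <= `|complex.Re w| + `|complex.Im w|.
Proof.
rewrite -(@ler_pXn2r _ 2) ?nnegrE ?cmod_ge0 ?addr_ge0 // cmod_sqr.
rewrite -(real_normK (num_real (complex.Re w))) -(real_normK (num_real (complex.Im w))).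
have := normr_ge0 (complex.Re w); have := normr_ge0 (complex.Im w); nra.
Qed.

Lemma cmod_conj w : cmod (conjc w) = cmod w.
Proof. by case: w => x y; rewrite /cmod /= sqrrN. Qed.

Lemma cmodD_ge a b : cmod a - cmod b <= cmod (a + b).
Proof.
by rewrite lerBlDr -{1}(addrK b a) -(cmodN b); exact: cmodD.
Qed.

Lemma Re_add a b : complex.Re (a + b) = complex.Re a + complex.Re b.
Proof. by case: a b => [? ?] []. Qed.
Lemma Im_add a b : complex.Im (a + b) = complex.Im a + complex.Im b.
Proof. by case: a b => [? ?] []. Qed.
Lemma Re_opp a : complex.Re (- a) = - complex.Re a. Proof. by case: a. Qed.
Lemma Im_opp a : complex.Im (- a) = - complex.Im a. Proof. by case: a. Qed.
Lemma Re_mul a b :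
  complex.Re (a * b) = complex.Re a * complex.Re b - complex.Im a * complex.Im b.
Proof. by case: a b => [? ?] []. Qed.
Lemma Im_mul a b :
  complex.Im (a * b) = complex.Re a * complex.Im b + complex.Im a * complex.Re b.
Proof. by case: a b => [? ?] []. Qed.
Definition ReImE := (Re_add, Im_add, Re_opp, Im_opp, Re_mul, Im_mul).

Lemma complex_ext a b :
  complex.Re a = complex.Re b -> complex.Im a = complex.Im b -> a = b.
Proof. by case: a b => [? ?] [? ?] /= -> ->. Qed.

End ComplexModulus.

Section ComplexDerivative.
Variable R : realType.
Local Notation C := R[i].
Implicit Types (f g : C -> C) (a b h w L : C).

Lemma half_pos (e : R) : 0 < e -> 0 < e / 2. Proof. lra. Qed.

Lemma half_lt (e : R) : 0 < e -> e / 2 < e. Proof. lra. Qed.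

(** The o(h) form of the derivative: it includes h = 0 and involves no quotient, so estimates
    combine without punctured neighbourhoods. [cdiffP] links it to [is_derive]. *)
Definition cdiff f a L := forall e : R, 0 < e ->
  exists2 d : R, 0 < d & forall h, cmod h < d ->
    cmod (f (a + h) - f a - L * h) <= e * cmod h.

Definition ccont f a := forall e : R, 0 < e ->
  exists2 d : R, 0 < d & forall h, cmod h < d -> cmod (f (a + h) - f a) <= e.

(** The norm of [C^o] takes its values in [C], where [0 < e] forces e to be real; this passes to
    real tolerances. *)
Lemma cvgC_cont (T : topologicalType) (F : set_system T) (FF : Filter F) (u : T -> C^o) (l : C^o) :
  u @ F --> l <-> forall e : R, 0 < e -> \forall x \near F, cmod (l - u x) < e.
Proof.
split => [/cvgrPdist_lt H e e0|H].
  have /H : (0 : C) < e%:C%C by rewrite ltcR.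
  by apply: filterS => x; rewrite -cmod_normE ltcR.
apply/cvgrPdist_lt => e e0.
have [r re] : exists r : R, r%:C%C = e.
  by exists (complex.Re e); apply: RRe_real; exact: gtr0_real.
have r0 : 0 < r by rewrite -ltcR re.
by apply: filterS (H _ r0) => x; rewrite -re -cmod_normE ltcR.
Qed.

Lemma nearC (a : C^o) (P : C -> Prop) :
  (\forall x \near a, P x) <-> exists2 d : R, 0 < d & forall h, cmod h < d -> P (a + h).
Proof.
split => [/nbhs_ballP [e /= e0 H]|[d d0 H]].
  have re : (complex.Re e)%:C%C = e by apply: RRe_real; exact: gtr0_real.
  exists (complex.Re e); first by rewrite -ltcR re.
  move=> h hd; apply: H; rewrite /ball /= opprD addNKr normrN -cmod_normE.
  by rewrite -re ltcR.
apply/nbhs_ballP; exists d%:C%C => /=; first by rewrite ltcR.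
move=> x; rewrite /ball /= -cmod_normE ltcR cmodC => /H.
by rewrite addrC subrK.
Qed.

Lemma ccontP f a : ccont f a <-> {for (a : C^o), continuous (f : C^o -> C^o)}.
Proof.
split => [H|/(@cvgC_cont _ (nbhs (a : C^o)) _ f (f a)) H e e0].
  apply/(@cvgC_cont _ (nbhs (a : C^o)) _ f (f a)) => e e0; apply/nearC.
  have [d d0 Hd] := H _ (half_pos e0).
  by exists d => // h /Hd; rewrite cmodC => /le_lt_trans; apply; exact: half_lt.
have /nearC [d d0 Hd] := H _ e0.
by exists d => // h /Hd /ltW; rewrite cmodC.
Qed.

Lemma cdiffP f a L : cdiff f a L <-> is_derive (a : C^o) 1 (f : C^o -> C^o) L.
Proof.
split => [H|[/cvg_ex [l Hl]] Le].
  have cv : (fun h : C^o => h^-1 *: ((f : C^o -> C^o) (h *: (1 : C^o) + a) - f a)) @ 0^' --> (L : C^o).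
    apply/(@cvgC_cont _ ((0 : C^o)^') _ _ (L : C^o)) => e e0; rewrite near_withinE; apply/nearC.
    have [d d0 Hd] := H _ (half_pos e0).
    exists d => // h hd; rewrite add0r => h0.
    rewrite -(ltr_pM2l (_ : 0 < cmod h)) ?cmod_gt0 // -cmodM mulrBr.
    rewrite /GRing.scale /= mulr1 mulVKf // (addrC h) mulrC cmodC.
    apply: le_lt_trans (Hd _ hd) _.
    by rewrite mulrC ltr_pM2l ?cmod_gt0 // half_lt.
  by apply: DeriveDef; [apply/cvg_ex; exists L|exact/cvg_lim].
move: Le; rewrite /derive (cvg_lim _ Hl) // => <-.
move=> e e0.
move/(@cvgC_cont _ ((0 : C^o)^') _ _ (l : C^o))/(_ _ e0): Hl; rewrite near_withinE => /nearC [d d0 Hd].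
exists d => // h hd; have [->|h0] := eqVneq h 0.
  by rewrite addr0 subrr mulr0 subr0 cmod0 mulr0.
move: (Hd _ hd); rewrite add0r => /(_ h0).
rewrite -(ltr_pM2l (_ : 0 < cmod h)) ?cmod_gt0 // -cmodM mulrBr.
rewrite /GRing.scale /= mulr1 mulVKf // (addrC h) (mulrC l) cmodC.
by rewrite (mulrC e); exact: ltW.
Qed.

Lemma cdiff_cont f a L : cdiff f a L -> ccont f a.
Proof.
move=> /cdiffP H; apply/ccontP; apply: differentiable_continuous.
by apply/derivable1_diffP; case: H.
Qed.

Lemma cdiff_uniq f a L L' : cdiff f a L -> cdiff f a L' -> L = L'.
Proof. by move=> /cdiffP[_ <-] /cdiffP[_ <-]. Qed.

Lemma cdiff_cst c a : cdiff (fun=> c) a 0.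
Proof. by apply/cdiffP; exact: is_derive_cst. Qed.

Lemma cdiff_id a : cdiff id a 1.
Proof. by apply/cdiffP; exact: is_derive_id. Qed.

Lemma cdiffD f g a L M : cdiff f a L -> cdiff g a M -> cdiff (fun x => f x + g x) a (L + M).
Proof. by move=> /cdiffP ? /cdiffP ?; apply/cdiffP; exact: is_deriveD. Qed.

Lemma cdiffN f a L : cdiff f a L -> cdiff (fun x => - f x) a (- L).
Proof. by move=> /cdiffP ?; apply/cdiffP; exact: is_deriveN. Qed.

Lemma cdiffM f g a L M : cdiff f a L -> cdiff g a M ->
  cdiff (fun x => f x * g x) a (L * g a + f a * M).
Proof.
move=> /cdiffP Hf /cdiffP Hg; apply/cdiffP; apply: (is_derive_eq (is_deriveM Hf Hg)).
by rewrite /GRing.scale /= addrC (mulrC L).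
Qed.

Lemma cdiffZ c f a L : cdiff f a L -> cdiff (fun x => c * f x) a (c * L).
Proof.
by move=> H; have := cdiffM (cdiff_cst c a) H; rewrite mul0r add0r.
Qed.

Lemma cdiffV f a L : f a != 0 -> cdiff f a L -> cdiff (fun x => (f x)^-1) a (- L / f a ^+ 2).
Proof.
move=> fa0 H e e0; set A := cmod (f a); have A0 : 0 < A by rewrite cmod_gt0.
have L1 : 0 < cmod L + 1 by rewrite ltr_wpDl ?cmod_ge0.
(* After multiplication by f(a)^2 f(a+h) two error terms remain. These tolerances make each at most
   e A^3/4 |h|, and e A^3/2 |h| is absorbed by |f(a+h)| >= A/2. *)
have e1 : 0 < e * A ^+ 2 / 4 by rewrite !mulr_gt0 ?exprn_gt0.
have e2 : 0 < e * A ^+ 3 / 4 / (cmod L + 1) by rewrite !divr_gt0 ?mulr_gt0 ?exprn_gt0.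
have [d1 d10 H1] := H _ e1; have [d2 d20 H2] := cdiff_cont H e2.
have [d3 d30 H3] := cdiff_cont H (half_pos A0).
exists (Order.min d1 (Order.min d2 d3)); first by rewrite !lt_min d10 d20.
move=> h; rewrite !lt_min => /and3P[/H1 {}H1 /H2 {}H2 /H3 {}H3].
have lb : A / 2 <= cmod (f (a + h)).
  have := cmodD_ge (f a) (f (a + h) - f a); rewrite (addrC (f a)) subrK; rewrite -/A; lra.
have fh0 : f (a + h) != 0 by rewrite -cmod_gt0; lra.
rewrite -(ler_pM2r (_ : 0 < A ^+ 2 * cmod (f (a + h)))); last by rewrite mulr_gt0 ?exprn_gt0 ?cmod_gt0.
rewrite -cmodX -2!cmodM.
have -> : ((f (a + h))^-1 - (f a)^-1 - - L / f a ^+ 2 * h) * (f a ^+ 2 * f (a + h)) =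
   L * h * (f (a + h) - f a) - f a * (f (a + h) - f a - L * h) by field; rewrite fa0 fh0.
rewrite [cmod (f a ^+ 2 * _)]cmodM cmodX; apply: le_trans (cmodB _ _) _; rewrite !cmodM -/A.
have h0 := cmod_ge0 h.
have B1 : A * cmod (f (a + h) - f a - L * h) <= e * A ^+ 3 / 4 * cmod h.
  by apply: le_trans (ler_wpM2l (ltW A0) H1) _; rewrite le_eqVlt; apply/orP; left; apply/eqP; ring.
have B2 : cmod L * cmod h * cmod (f (a + h) - f a) <= e * A ^+ 3 / 4 * cmod h.
  rewrite -mulrA mulrCA mulrC; apply: ler_wpM2r => //.
  rewrite ler_pdivlMr // in H2; apply: le_trans H2; rewrite mulrC.
  by apply: ler_wpM2l; [exact: cmod_ge0|rewrite lerDl].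
have B3 : e * A ^+ 3 / 2 * cmod h <= e * cmod h * (A ^+ 2 * cmod (f (a + h))).
  have -> : e * A ^+ 3 / 2 * cmod h = e * cmod h * (A ^+ 2 * (A / 2)) by ring.
  apply: ler_wpM2l; first by rewrite mulr_ge0 // ltW.
  by apply: ler_wpM2l => //; rewrite exprn_ge0 // ltW.
lra.
Qed.

Lemma cdiff_eq f a L L' : cdiff f a L -> L = L' -> cdiff f a L'.
Proof. by move=> H <-. Qed.

Lemma cdiff_near f g a L (d : R) : 0 < d ->
  (forall h, cmod h < d -> f (a + h) = g (a + h)) -> cdiff f a L -> cdiff g a L.
Proof.
move=> d0 fg H e e0; have [d1 d10 H1] := H _ e0.
exists (Order.min d d1); first by rewrite lt_min d0.
move=> h; rewrite lt_min => /andP[hd hd1].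
by rewrite -fg // -{2}(addr0 a) -fg ?cmod0 // addr0; exact: H1.
Qed.

Lemma cdiffX f a L n : cdiff f a L -> cdiff (fun x => f x ^+ n) a (L * f a ^+ n.-1 *+ n).
Proof.
move=> H; elim: n => [|n IHn]; first exact: cdiff_cst.
apply: (@cdiff_near (fun x => f x * f x ^+ n) _ _ _ 1) => //.
  by move=> h _; rewrite exprS.
apply: cdiff_eq (cdiffM H IHn) _ => /=.
case: n {IHn} => [|n]; first by rewrite !mulr0n mulr0 addr0 mulr1n.
by rewrite /= mulrnAr mulrCA -exprS [RHS]mulrS.
Qed.

Lemma cdiff_sum (I : Type) (s : seq I) (P : pred I) (f : I -> C -> C) a (L : I -> C) :
  (forall i, P i -> cdiff (f i) a (L i)) ->
  cdiff (fun x => \sum_(i <- s | P i) f i x) a (\sum_(i <- s | P i) L i).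
Proof.
move=> H; elim: s => [|i s IHs].
  rewrite big_nil; apply: (cdiff_near (d := 1)) (cdiff_cst 0 a) => //.
  by move=> h _; rewrite big_nil.
rewrite big_cons; case: ifPn => Pi.
  apply: (cdiff_near (d := 1)) (cdiffD (H i Pi) IHs) => //.
  by move=> h _; rewrite big_cons Pi.
by apply: (cdiff_near (d := 1)) IHs => // h _; rewrite big_cons (negbTE Pi).
Qed.

End ComplexDerivative.

(** * Cauchy's theorem and Taylor expansions *)

Section SegmentIntegral.
Variable R : realType.
Local Notation C := R[i].
Implicit Types (G H : R -> C) (u v w : C).

Definition rdiff G (t : R) (L : C) := forall e : R, 0 < e ->
  exists2 d : R, 0 < d & forall h : R, `|h| < d ->
    cmod (G (t + h) - G t - L * h%:C%C) <= e * `|h|.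

Lemma rdiff_real (g : R -> R) (t L : R) :
  (forall e : R, 0 < e -> exists2 d : R, 0 < d & forall h : R, `|h| < d ->
    `|g (t + h) - g t - L * h| <= e * `|h|) <-> is_derive t 1 g L.
Proof.
split => [H|[/cvg_ex [l Hl]] Le].
  have cv : (fun h : R => h^-1 *: (g (h *: (1 : R) + t) - g t)) @ 0^' --> L.
    apply/(@cvgrPdist_lt _ _ _ (0 : R)^') => e e0; rewrite near_withinE.
    have [d d0 Hd] := H _ (half_pos e0).
    apply/nbhs_ballP; exists d => // h; rewrite /ball /= sub0r normrN => hd h0.
    rewrite -(ltr_pM2l (_ : 0 < `|h|)) ?normr_gt0 // -normrM mulrBr.
    rewrite /GRing.scale /= mulr1 mulVKf // (addrC h) mulrC distrC.
    apply: le_lt_trans (Hd _ hd) _.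
    by rewrite mulrC ltr_pM2l ?normr_gt0 // half_lt.
  by apply: DeriveDef; [apply/cvg_ex; exists L|exact/cvg_lim].
move: Le; rewrite /derive (cvg_lim _ Hl) // => <-.
move=> e e0.
move/(@cvgrPdist_lt _ _ _ (0 : R)^')/(_ _ e0): Hl.
rewrite near_withinE => /nbhs_ballP [d /= d0 Hd].
exists d => // h hd; have [->|h0] := eqVneq h 0.
  by rewrite addr0 subrr mulr0 subr0 normr0 mulr0.
have := Hd h; rewrite /ball /= sub0r normrN => /(_ hd h0).
rewrite -(ltr_pM2l (_ : 0 < `|h|)) ?normr_gt0 // -normrM mulrBr.
rewrite /GRing.scale /= mulr1 mulVKf // (addrC h) (mulrC h l) distrC (mulrC e).
exact: ltW.
Qed.

Lemma rdiff_lin (k : C) G t L : rdiff G t L ->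
  is_derive t 1 (fun x => complex.Re (k * G x)) (complex.Re (k * L)).
Proof.
move=> H; apply/rdiff_real => e e0.
have k1 : 0 < cmod k + 1 by rewrite ltr_wpDl ?cmod_ge0.
have [d d0 Hd] := H _ (divr_gt0 e0 k1).
exists d => // h /Hd {}Hd.
have -> : complex.Re (k * G (t + h)) - complex.Re (k * G t) - complex.Re (k * L) * h
  = complex.Re (k * (G (t + h) - G t - L * h%:C%C)) by rewrite !ReImE /=; ring.
apply: le_trans (normr_Re_le _) _; rewrite cmodM.
rewrite mulrAC ler_pdivlMr // in Hd.
by apply: le_trans Hd; rewrite mulrC ler_wpM2l ?cmod_ge0 // lerDl.
Qed.

Lemma rdiff_pair (gr gi : R -> R) (t lr li : R) :
  is_derive t 1 gr lr -> is_derive t 1 gi li ->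
  rdiff (fun x => Complex (gr x) (gi x)) t (Complex lr li).
Proof.
move=> /rdiff_real Hr /rdiff_real Hi e e0.
have [d d0 Hd] := Hr _ (half_pos e0); have [d' d'0 Hd'] := Hi _ (half_pos e0).
exists (Order.min d d') => [|h]; first by rewrite lt_min d0.
rewrite lt_min => /andP[/Hd {}Hd /Hd' {}Hd'].
apply: le_trans (cmod_leD _) _.
rewrite !ReImE /= !mulr0 subr0 add0r; lra.
Qed.

(** The mean value theorem fails for complex values. It is applied to Re (k H) with k the conjugate
    of the increment, for which Re (k (H 1 - H 0)) = |H 1 - H 0|^2. *)
Lemma rdiff_mean_value H h (M : R) :
  (forall t, 0 <= t <= 1 -> rdiff H t (h t) /\ cmod (h t) <= M) ->
  cmod (H 1 - H 0) <= M.
Proof.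
move=> HH; have [->|n0] := eqVneq (H 1 - H 0) 0.
  by rewrite cmod0; apply: le_trans (cmod_ge0 (h 0)) (HH 0 _).2; rewrite lexx ler01.
set k := conjc (H 1 - H 0).
have [c cI] : exists2 c, c \in `]0, 1[%R &
    complex.Re (k * H 1) - complex.Re (k * H 0) = complex.Re (k * h c) * (1 - 0).
  apply: (@MVT _ (fun x => complex.Re (k * H x)) (fun x => complex.Re (k * h x))) => //.
    move=> x; rewrite in_itv /= => /andP[x0 x1].
    by apply: rdiff_lin; apply: (HH x _).1; rewrite !ltW.
  apply: continuous_in_subspaceT => x; rewrite inE /= in_itv /= => xI.
  have D := rdiff_lin k (HH x xI).1.
  by apply: differentiable_continuous; apply/derivable1_diffP; case: D.
rewrite subr0 mulr1 => E.
move: cI; rewrite in_itv /= => /andP[c0 c1].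
have cM : cmod (h c) <= M by apply: (HH c _).2; rewrite !ltW.
have E2 : cmod (H 1 - H 0) ^+ 2 = complex.Re (k * h c).
  by rewrite -E cmod_sqr /k; case: (H 1) (H 0) => [a b] [a' b'] /=; ring.
have : cmod (H 1 - H 0) ^+ 2 <= cmod (H 1 - H 0) * M.
  rewrite E2; apply: le_trans (ler_norm _) _; apply: le_trans (normr_Re_le _) _.
  by rewrite cmodM cmod_conj ler_wpM2l ?cmod_ge0.
by rewrite expr2 ler_pM2l // cmod_gt0.
Qed.

(** The integral starts at -1 and is considered up to 2, so that 0 and 1 are interior points and the
    derivative there is two-sided. *)
Lemma primitive_real (g : R -> R) : continuous g ->
  exists F : R -> R, forall t : R, 0 <= t <= 1 -> is_derive t 1 F (g t).
Proof.
move=> cg; exists (fun x => (\int[lebesgue_measure]_(t in [set` `[-1, x]]) (g t))%R).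
move=> t /andP[t0 t1].
have [||||D1 D2] := @continuous_FTC1_closed R g (-1) t 2.
- lra.
- by apply: continuous_compact_integrable; [exact: segment_compact|exact: continuous_subspaceT].
- lra.
- exact: cg.
by apply: DeriveDef; [exact: D1|rewrite -derive1E; exact: D2].
Qed.

(** Composition with this retraction onto [0, 1] extends a function continuous on [0, 1] to one
    continuous on the whole line. *)
Definition clamp (t : R) : R := Order.max 0 (Order.min 1 t).

Lemma clamp_id t : 0 <= t <= 1 -> clamp t = t.
Proof. by move=> /andP[t0 t1]; rewrite /clamp min_r // max_r. Qed.

Lemma clamp01 t : 0 <= clamp t <= 1.
Proof. by rewrite /clamp le_max lexx /= ge_max ler01 ge_min lexx. Qed.

Lemma clamp_lip s t : `|clamp s - clamp t| <= `|s - t|.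
Proof.
rewrite /clamp !maxEle !minEle.
have := ler_norm (s - t); have := ler_norm (t - s); rewrite (distrC t s) => ? ?.
case: (leP 1 s) => ?; case: (leP 1 t) => ?; rewrite ?ler10 ?ler01.
all: try (case: (leP 0 s) => ?); try (case: (leP 0 t) => ?).
all: rewrite ?subrr ?normr0 ?normr_ge0 // ler_norml; apply/andP; split; lra.
Qed.

Lemma primitive_exists (g : R -> C) :
  (forall t, 0 <= t <= 1 -> forall e : R, 0 < e -> exists2 d : R, 0 < d & forall s,
     0 <= s <= 1 -> `|s - t| < d -> cmod (g s - g t) <= e) ->
  exists G, forall t, 0 <= t <= 1 -> rdiff G t (g t).
Proof.
move=> cg.
have cc (k : C -> R) : (forall a b, `|k a - k b| <= cmod (a - b)) ->
    continuous (fun t => k (g (clamp t))).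
  move=> kl t; apply/(@cvgrPdist_le _ _ _ (nbhs t)) => e e0.
  have [d d0 Hd] := cg _ (clamp01 t) _ e0.
  apply/nbhs_ballP; exists d => // s; rewrite /ball /= => st.
  apply: le_trans (kl _ _) _; rewrite cmodC; apply: Hd; first exact: clamp01.
  by apply: le_lt_trans (clamp_lip _ _) _; rewrite distrC.
have [|Fr HFr] := primitive_real (cc (@complex.Re R) _).
  by move=> a b; rewrite -Re_opp -Re_add normr_Re_le.
have [|Fi HFi] := primitive_real (cc (@complex.Im R) _).
  by move=> a b; rewrite -Im_opp -Im_add normr_Im_le.
exists (fun x => Complex (Fr x) (Fi x)) => t t01.
have -> : g t = Complex (complex.Re (g (clamp t))) (complex.Im (g (clamp t))).
  by rewrite clamp_id //; case: (g t).
by apply: rdiff_pair; [exact: HFr|exact: HFi].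
Qed.

Definition seg u v (t : R) : C := u + t%:C%C * (v - u).

Lemma seg0 u v : seg u v 0 = u. Proof. by rewrite /seg rmorph0 mul0r addr0. Qed.

Lemma seg1 u v : seg u v 1 = v. Proof. by rewrite /seg rmorph1 mul1r addrC subrK. Qed.

(* The integral of [f] from [u] to [v] is the increment of a primitive along the segment; junk if there is none. *)
Definition sint (f : C -> C) u v : C :=
  let G := xget (fun=> 0) [set G | forall t, 0 <= t <= 1 -> rdiff G t (f (seg u v t) * (v - u))] in
  G 1 - G 0.

Definition seg_cont (f : C -> C) u v := forall t, 0 <= t <= 1 -> ccont f (seg u v t).

(** Makes [sint] independent of the primitive chosen: the difference of two primitives has
    derivative 0, and the mean value inequality applies with bound 0. *)
Lemma rdiff_uniq_diff G H h : (forall t, 0 <= t <= 1 -> rdiff G t (h t)) ->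
  (forall t, 0 <= t <= 1 -> rdiff H t (h t)) -> G 1 - G 0 = H 1 - H 0.
Proof.
move=> HG HH; have : cmod ((G 1 - H 1) - (G 0 - H 0)) <= 0.
  apply: (@rdiff_mean_value (fun x => G x - H x) (fun=> 0)) => t t01.
  split; last by rewrite cmod0.
  move=> e e0; have [d d0 Hd] := HG t t01 _ (half_pos e0).
  have [d' d'0 Hd'] := HH t t01 _ (half_pos e0).
  exists (Order.min d d') => [|x]; first by rewrite lt_min d0.
  rewrite lt_min => /andP[/Hd {}Hd /Hd' {}Hd'].
  have -> : G (t + x) - H (t + x) - (G t - H t) - 0 * x%:C%C =
    (G (t + x) - G t - h t * x%:C%C) - (H (t + x) - H t - h t * x%:C%C) by ring.
  by apply: le_trans (cmodB _ _) _; lra.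
have -> : G 1 - H 1 - (G 0 - H 0) = G 1 - G 0 - (H 1 - H 0) by ring.
move=> le0; apply/eqP; rewrite -subr_eq0 -cmod_eq0; apply/eqP/le_anti.
by rewrite le0 cmod_ge0.
Qed.

Lemma sint_prim f u v : seg_cont f u v ->
  exists2 G, (forall t, 0 <= t <= 1 -> rdiff G t (f (seg u v t) * (v - u))) &
    sint f u v = G 1 - G 0.
Proof.
move=> cf; rewrite /sint.
have : exists G, forall t, 0 <= t <= 1 -> rdiff G t (f (seg u v t) * (v - u)).
  apply: primitive_exists => t t01 e e0.
  have p : 0 < cmod (v - u) + 1 by rewrite ltr_wpDl ?cmod_ge0.
  have [d d0 Hd] := cf t t01 _ (divr_gt0 e0 p).
  exists (d / (cmod (v - u) + 1)); first exact: divr_gt0.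
  move=> s _; rewrite ltr_pdivlMr // => st.
  rewrite -mulrBl cmodM.
  have E : seg u v s = seg u v t + (s - t)%:C%C * (v - u).
    by rewrite /seg rmorphB /=; ring.
  have : cmod (f (seg u v s) - f (seg u v t)) <= e / (cmod (v - u) + 1).
    rewrite E; apply: Hd; rewrite cmodM cmod_real; apply: le_lt_trans st.
    by rewrite ler_wpM2l // lerDl.
  rewrite ler_pdivlMr // => {Hd}; apply: le_trans.
  by rewrite ler_wpM2l ?cmod_ge0 // lerDl.
by move=> exG; eexists; [exact: (xgetPex (fun=> 0) exG)|].
Qed.

Lemma sintE f u v G : (forall t, 0 <= t <= 1 -> rdiff G t (f (seg u v t) * (v - u))) ->
  sint f u v = G 1 - G 0.
Proof.
move=> HG; rewrite /sint; case: xgetP => [H -> /= HH|/(_ G)//].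
exact: rdiff_uniq_diff HH HG.
Qed.

Lemma rdiffD G H t L M : rdiff G t L -> rdiff H t M -> rdiff (fun x => G x + H x) t (L + M).
Proof.
move=> HG HH e e0; have [d d0 Hd] := HG _ (half_pos e0).
have [d' d'0 Hd'] := HH _ (half_pos e0).
exists (Order.min d d') => [|x]; first by rewrite lt_min d0.
rewrite lt_min => /andP[/Hd {}Hd /Hd' {}Hd'].
have -> : G (t + x) + H (t + x) - (G t + H t) - (L + M) * x%:C%C =
  (G (t + x) - G t - L * x%:C%C) + (H (t + x) - H t - M * x%:C%C) by ring.
by apply: le_trans (cmodD _ _) _; lra.
Qed.

Lemma rdiffZ c G t L : rdiff G t L -> rdiff (fun x => c * G x) t (c * L).
Proof.
move=> H e e0; have p : 0 < cmod c + 1 by rewrite ltr_wpDl ?cmod_ge0.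
have [d d0 Hd] := H _ (divr_gt0 e0 p); exists d => // h /Hd {}Hd.
rewrite -mulrBr -mulrA -mulrBr cmodM.
rewrite mulrAC ler_pdivlMr // in Hd.
by apply: le_trans Hd; rewrite mulrC ler_wpM2l ?cmod_ge0 // lerDl.
Qed.

Lemma rdiff_affine G (a b t : R) L : rdiff G (a + b * t) L ->
  rdiff (fun x => G (a + b * x)) t (L * b%:C%C).
Proof.
move=> H e e0; have p : 0 < `|b| + 1 by rewrite ltr_wpDl.
have [d d0 Hd] := H _ (divr_gt0 e0 p).
exists (d / (`|b| + 1)) => [|h]; first exact: divr_gt0.
rewrite ltr_pdivlMr // => hd.
have hb : `|b * h| <= `|h| * (`|b| + 1) by rewrite normrM mulrC ler_wpM2l // lerDl.
have -> : G (a + b * (t + h)) - G (a + b * t) - L * b%:C%C * h%:C%C =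
   G (a + b * t + b * h) - G (a + b * t) - L * (b * h)%:C%C.
  by rewrite rmorphM mulrA mulrDr addrA.
apply: le_trans (Hd _ (le_lt_trans hb hd)) _.
by rewrite mulrAC ler_pdivrMr // -mulrA ler_pM2l.
Qed.

Lemma rdiff_seg (A : C -> C) u v t L : cdiff A (seg u v t) L ->
  rdiff (fun x => A (seg u v x)) t (L * (v - u)).
Proof.
move=> H e e0; have p : 0 < cmod (v - u) + 1 by rewrite ltr_wpDl ?cmod_ge0.
have [d d0 Hd] := H _ (divr_gt0 e0 p).
exists (d / (cmod (v - u) + 1)) => [|h]; first exact: divr_gt0.
rewrite ltr_pdivlMr // => hd.
have hb : cmod (h%:C%C * (v - u)) <= `|h| * (cmod (v - u) + 1).
  by rewrite cmodM cmod_real ler_wpM2l // lerDl.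
have -> : seg u v (t + h) = seg u v t + h%:C%C * (v - u) by rewrite /seg rmorphD /=; ring.
rewrite -mulrA [(v - u) * _]mulrC.
apply: le_trans (Hd _ (le_lt_trans hb hd)) _.
by rewrite mulrAC ler_pdivrMr // -mulrA ler_pM2l.
Qed.

Lemma sint_cdiff (f A : C -> C) u v :
  (forall t, 0 <= t <= 1 -> cdiff A (seg u v t) (f (seg u v t))) ->
  sint f u v = A v - A u.
Proof.
move=> H; rewrite (@sintE _ _ _ (fun t => A (seg u v t))); last first.
  by move=> t /H; exact: rdiff_seg.
by rewrite seg0 seg1.
Qed.

Lemma sint_bound f u v (M : R) : seg_cont f u v ->
  (forall t, 0 <= t <= 1 -> cmod (f (seg u v t)) <= M) ->
  cmod (sint f u v) <= M * cmod (v - u).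
Proof.
move=> /sint_prim[G HG ->] fM.
apply: (rdiff_mean_value (h := fun t => f (seg u v t) * (v - u))) => t t01; split; first exact: HG.
by rewrite cmodM ler_wpM2r ?cmod_ge0 // fM.
Qed.

Lemma sint_ext f g u v : seg_cont f u v ->
  (forall t, 0 <= t <= 1 -> f (seg u v t) = g (seg u v t)) -> sint f u v = sint g u v.
Proof.
move=> /sint_prim[G HG ->] fg; symmetry; apply: sintE => t t01.
by rewrite -fg //; exact: HG.
Qed.

Lemma sintD f g u v : seg_cont f u v -> seg_cont g u v ->
  sint (fun w => f w + g w) u v = sint f u v + sint g u v.
Proof.
move=> /sint_prim[G HG ->] /sint_prim[H HH ->].
rewrite (@sintE _ _ _ (fun t => G t + H t)); first by ring.
by move=> t t01; rewrite mulrDl; apply: rdiffD; [exact: HG|exact: HH].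
Qed.

Lemma sintZ c f u v : seg_cont f u v -> sint (fun w => c * f w) u v = c * sint f u v.
Proof.
move=> /sint_prim[G HG ->].
rewrite (@sintE _ _ _ (fun t => c * G t)); first by rewrite mulrBr.
by move=> t t01; rewrite -mulrA; apply: rdiffZ; exact: HG.
Qed.

Lemma sint_rev f u v : seg_cont f u v -> sint f v u = - sint f u v.
Proof.
move=> /sint_prim[G HG ->].
rewrite (@sintE _ _ _ (fun t => G (1 + -1 * t))); first by rewrite mulr1 subrr mulr0 addr0 opprB.
move=> t /andP[t0 t1].
have E : seg v u t = seg u v (1 + -1 * t) by rewrite /seg mulN1r rmorphB /=; ring.
have := @rdiff_affine G 1 (-1) t (f (seg u v (1 + -1 * t)) * (v - u)).
rewrite E rmorphN1 mulrN1 -mulrN opprB; apply; apply: HG; apply/andP; split; lra.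
Qed.

Lemma sint_split f u v (s : R) : 0 <= s <= 1 -> seg_cont f u v ->
  sint f u v = sint f u (seg u v s) + sint f (seg u v s) v.
Proof.
move=> /andP[s0 s1] /sint_prim[G HG ->].
rewrite (@sintE _ u _ (fun t => G (0 + s * t))); last first.
  move=> t /andP[t0 t1].
  have -> : seg u (seg u v s) t = seg u v (0 + s * t) by rewrite /seg add0r rmorphM /=; ring.
  have -> : seg u v s - u = (v - u) * s%:C%C by rewrite /seg; ring.
  by rewrite mulrA; apply: rdiff_affine; apply: HG; apply/andP; split; nra.
rewrite (@sintE _ (seg u v s) _ (fun t => G (s + (1 - s) * t))); last first.
  move=> t /andP[t0 t1].
  have -> : seg (seg u v s) v t = seg u v (s + (1 - s) * t).
    by rewrite /seg rmorphD rmorphM rmorphB /=; ring.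
  have -> : v - seg u v s = (v - u) * (1 - s)%:C%C by rewrite /seg rmorphB /=; ring.
  by rewrite mulrA; apply: rdiff_affine; apply: HG; apply/andP; split; nra.
rewrite !mulr1 !mulr0 !add0r !addr0 (addrC s) subrK; ring.
Qed.

Lemma ccont_seg (K : C -> Prop) f u v :
  (forall t, 0 <= t <= 1 -> K (seg u v t)) -> (forall w, K w -> ccont f w) -> seg_cont f u v.
Proof. by move=> Hs Hc t t01; apply/Hc/Hs. Qed.

End SegmentIntegral.

Section GeometricDecay.
Variable R : realType.

Lemma geom_small_gen (q c e : R) : 0 <= q < 1 -> 0 < e -> exists n, c * q ^+ n < e.
Proof.
move=> /andP[q0 q1] e0.
have p : 0 < `|c| + 1 by rewrite ltr_wpDl.
have := @cvg_expr R q; rewrite ger0_norm // => /(_ q1)/(@cvgrPdist_lt _ _ _ _).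
move/(_ _ (divr_gt0 e0 p)) => [N _ /(_ N (leqnn N))] /=.
rewrite sub0r normrN ger0_norm ?exprn_ge0 // ltr_pdivlMr // => H.
exists N; apply: le_lt_trans H; rewrite mulrC; apply: ler_wpM2l; first exact: exprn_ge0.
by apply: le_trans (ler_norm c) _; rewrite lerDl.
Qed.

Lemma geom_small (c e : R) : 0 < e -> exists n, c * 2^-1 ^+ n < e.
Proof. by apply: geom_small_gen; rewrite invr_ge0 ler0n /= invf_lt1 // ltr1n. Qed.

End GeometricDecay.

(** * Goursat's lemma for triangles *)

Section Goursat.
Variable R : realType.
Local Notation C := R[i].
Implicit Types (f : C -> C) (a b c u v w p : C).

Definition mid a b : C := seg a b (1 / 2).

Lemma half01 : 0 <= (1 / 2 : R) <= 1.
Proof. by rewrite divr_ge0 //=; lra. Qed.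

Lemma halfC : ((1 / 2 : R)%:C%C : C) = 2^-1.
Proof. by rewrite rmorphM /= fmorphV rmorph1 mul1r rmorph_nat. Qed.

Lemma midE a b : mid a b = (a + b) / 2.
Proof. by rewrite /mid /seg halfC; field. Qed.

Lemma cmod_half a b : a = b / 2 -> cmod a = cmod b / 2.
Proof.
by move=> ->; rewrite cmodM -halfC cmod_real ger0_norm ?divr_ge0 // div1r.
Qed.

Definition tri f (T : C * C * C) : C :=
  sint f T.1.1 T.1.2 + sint f T.1.2 T.2 + sint f T.2 T.1.1.

Definition perim (T : C * C * C) : R :=
  cmod (T.1.1 - T.1.2) + cmod (T.1.2 - T.2) + cmod (T.2 - T.1.1).

Definition subtri (T : C * C * C) (k : nat) : C * C * C :=
  let: (a, b, c) := T in
  match k with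
  | 0 => (a, mid a b, mid c a)
  | 1 => (mid a b, b, mid b c)
  | 2 => (mid c a, mid b c, c)
  | _ => (mid a b, mid b c, mid c a)
  end.

(** A closed convex set plays the role of the solid triangle: convexity keeps all subdivided
    triangles inside, closedness keeps their limit point inside. It will be a half disc that avoids
    an exceptional point. *)
Variable K : C -> Prop.
Hypothesis K_convex : forall a b t, K a -> K b -> 0 <= t <= 1 -> K (seg a b t).
Hypothesis K_closed : forall p,
  (forall e : R, 0 < e -> exists2 w, K w & cmod (w - p) <= e) -> K p.

Definition Ktri (T : C * C * C) := [/\ K T.1.1, K T.1.2 & K T.2].

Lemma K_mid a b : K a -> K b -> K (mid a b).
Proof. by move=> Ka Kb; apply: K_convex => //; apply/andP; split; lra. Qed.

Lemma Ktri_sub T k : Ktri T -> Ktri (subtri T k).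
Proof. by case: T => [[a b] c] [/= Ka Kb Kc]; case: k => [|[|[|k]]]; split => //=; exact: K_mid. Qed.

Lemma perim_sub T k : perim (subtri T k) = perim T / 2.
Proof.
case: T => [[a b] c]; rewrite /perim.
case: k => [|[|[|k]]] /=; rewrite !mulrDl.
- by congr (_ + _ + _); apply: cmod_half; rewrite !midE; field.
- by congr (_ + _ + _); apply: cmod_half; rewrite !midE; field.
- by congr (_ + _ + _); apply: cmod_half; rewrite !midE; field.
rewrite (cmodC a b) (cmodC b c) (cmodC c a) [RHS]addrC addrA.
by congr (_ + _ + _); apply: cmod_half; rewrite !midE; field.
Qed.

Lemma K_seg_cont f u v : (forall w, K w -> ccont f w) -> K u -> K v -> seg_cont f u v.
Proof. by move=> cf Ku Kv; apply: (@ccont_seg _ K) => // t t01; exact: K_convex. Qed.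

Lemma tri_sub f T : (forall w, K w -> ccont f w) -> Ktri T ->
  tri f T = tri f (subtri T 0) + tri f (subtri T 1) + tri f (subtri T 2) + tri f (subtri T 3).
Proof.
move=> cf; case: T => [[a b] c] [/= Ka Kb Kc]; rewrite /tri /=.
have h2 := half01.
have Kab := K_mid Ka Kb; have Kbc := K_mid Kb Kc; have Kca := K_mid Kc Ka.
rewrite (sint_split h2 (K_seg_cont cf Ka Kb)) (sint_split h2 (K_seg_cont cf Kb Kc)).
rewrite (sint_split h2 (K_seg_cont cf Kc Ka)) -!/(mid _ _).
rewrite (sint_rev (K_seg_cont cf Kab Kca)) (sint_rev (K_seg_cont cf Kab Kbc)).
rewrite (sint_rev (K_seg_cont cf Kbc Kca)).
ring.
Qed.

Lemma tri_step f T : (forall w, K w -> ccont f w) -> Ktri T ->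
  exists k, cmod (tri f T) / 4 <= cmod (tri f (subtri T k)).
Proof.
move=> cf KT; apply: contrapT => /forallNP H.
have {}H k : cmod (tri f (subtri T k)) < cmod (tri f T) / 4 by rewrite ltNge; apply/negP.
have := cmodD (tri f (subtri T 0) + tri f (subtri T 1) + tri f (subtri T 2)) (tri f (subtri T 3)).
rewrite -tri_sub // => H3.
have H2 := cmodD (tri f (subtri T 0) + tri f (subtri T 1)) (tri f (subtri T 2)).
have H1 := cmodD (tri f (subtri T 0)) (tri f (subtri T 1)).
have := H 0%N; have := H 1%N; have := H 2%N; have := H 3%N.
move: H1 H2 H3; move: (cmod (tri f T)) (cmod (tri f _)) (cmod (tri f _)) (cmod (tri f _)) (cmod (tri f _)).
move: (cmod _) (cmod _) => x1 x2 x3 x4 x5 x6 x7; lra.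
Qed.

Lemma perim_ge0 T : 0 <= perim T.
Proof. by rewrite !addr_ge0 ?cmod_ge0. Qed.

Lemma subtri_vertex T k : cmod ((subtri T k).1.1 - T.1.1) <= perim T.
Proof.
case: T => [[a b] c] /=.
have := cmod_ge0 (a - b); have := cmod_ge0 (b - c); have := cmod_ge0 (c - a); rewrite /perim /= => h1 h2 h3.
have E1 : cmod (mid a b - a) = cmod (a - b) / 2.
  by rewrite cmodC; apply: cmod_half; rewrite midE; field.
have E2 : cmod (mid c a - a) = cmod (c - a) / 2.
  by apply: cmod_half; rewrite midE; field.
case: k => [|[|[|k]]] /=; rewrite ?subrr ?cmod0 ?E1 ?E2; lra.
Qed.

(** The intervals with centre x_n and radius 2p/2^n, the sum of the remaining steps, are nested; the
    limit is the supremum of their left ends. *)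
Lemma geometric_limit_real (x : nat -> R) (p : R) :
  (forall n, `|x n.+1 - x n| <= p / 2 ^+ n) -> exists l, forall n, `|x n - l| <= 2 * p / 2 ^+ n.
Proof.
move=> H.
pose y n := x n - 2 * p / 2 ^+ n; pose z n := x n + 2 * p / 2 ^+ n.
have p2 n : p / 2 ^+ n = 2 * (p / 2 ^+ n.+1) by rewrite exprS; field; rewrite expf_neq0.
have yS n : y n <= y n.+1.
  rewrite /y -!mulrA; have := H n; rewrite ler_norml (p2 n) => /andP[]; lra.
have zS n : z n.+1 <= z n.
  rewrite /z -!mulrA; have := H n; rewrite ler_norml (p2 n) => /andP[]; lra.
have ym m n : (m <= n)%N -> y m <= y n.
  by move=> /subnKC <-; elim: (n - m)%N => [|k IHk]; rewrite ?addn0 // addnS; apply: le_trans IHk _.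
have zm m n : (m <= n)%N -> z n <= z m.
  by move=> /subnKC <-; elim: (n - m)%N => [|k IHk]; rewrite ?addn0 // addnS; apply: le_trans IHk.
have p0 : 0 <= p by have := le_trans (normr_ge0 _) (H 0%N); rewrite expr0 divr1.
have yz n : y n <= z n.
  have : 0 <= 2 * p / 2 ^+ n by rewrite divr_ge0 ?exprn_ge0 // mulr_ge0.
  rewrite /y /z; lra.
have yzmn m n : y m <= z n.
  case: (leqP m n) => [mn|/ltnW nm]; first exact: le_trans (ym _ _ mn) (yz n).
  exact: le_trans (yz m) (zm _ _ nm).
pose S := [set t | exists n, t = y n].
have S0 : S !=set0 by exists (y 0%N), 0%N.
have Sub n : ubound S (z n) by move=> _ [m ->]; exact: yzmn.
exists (sup S) => n; rewrite ler_norml; apply/andP; split.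
  have : sup S <= z n by apply: ge_sup => //; exact: Sub.
  rewrite /z; lra.
have : y n <= sup S by apply: ub_le_sup; [exists (z 0%N); exact: Sub|exists n].
rewrite /y; lra.
Qed.

Lemma geometric_limit (x : nat -> C) (p : R) :
  (forall n, cmod (x n.+1 - x n) <= p / 2 ^+ n) -> exists l, forall n, cmod (x n - l) <= 4 * p / 2 ^+ n.
Proof.
move=> H.
have [n|lr Hr] := @geometric_limit_real (fun n => complex.Re (x n)) p.
  by rewrite -Re_opp -Re_add; exact: le_trans (normr_Re_le _) (H n).
have [n|li Hi] := @geometric_limit_real (fun n => complex.Im (x n)) p.
  by rewrite -Im_opp -Im_add; exact: le_trans (normr_Im_le _) (H n).
exists (Complex lr li) => n; apply: le_trans (cmod_leD _) _.
rewrite !ReImE /=; have := Hr n; have := Hi n; rewrite -!mulrA; lra.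
Qed.

(** The affine part f(p) + L(w - p) has the primitive [A], so its integral over the closed triangle
    is 0 and only the remainder contributes. *)
Lemma goursat_bound f p L (e r : R) T : Ktri T -> (forall w, K w -> ccont f w) ->
  (forall w, K w -> cmod (w - p) <= r -> cmod (f w - f p - L * (w - p)) <= e * r) ->
  cmod (T.1.1 - p) <= r -> cmod (T.1.2 - p) <= r -> cmod (T.2 - p) <= r ->
  cmod (tri f T) <= e * r * perim T.
Proof.
case: T => [[a b] c] [/= Ka Kb Kc] cf Hr ra rb rc; rewrite /tri /perim /=.
pose A w : C := f p * w + L * ((w - p) ^+ 2 / 2).
pose g w : C := f p + L * (w - p).
have dA w : cdiff A w (g w).
  have -> : g w = f p * 1 + L * ((1 - 0) * (w - p) ^+ 1 *+ 2 / 2 + (w - p) ^+ 2 * 0).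
    by rewrite /g mulr2n; field.
  apply: cdiffD; first exact/cdiffZ/cdiff_id.
  apply/cdiffZ/cdiffM; last exact: cdiff_cst.
  apply: (@cdiffX _ (fun w => w - p) w (1 - 0) 2).
  by apply: cdiffD; [exact: cdiff_id|exact/cdiffN/cdiff_cst].
have cg w : ccont g w.
  apply: (@cdiff_cont _ _ _ (0 + L * (1 - 0))).
  apply: cdiffD; first exact: cdiff_cst.
  by apply/cdiffZ/cdiffD; [exact: cdiff_id|exact/cdiffN/cdiff_cst].
have sd u v : K u -> K v -> cmod (u - p) <= r -> cmod (v - p) <= r ->
    cmod (sint f u v - (A v - A u)) <= e * r * cmod (u - v).
  move=> Ku Kv ru rv.
  have cfuv := K_seg_cont cf Ku Kv.
  have cguv : seg_cont g u v by move=> t _.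
  have cg' : seg_cont (fun w => -1 * g w) u v.
    move=> t _; apply: (@cdiff_cont _ _ _ (-1 * (0 + L * (1 - 0)))); apply/cdiffZ.
    apply: cdiffD; first exact: cdiff_cst.
    by apply/cdiffZ/cdiffD; [exact: cdiff_id|exact/cdiffN/cdiff_cst].
  rewrite -(sint_cdiff (f := g)); last by move=> t _; exact: dA.
  rewrite -mulN1r -(sintZ _ cguv) -sintD // (cmodC u).
  apply: sint_bound => [t t01|t t01].
    move=> e' e'0; have [d d0 Hd] := cfuv t t01 _ (half_pos e'0).
    have [d' d'0 Hd'] := cg' t t01 _ (half_pos e'0).
    exists (Order.min d d') => [|h]; first by rewrite lt_min d0.
    rewrite lt_min => /andP[/Hd {}Hd /Hd' {}Hd'].
    set F1 := f _; set G1 := -1 * g _; set F2 := f _; set G2 := -1 * g _.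
    have -> : F1 + G1 - (F2 + G2) = (F1 - F2) + (G1 - G2) by ring.
    by apply: le_trans (cmodD _ _) _; lra.
  have -> : f (seg u v t) + -1 * g (seg u v t) =
    f (seg u v t) - f p - L * (seg u v t - p) by rewrite /g; ring.
  apply: Hr; first exact: K_convex.
  have -> : seg u v t - p = (1 - t)%:C%C * (u - p) + t%:C%C * (v - p).
    by rewrite /seg rmorphB /=; ring.
  move: t01 => /andP[t0 t1].
  apply: le_trans (cmodD _ _) _; rewrite !cmodM !cmod_real !ger0_norm ?subr_ge0 //.
  nra.
set s1 := sint f a b; set s2 := sint f b c; set s3 := sint f c a.
have -> : s1 + s2 + s3 = (s1 - (A b - A a)) + (s2 - (A c - A b)) + (s3 - (A a - A c)) by ring.
have h1 := sd a b Ka Kb ra rb; have h2 := sd b c Kb Kc rb rc; have h3 := sd c a Kc Ka rc ra.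
apply: le_trans (cmodD _ _) _; apply: le_trans (lerD (cmodD _ _) (lexx _)) _.
rewrite !mulrDr; exact: lerD (lerD h1 h2) h3.
Qed.

Lemma goursat f T : (forall w, K w -> exists L, cdiff f w L) -> Ktri T -> tri f T = 0.
Proof.
move=> df KT.
have cf w : K w -> ccont f w by move=> /df[L]; exact: cdiff_cont.
have stepP (S : C * C * C) : exists S', Ktri S -> [/\ Ktri S', perim S' = perim S / 2,
    cmod (tri f S) / 4 <= cmod (tri f S') & cmod (S'.1.1 - S.1.1) <= perim S].
  have [KS|nKS] := pselect (Ktri S); last by exists S.
  have [k Hk] := tri_step cf KS; exists (subtri S k) => _; split => //.
  - exact: Ktri_sub.
  - exact: perim_sub.
  - exact: subtri_vertex.
have [next Hnext] := choice stepP.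
pose S n := iter n next T.
have KS n : Ktri (S n).
  by elim: n => [|n IHn] //; rewrite /S iterS; case: (Hnext (S n) IHn).
have pS n : perim (S n) = perim T / 2 ^+ n.
  elim: n => [|n IHn]; first by rewrite expr0 divr1.
  rewrite /S iterS; case: (Hnext (S n) (KS n)) => _ -> _ _.
  by rewrite IHn exprS; field; rewrite expf_neq0.
have tS n : cmod (tri f T) / 4 ^+ n <= cmod (tri f (S n)).
  elim: n => [|n IHn]; first by rewrite expr0 divr1.
  rewrite [S n.+1]/S iterS; case: (Hnext (S n) (KS n)) => _ _ + _; apply: le_trans.
  rewrite exprSr invfM mulrA ler_pM2r //; lra.
have [|p Hp] := @geometric_limit (fun n => (S n).1.1) (perim T).
  move=> n; rewrite -pS [S n.+1]/S iterS; by case: (Hnext (S n) (KS n)).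
have Kp : K p.
  apply: K_closed => e e0; have [n Hn] := geom_small (4 * perim T) e0.
  exists (S n).1.1; first by case: (KS n).
  by rewrite exprVn in Hn; exact: le_trans (Hp n) (ltW Hn).
have [L HL] := df p Kp.
apply/eqP; rewrite -cmod_eq0; apply/eqP/le_anti; rewrite cmod_ge0 andbT leNgt; apply/negP => X0.
set X := cmod (tri f T) in X0; set P := perim T.
have P0 : 0 <= P := perim_ge0 T.
(* The first vertex of the n-th triangle lies within 4P/2^n of p and the other two within one
   perimeter more, whence the radius 5P/2^n. With tolerance X/(5P^2+1) the integral is at most X
   5P^2/(5P^2+1)/4^n, less than the lower bound X/4^n. *)
have q0 : 0 < 5 * P ^+ 2 + 1 by have := sqr_ge0 P; lra.
have [d d0 Hd] := HL _ (divr_gt0 X0 q0).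
have [n Hn] := geom_small (5 * P) d0.
set r := 5 * P * 2^-1 ^+ n in Hn.
have rE : r = 5 * (P / 2 ^+ n) by rewrite /r exprVn mulrA.
have an : cmod ((S n).1.1 - p) <= 4 * (P / 2 ^+ n) by rewrite mulrA.
have : cmod (tri f (S n)) <= X / (5 * P ^+ 2 + 1) * r * perim (S n).
  have := pS n; rewrite -/P; have := KS n; move: an; case: (S n) => [[a b] c] /= an Kabc pn.
  have [h1 h2 h3] : [/\ 0 <= cmod (a - b), 0 <= cmod (b - c) & 0 <= cmod (c - a)] by rewrite !cmod_ge0.
  apply: (@goursat_bound _ p L) => //=.
  - move=> w Kw wr; have := Hd (w - p); rewrite subrKC => H.
    apply: le_trans (H (le_lt_trans wr Hn)) _.
    by apply: ler_wpM2l => //; rewrite divr_ge0 ?ltW.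
  - rewrite rE; have : 0 <= P / 2 ^+ n by rewrite -pn perim_ge0.
    lra.
  - have -> : b - p = (a - p) - (a - b) by ring.
    apply: le_trans (cmodB _ _) _; rewrite rE -pn in an *; rewrite /perim /= in an *; lra.
  have -> : c - p = (a - p) + (c - a) by ring.
  apply: le_trans (cmodD _ _) _; rewrite rE -pn in an *; rewrite /perim /= in an *; lra.
move/(le_trans (tS n)); rewrite pS -/P -/X rE.
have -> : X / (5 * P ^+ 2 + 1) * (5 * (P / 2 ^+ n)) * (P / 2 ^+ n) =
   X / (5 * P ^+ 2 + 1) * (5 * P ^+ 2) / 4 ^+ n.
  have -> : 4 ^+ n = 2 ^+ n * 2 ^+ n :> R by rewrite -exprMn; congr (_ ^+ n); ring.
  by field; rewrite expf_neq0 //= lt0r_neq0.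
rewrite ler_pM2r ?invr_gt0 ?exprn_gt0 // mulrAC ler_pdivlMr // ler_pM2l //; lra.
Qed.

End Goursat.

(** * Cauchy's theorem on a square, with one exceptional point *)

Section CauchyDiamond.
Variable R : realType.
Local Notation C := R[i].
Implicit Types (f g : C -> C) (a b u v w k : C).

Lemma seg_norm u v (t s : R) : 0 <= t <= 1 -> cmod u <= s -> cmod v <= s -> cmod (seg u v t) <= s.
Proof.
move=> /andP[t0 t1] us vs.
have -> : seg u v t = (1 - t)%:C%C * u + t%:C%C * v by rewrite /seg rmorphB /=; ring.
apply: le_trans (cmodD _ _) _; rewrite !cmodM !cmod_real !ger0_norm ?subr_ge0 //.
nra.
Qed.

(** For d > 0 the half plane excludes a, where the real part is 0; this is the closed convex set to
    which Goursat's lemma is applied near an exceptional point a. *)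
Definition halfdisc (s : R) k a (d : R) w := cmod w <= s /\ d <= complex.Re (k * (w - a)).

Lemma halfdisc_convex s k a d u v t : halfdisc s k a d u -> halfdisc s k a d v ->
  0 <= t <= 1 -> halfdisc s k a d (seg u v t).
Proof.
move=> [us ud] [vs vd] t01; split; first exact: seg_norm.
have -> : k * (seg u v t - a) = (1 - t)%:C%C * (k * (u - a)) + t%:C%C * (k * (v - a)).
  by rewrite /seg rmorphB /=; ring.
rewrite Re_add !(Re_mul _%:C%C) /= !mul0r !subr0.
move: t01 => /andP[t0 t1]; nra.
Qed.

Lemma halfdisc_closed s k a d p :
  (forall e : R, 0 < e -> exists2 w, halfdisc s k a d w & cmod (w - p) <= e) -> halfdisc s k a d p.
Proof.
move=> H; split.
  rewrite leNgt; apply/negP => sp.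
  have [|w [ws _] wp] := H ((cmod p - s) / 2); first by lra.
  have := cmodD_ge p (w - p); rewrite subrKC; lra.
rewrite leNgt; apply/negP => sp.
set e := d - complex.Re (k * (p - a)).
have k1 : 0 < cmod k + 1 by rewrite ltr_wpDl ?cmod_ge0.
have e0 : 0 < e / 2 by rewrite /e; lra.
have [|w [_ wd] wp] := H (e / 2 / (cmod k + 1)); first exact: divr_gt0.
have : complex.Re (k * (w - a)) - complex.Re (k * (p - a)) <= e / 2.
  rewrite -Re_opp -Re_add.
  have -> : k * (w - a) - k * (p - a) = k * (w - p) by ring.
  apply: le_trans (ler_norm _) _; apply: le_trans (normr_Re_le _) _; rewrite cmodM.
  rewrite ler_pdivlMr // in wp; apply: le_trans wp; rewrite mulrC.
  by apply: ler_wpM2l; [exact: cmod_ge0|rewrite lerDl].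
rewrite /e in wp e0 *; lra.
Qed.

(** Shrinking u and v towards a by the factor t removes a quadrilateral, cut into two triangles that
    stay in a half disc away from a; both have integral 0 by Goursat. The remaining small triangle
    has integral O(t), because f is bounded near a. *)
Lemma tri_exceptional f (s r : R) k a u v : s < r ->
  (forall w, cmod w < r -> ccont f w) ->
  (forall w, cmod w < r -> w != a -> exists L, cdiff f w L) ->
  cmod u <= s -> cmod v <= s -> cmod a <= s ->
  0 < complex.Re (k * (u - a)) -> 0 < complex.Re (k * (v - a)) ->
  tri f (u, v, a) = 0.
Proof.
move=> sr cf df us vs as_ ku kv.
have cs x y : cmod x <= s -> cmod y <= s -> seg_cont f x y.
  move=> xs ys t t01; apply: cf; apply: le_lt_trans sr; exact: seg_norm.
have shrink (t : R) : 0 < t -> t <= 1 ->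
    tri f (u, v, a) = tri f (seg a u t, seg a v t, a).
  move=> t0 t1; have t01 : 0 <= t <= 1 by rewrite ltW.
  set u' := seg a u t; set v' := seg a v t.
  have u's : cmod u' <= s by apply: seg_norm.
  have v's : cmod v' <= s by apply: seg_norm.
  pose d := t * Order.min (complex.Re (k * (u - a))) (complex.Re (k * (v - a))).
  have d0 : 0 < d by rewrite mulr_gt0 // lt_min ku.
  have dE x : k * (seg a x t - a) = t%:C%C * (k * (x - a)) by rewrite /seg; ring.
  have [m1 m2] : d <= t * complex.Re (k * (u - a)) /\ d <= t * complex.Re (k * (v - a)).
    by split; apply: ler_wpM2l; rewrite ?(ltW t0) // ge_min lexx ?orbT.
  have hd w : halfdisc s k a d w -> exists L, cdiff f w L.
    move=> [ws wd]; apply: df; first exact: le_lt_trans ws sr.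
    by apply: contraL d0 => /eqP wa; rewrite wa subrr mulr0 /= in wd; rewrite -leNgt.
  have Hu : halfdisc s k a d u by split => //; apply: le_trans m1 _; nra.
  have Hv : halfdisc s k a d v by split => //; apply: le_trans m2 _; nra.
  have Hu' : halfdisc s k a d u' by split => //; rewrite dE Re_mul /= mul0r subr0.
  have Hv' : halfdisc s k a d v' by split => //; rewrite dE Re_mul /= mul0r subr0.
  have G1 : tri f (u, v, v') = 0.
    by apply: (goursat (@halfdisc_convex s k a d) (@halfdisc_closed s k a d)) => //; split.
  have G2 : tri f (u, v', u') = 0.
    by apply: (goursat (@halfdisc_convex s k a d) (@halfdisc_closed s k a d)) => //; split.
  move: G1 G2; rewrite /tri /=.
  rewrite (sint_rev (cs a v _ _)) // (sint_split t01 (cs a v _ _)) // -/v'.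
  rewrite (sint_split t01 (cs a u _ _)) // -/u'.
  rewrite (sint_rev (cs u v' _ _)) // (sint_rev (cs u' v' _ _)) //.
  rewrite (sint_rev (cs v' v _ _)) // (sint_rev (cs a v' _ _)) //.
  move: (sint f u v) (sint f u v') (sint f u' v') (sint f a v') (sint f v' v) (sint f u' u) (sint f a u').
  by move=> x1 x2 x3 x4 x5 x6 x7 E1 E2; rewrite -[LHS]subr0 -{1}E1 -[LHS]subr0 -{1}E2; ring.
have ar : cmod a < r by apply: le_lt_trans sr.
have [d d0 Hd] := cf a ar 1 ltr01.
set B := cmod (f a) + 1; have B0 : 0 < B by rewrite ltr_wpDl ?cmod_ge0.
set P := perim (u, v, a).
have P0 : 0 <= P by exact: perim_ge0.
have bnd (t : R) : 0 < t -> t <= 1 -> t * P < d -> cmod (tri f (u, v, a)) <= B * (t * P).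
  move=> t0 t1 tP; rewrite (shrink t) // /tri /=.
  have t01 : 0 <= t <= 1 by rewrite ltW.
  have u's : cmod (seg a u t) <= s by apply: seg_norm.
  have v's : cmod (seg a v t) <= s by apply: seg_norm.
  have side x : cmod (seg a x t - a) = t * cmod (x - a).
    by rewrite /seg addrC addKr cmodM cmod_real gtr0_norm.
  have side2 x y : cmod (seg a x t - seg a y t) = t * cmod (x - y).
    have -> : seg a x t - seg a y t = t%:C%C * (x - y) by rewrite /seg; ring.
    by rewrite cmodM cmod_real gtr0_norm.
  have au : t * cmod (u - a) <= t * P.
    by rewrite ler_pM2l // /P /perim /= (cmodC a u) lerDr addr_ge0 ?cmod_ge0.
  have av : t * cmod (v - a) <= t * P.
    by rewrite ler_pM2l // /P /perim /= -addrA addrCA lerDl addr_ge0 ?cmod_ge0.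
  have fb w : cmod (w - a) <= t * P -> cmod (f w) <= B.
    move=> wa; have := Hd (w - a) (le_lt_trans wa tP); rewrite subrKC => H.
    have -> : f w = (f w - f a) + f a by ring.
    by apply: le_trans (cmodD _ _) _; rewrite addrC lerD2l.
  have sb x y : cmod x <= s -> cmod y <= s -> cmod (x - a) <= t * P -> cmod (y - a) <= t * P ->
      cmod (sint f x y) <= B * cmod (y - x).
    move=> xs ys xa ya; apply: sint_bound; first exact: cs.
    move=> t' t'01; apply: fb.
    have -> : seg x y t' - a = seg (x - a) (y - a) t' by rewrite /seg; ring.
    exact: seg_norm.
  have aa : cmod (a - a) <= t * P by rewrite subrr cmod0 mulr_ge0 // ltW.
  have h1 := sb (seg a u t) (seg a v t) u's v's.
  have h2 := sb (seg a v t) a v's as_; have h3 := sb a (seg a u t) as_ u's.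
  rewrite !side side2 (cmodC a) !side in h1 h2 h3.
  apply: le_trans (cmodD _ _) _; apply: le_trans (lerD (cmodD _ _) (lexx _)) _.
  apply: le_trans (lerD (lerD (h1 au av) (h2 av aa)) (h3 aa au)) _.
  by rewrite -!mulrDr /P /perim /= (cmodC u v) (cmodC a u).
apply/eqP; rewrite -cmod_eq0; apply/eqP/le_anti; rewrite cmod_ge0 andbT leNgt; apply/negP => X0.
set X := cmod _ in X0 bnd.
(* The second bound keeps the small triangle where f is bounded by B, the third makes its integral
   at most X/2. *)
pose t := Order.min 1 (Order.min (d / 2 / (P + 1)) (X / 2 / (B * (P + 1)))).
have P1 : 0 < P + 1 by rewrite ltr_wpDl.
have BP1 : 0 < B * (P + 1) by rewrite mulr_gt0.
have t0 : 0 < t by rewrite !lt_min ltr01 /= !divr_gt0.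
have tle : t <= d / 2 / (P + 1) by rewrite !ge_min lexx orbT.
have tle2 : t <= X / 2 / (B * (P + 1)) by rewrite !ge_min lexx !orbT.
have t1 : t <= 1 by rewrite ge_min lexx.
rewrite ler_pdivlMr // in tle; rewrite ler_pdivlMr // in tle2.
have : X <= B * (t * P) by apply: bnd => //; nra.
have : B * (t * P) <= t * (B * (P + 1)) by nra.
lra.
Qed.

Variable s : R.
Hypothesis s0 : 0 < s.

Definition dia_vertex (j : nat) : C := s%:C%C * 'i%C ^+ j.

Definition dia_cont f := forall j, (j < 4)%N -> seg_cont f (dia_vertex j) (dia_vertex j.+1).

(* The boundary of the square with vertices s, is, -s, -is replaces the circle, so that only segment integrals occur. *)
Definition dia f : C := \sum_(j < 4) sint f (dia_vertex j) (dia_vertex j.+1).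

Definition on_dia w := exists2 j, (j < 4)%N & exists2 t : R, 0 <= t <= 1 &
  w = seg (dia_vertex j) (dia_vertex j.+1) t.

Lemma dia_vertex4 : dia_vertex 4 = dia_vertex 0.
Proof. by rewrite /dia_vertex expr0 (exprM _ 2 2) sqr_i sqrrN expr1n. Qed.

Lemma cmod_vertex j : cmod (dia_vertex j) = s.
Proof. by rewrite cmodM cmodX cmod_i expr1n mulr1 cmod_real gtr0_norm. Qed.

Lemma seg_vertex j (t : R) :
  seg (dia_vertex j) (dia_vertex j.+1) t = 'i%C ^+ j * (s%:C%C * Complex (1 - t) t).
Proof.
have -> : Complex (1 - t) t = 1 - t%:C%C + t%:C%C * 'i%C.
  by apply: complex_ext; rewrite !ReImE /=; ring.
by rewrite /seg /dia_vertex exprS; ring.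
Qed.

Lemma on_dia_le w : on_dia w -> cmod w <= s.
Proof.
by move=> [j _ [t t01 ->]]; apply: seg_norm => //; rewrite cmod_vertex.
Qed.

(** The square comes as close to 0 as s/sqrt 2; 2/3 is a rational number below 1/sqrt 2, and it
    still exceeds the 1/2 used to bound the evaluation points. *)
Lemma on_dia_ge w : on_dia w -> 2 / 3 * s <= cmod w.
Proof.
move=> [j _ [t t01 ->]]; rewrite seg_vertex cmodM cmodX cmod_i expr1n mul1r.
rewrite cmodM cmod_real gtr0_norm // mulrC ler_pM2l //.
rewrite -(@ler_pXn2r _ 2) ?nnegrE ?cmod_ge0 ?divr_ge0 //.
rewrite cmod_sqr /=; have := sqr_ge0 (t - 1 / 2); nra.
Qed.

Lemma dia_cont_near f : (forall w, on_dia w -> ccont f w) -> dia_cont f.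
Proof. by move=> H j j4 t t01; apply: H; exists j => //; exists t. Qed.

Lemma dia_ext f g : dia_cont f -> (forall w, on_dia w -> f w = g w) -> dia f = dia g.
Proof.
move=> cf fg; apply: eq_bigr => j _; apply: sint_ext; first exact: cf.
by move=> t t01; apply: fg; exists j => //; exists t.
Qed.

Lemma diaD f g : dia_cont f -> dia_cont g -> dia (fun w => f w + g w) = dia f + dia g.
Proof.
move=> cf cg; rewrite /dia -big_split; apply: eq_bigr => j _.
by rewrite sintD //; [exact: cf|exact: cg].
Qed.

Lemma diaZ a f : dia_cont f -> dia (fun w => a * f w) = a * dia f.
Proof.
move=> cf; rewrite /dia mulr_sumr; apply: eq_bigr => j _.
by rewrite sintZ //; exact: cf.
Qed.

(** Four sides, each of length at most 2s by the triangle inequality. *)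
Lemma dia_bound f (M : R) : dia_cont f -> (forall w, on_dia w -> cmod (f w) <= M) ->
  cmod (dia f) <= 8 * s * M.
Proof.
move=> cf fM; apply: le_trans (cmod_sum _ _ _) _.
have -> : 8 * s * M = \sum_(j < 4) (2 * s * M) by rewrite sumr_const card_ord -mulr_natl; ring.
apply: ler_sum => j _; apply: le_trans (sint_bound (cf j (ltn_ord j)) _) _.
  by move=> t t01; apply: fM; exists j => //; exists t.
rewrite mulrC; apply: ler_wpM2r.
  apply: le_trans (cmod_ge0 _) (fM (dia_vertex 0) _).
  by exists 0%N => //; exists 0; rewrite ?lexx ?ler01 ?seg0.
by apply: le_trans (cmodB _ _) _; rewrite !cmod_vertex; lra.
Qed.

Lemma dia_prim f (A : C -> C) : (forall w, on_dia w -> cdiff A w (f w)) -> dia f = 0.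
Proof.
move=> H; rewrite /dia (eq_bigr (fun j : 'I_4 => A (dia_vertex j.+1) - A (dia_vertex j))).
  by rewrite !big_ord_recr big_ord0 /= -dia_vertex4; ring.
by move=> j _; apply: sint_cdiff => t t01; apply: H; exists j => //; exists t.
Qed.

Lemma dia_exceptional g (r : R) a : s < r -> cmod a < s / 2 ->
  (forall w, cmod w < r -> ccont g w) ->
  (forall w, cmod w < r -> w != a -> exists L, cdiff g w L) -> dia g = 0.
Proof.
move=> sr as2 cg dg.
have as_ : cmod a <= s by have := s0; have := as2; lra.
have T j : (j < 4)%N -> tri g (dia_vertex j, dia_vertex j.+1, a) = 0.
  (* The direction normal to the j-th side, which lies on the line Re (k w) = s; since |k a| <= 2|a|
     < s, the point a is strictly on the inner side. *)
  move=> j4; pose k := conjc ('i%C ^+ j * Complex 1 1) : C.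
  have ii : (conjc 'i%C : C) ^+ j * 'i%C ^+ j = 1.
    rewrite -exprMn; have -> : conjc 'i%C * 'i%C = 1 :> C by apply: complex_ext; rewrite /=; ring.
    by rewrite expr1n.
  have kE x : k * ('i%C ^+ j * x) = Complex 1 (-1) * x.
    rewrite /k rmorphM rmorphXn /= mulrACA ii mul1r; congr (_ * _).
  have ka : complex.Re (k * a) < s.
    apply: le_lt_trans (ler_norm _) _; apply: le_lt_trans (normr_Re_le _) _.
    rewrite cmodM /k cmod_conj cmodM cmodX cmod_i expr1n mul1r.
    have : cmod (Complex 1 1 : C) <= 2.
      by apply: le_trans (cmod_leD _) _; rewrite /= normr1.
    have := cmod_ge0 a; nra.
  apply: (@tri_exceptional g s r k) => //; rewrite ?cmod_vertex //.
    have -> : dia_vertex j = 'i%C ^+ j * s%:C%C by rewrite mulrC.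
    rewrite mulrBr kE Re_add Re_opp Re_mul /= mul1r mulr0 subr0; lra.
  have -> : dia_vertex j.+1 = 'i%C ^+ j * ('i%C * s%:C%C) by rewrite /dia_vertex exprS; ring.
  rewrite mulrBr kE Re_add Re_opp.
  have -> : complex.Re (Complex 1 (-1) * ('i%C * s%:C%C)) = s by rewrite !ReImE /=; ring.
  by rewrite subr_gt0.
have cs x y : cmod x <= s -> cmod y <= s -> seg_cont g x y.
  by move=> xs ys t t01; apply: cg; apply: le_lt_trans sr; exact: seg_norm.
have vs j : cmod (dia_vertex j) <= s by rewrite cmod_vertex.
rewrite /dia (eq_bigr (fun j : 'I_4 => sint g a (dia_vertex j.+1) - sint g a (dia_vertex j))).
  by rewrite !big_ord_recr big_ord0 /= -dia_vertex4; ring.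
move=> j _; have := T j (ltn_ord j); rewrite /tri /= (sint_rev (cs a (dia_vertex j.+1) _ _)) //.
by move=> /eqP; rewrite -addrA addr_eq0 => /eqP ->; ring.
Qed.

Lemma on_dia_neq w a : on_dia w -> cmod a < s / 2 -> w != a.
Proof.
move=> /on_dia_ge wg as2; apply: contraTneq wg => ->; rewrite -ltNge.
by have := s0; have := as2; lra.
Qed.

Lemma on_dia_neq0 w : on_dia w -> w != 0.
Proof. by move=> /on_dia_neq; apply; rewrite cmod0 divr_gt0. Qed.

Lemma cdiff_sub_cst a w : cdiff (fun x => x - a) w 1.
Proof. by rewrite -[1]addr0 -[X in 1 + X]oppr0; apply/cdiffD/cdiffN/cdiff_cst; exact: cdiff_id. Qed.

Lemma cdiff_kernel w n : w != 0 -> exists L : C, cdiff (fun x : C => (x ^+ n)^-1) w L.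
Proof.
move=> w0; eexists; apply: cdiffV; first by rewrite expf_neq0.
exact: cdiffX (cdiff_id w).
Qed.

Lemma cdiff_cauchy_kernel w a : w != a -> exists L : C, cdiff (fun x : C => (x - a)^-1) w L.
Proof.
by move=> wa; eexists; apply: cdiffV; [rewrite subr_eq0|exact: cdiff_sub_cst].
Qed.

Lemma ccontM f g w : ccont f w -> ccont g w -> ccont (fun x => f x * g x) w.
Proof. by move=> /ccontP cf /ccontP cg; apply/ccontP; first [exact: (continuousM cf cg)|exact: (cvgM cf cg)]. Qed.

Lemma ccont_kernel w n : w != 0 -> ccont (fun x : C => (x ^+ n)^-1) w.
Proof. by move=> /(cdiff_kernel n)[L]; exact: cdiff_cont. Qed.

Lemma ccont_cauchy_kernel w a : w != a -> ccont (fun x : C => (x - a)^-1) w.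
Proof. by move=> /cdiff_cauchy_kernel[L]; exact: cdiff_cont. Qed.

(* [kappa] is 2 pi i, but only [kappa != 0] is needed. *)
Definition kappa : C := dia (fun w => w^-1).

Lemma rdiff_Re_pos G (h : R -> C) k : (forall t, 0 <= t <= 1 -> rdiff G t (h t)) ->
  (forall t, 0 <= t <= 1 -> 0 < complex.Re (k * h t)) ->
  0 < complex.Re (k * (G 1 - G 0)).
Proof.
move=> HG hp.
have [c cI] : exists2 c, c \in `]0, 1[%R &
    complex.Re (k * G 1) - complex.Re (k * G 0) = complex.Re (k * h c) * (1 - 0).
  apply: (@MVT _ (fun x => complex.Re (k * G x)) (fun x => complex.Re (k * h x))) => //.
    move=> x; rewrite in_itv /= => /andP[x0' x1].
    by apply: rdiff_lin; apply: HG; rewrite !ltW.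
  apply: continuous_in_subspaceT => x; rewrite inE /= in_itv /= => xI.
  have D := rdiff_lin k (HG x xI).
  by apply: differentiable_continuous; apply/derivable1_diffP; case: D.
rewrite subr0 mulr1 mulrBr Re_add Re_opp => ->; apply: hp.
by move: cI; rewrite in_itv /= => /andP[c0 c1]; rewrite !ltW.
Qed.

(** The form dw/w is invariant under rotation by i, so the four sides contribute equally. On one
    side, multiplication by -i gives the integrand the real part 1/((1-t)^2 + t^2) > 0. *)
Lemma kappa_neq0 : kappa != 0.
Proof.
have ci w : on_dia w -> ccont (fun x : C => x^-1) w.
  by move=> /on_dia_neq0 w0; exact: (ccont_kernel 1 w0).
have cf := dia_cont_near ci.
have [G HG E0] := sint_prim (cf 0%N isT).
have key j (t : R) : 0 <= t <= 1 ->
    (seg (dia_vertex j) (dia_vertex j.+1) t)^-1 * (dia_vertex j.+1 - dia_vertex j) =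
    (Complex (1 - t) t)^-1 * ('i%C - 1).
  move=> t01; rewrite seg_vertex /dia_vertex exprS.
  have i0 : 'i%C ^+ j != 0 :> C by rewrite expf_neq0 // -cmod_eq0 cmod_i oner_eq0.
  have sn0 : s%:C%C != 0 :> C by rewrite -cmod_eq0 cmod_real normr_eq0 gt_eqF.
  have t0 : Complex (1 - t) t != 0.
    apply/eqP => -[] h1 h2; move: h1; rewrite h2 subr0 => /eqP; by rewrite oner_eq0.
  by field; rewrite i0 sn0 t0.
have Ej j : (j < 4)%N -> sint (fun w => w^-1) (dia_vertex j) (dia_vertex j.+1) = G 1 - G 0.
  move=> j4; apply: sintE => t t01; rewrite (key j) // -(key 0%N) //.
  exact: HG.
have -> : kappa = 4%:R * (G 1 - G 0).
  rewrite /kappa /dia (eq_bigr (fun=> G 1 - G 0)); last by move=> j _; rewrite Ej.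
  by rewrite sumr_const card_ord mulr_natl.
rewrite mulf_neq0 ?pnatr_eq0 //.
have : 0 < complex.Re (- 'i%C * (G 1 - G 0)).
  apply: (rdiff_Re_pos HG) => t t01; rewrite key //.
  have t0 : 0 < (1 - t) ^+ 2 + t ^+ 2 by have := sqr_ge0 (t - 1 / 2); nra.
  have -> : complex.Re (- 'i%C * ((Complex (1 - t) t)^-1 * ('i%C - 1))) = ((1 - t) ^+ 2 + t ^+ 2)^-1.
    rewrite !ReImE /=; field; exact: lt0r_neq0.
  by rewrite invr_gt0.
by apply: contraTneq => ->; rewrite mulr0 /= ltxx.
Qed.

Lemma dia_inv_pow n : dia (fun w => (w ^+ n.+2)^-1) = 0.
Proof.
apply: (@dia_prim _ (fun w => (- (n.+1)%:R^-1) * (w ^+ n.+1)^-1)) => w /on_dia_neq0 w0.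
apply: cdiff_eq.
  by apply/cdiffZ/cdiffV; [rewrite expf_neq0|exact: cdiffX (cdiff_id w)].
rewrite /= mul1r -[w ^+ n *+ _]mulr_natr.
have n0 : (n.+1)%:R != 0 :> C by rewrite pnatr_eq0.
move: n0; move: (n.+1%:R : C) => c n0.
by rewrite !exprSr expr0; field; rewrite ?n0 ?w0 ?expf_neq0.
Qed.

Lemma cauchy_kernel_expansion (w a : C) N : w != 0 -> w != a ->
  (w - a)^-1 = \sum_(n < N) a ^+ n * (w ^+ n.+1)^-1 + a ^+ N * ((w ^+ N)^-1 * (w - a)^-1).
Proof.
move=> w0 wa; have wa0 : w - a != 0 by rewrite subr_eq0.
elim: N => [|N IHN]; first by rewrite big_ord0 expr0 invr1 !mul1r add0r.
rewrite big_ord_recr /= {1}IHN -addrA; congr (_ + _).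
by rewrite !exprS; field; rewrite w0 wa0 expf_neq0.
Qed.

Lemma ccont_bounded f u v : seg_cont f u v ->
  exists M : R, forall t, 0 <= t <= 1 -> cmod (f (seg u v t)) <= M.
Proof.
move=> cf.
have cg : continuous (fun t : R => cmod (f (seg u v (clamp t)))).
  move=> t; apply/(@cvgrPdist_le _ _ _ (nbhs t)) => e e0.
  have p : 0 < cmod (v - u) + 1 by rewrite ltr_wpDl ?cmod_ge0.
  have [d d0 Hd] := cf _ (clamp01 t) _ e0.
  apply/nbhs_ballP; exists (d / (cmod (v - u) + 1)) => /=; first exact: divr_gt0.
  move=> x; rewrite /ball /= ltr_pdivlMr // => tx.
  have E : seg u v (clamp x) = seg u v (clamp t) + (clamp x - clamp t)%:C%C * (v - u).
    by rewrite /seg rmorphB /=; ring.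
  have : cmod (f (seg u v (clamp x)) - f (seg u v (clamp t))) <= e.
    rewrite E; apply: Hd; rewrite cmodM cmod_real; apply: le_lt_trans tx.
    rewrite distrC; apply: ler_pM; rewrite ?cmod_ge0 ?lerDl //.
    exact: clamp_lip.
  have := cmodD_ge (f (seg u v (clamp t))) (f (seg u v (clamp x)) - f (seg u v (clamp t))).
  have := cmodD_ge (f (seg u v (clamp x))) (f (seg u v (clamp t)) - f (seg u v (clamp x))).
  rewrite !subrKC (cmodC (f (seg u v (clamp t)))) ler_norml => h1 h2 h3.
  by apply/andP; split; lra.
have [c _ Hc] := @EVT_max R _ 0 1 ler01 (continuous_subspaceT cg).
exists (cmod (f (seg u v (clamp c)))) => t t01.
by have := Hc t; rewrite in_itv /= (clamp_id t01); apply.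
Qed.

Lemma dia_bounded f : dia_cont f ->
  exists2 M : R, 0 <= M & forall w, on_dia w -> cmod (f w) <= M.
Proof.
move=> cf.
have [M0 H0] := ccont_bounded (cf 0%N isT); have [M1 H1] := ccont_bounded (cf 1%N isT).
have [M2 H2] := ccont_bounded (cf 2%N isT); have [M3 H3] := ccont_bounded (cf 3%N isT).
exists (`|M0| + `|M1| + `|M2| + `|M3|); first by rewrite !addr_ge0.
have n0 := normr_ge0 M0; have n1 := normr_ge0 M1; have n2 := normr_ge0 M2; have n3 := normr_ge0 M3.
have l0 := ler_norm M0; have l1 := ler_norm M1; have l2 := ler_norm M2; have l3 := ler_norm M3.
move=> w [j + [t t01 ->]]; case: j => [|[|[|[|//]]]] _.
- have := H0 t t01; lra.
- have := H1 t t01; lra.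
- have := H2 t t01; lra.
have := H3 t t01; lra.
Qed.

Lemma dia_kernel_expansion g a : (forall w, on_dia w -> ccont g w) -> cmod a < s / 2 -> forall N,
  dia (fun w => g w * (w - a)^-1) =
    \sum_(n < N) a ^+ n * dia (fun w => g w * (w ^+ n.+1)^-1) +
    a ^+ N * dia (fun w => g w * (w ^+ N)^-1 * (w - a)^-1).
Proof.
move=> cg as2 N.
have ck n w : on_dia w -> ccont (fun w => g w * (w ^+ n)^-1) w.
  by move=> wd; apply: ccontM; [exact: cg|apply/ccont_kernel/on_dia_neq0].
have cck w : on_dia w -> ccont (fun w => g w * (w ^+ N)^-1 * (w - a)^-1) w.
  by move=> wd; apply: ccontM; [exact: ck|apply: ccont_cauchy_kernel; exact: on_dia_neq].
have cS (m : nat) w : on_dia w ->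
    ccont (fun w => \sum_(n < m) a ^+ n * (g w * (w ^+ n.+1)^-1)) w.
  move=> wd; elim: m => [|m IHm].
    move=> e e0; exists 1 => // h _; by rewrite !big_ord0 subrr cmod0 ltW.
  have H : ccont (fun w => \sum_(n < m) a ^+ n * (g w * (w ^+ n.+1)^-1) + a ^+ m * (g w * (w ^+ m.+1)^-1)) w.
    apply/ccontP; apply: continuousD; apply/ccontP => //.
    by apply: ccontM; [exact: cdiff_cont (cdiff_cst _ _)|exact: ck].
  move=> e e0; have [d d0 Hd] := H e e0; exists d => // h /Hd.
  by rewrite !big_ord_recr.
have sumE (m : nat) : dia (fun w => \sum_(n < m) a ^+ n * (g w * (w ^+ n.+1)^-1)) =
   \sum_(n < m) a ^+ n * dia (fun w => g w * (w ^+ n.+1)^-1).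
  elim: m => [|m IHm].
    rewrite big_ord0 /dia big1 // => j _; rewrite (@sintE _ _ _ _ (fun=> 0)) ?subrr //.
    move=> t _ e e0; exists 1 => // h _; by rewrite big_ord0 mul0r mul0r !subr0 cmod0 mulr_ge0 // ltW.
  rewrite big_ord_recr /= -IHm -diaZ; last by apply: dia_cont_near => w; exact: ck.
  rewrite -diaD; last 2 first.
  - by apply: dia_cont_near => w; exact: cS.
  - by apply: dia_cont_near => w wd; apply: ccontM; [exact: cdiff_cont (cdiff_cst _ _)|exact: ck].
  apply: dia_ext; first by apply: dia_cont_near => w; exact: cS.
  by move=> w _; rewrite big_ord_recr.
rewrite -sumE -diaZ; last by apply: dia_cont_near => w; exact: cck.
rewrite -diaD; last 2 first.
- by apply: dia_cont_near => w; exact: cS.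
- by apply: dia_cont_near => w wd; apply: ccontM; [exact: cdiff_cont (cdiff_cst _ _)|exact: cck].
apply: dia_ext.
  apply: dia_cont_near => w wd; apply: ccontM; first exact: cg.
  by apply: ccont_cauchy_kernel; exact: on_dia_neq.
move=> w wd; have w0 := on_dia_neq0 wd; have wa := on_dia_neq wd as2.
rewrite {1}(cauchy_kernel_expansion N w0 wa) mulrDr mulr_sumr; congr (_ + _).
  by apply: eq_bigr => n _; rewrite mulrCA.
by rewrite mulrCA [g w * (_ * _)]mulrA.
Qed.

End CauchyDiamond.

(** * Cauchy's formula and Taylor expansion with remainder *)

Section Taylor.
Variable R : realType.
Local Notation C := R[i].
Implicit Types (f g : C -> C) (a b u v w k : C) (p q : {poly C}).

Lemma cdiff_horner p a : cdiff (horner p) a p^`().[a].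
Proof.
elim/poly_ind: p => [|p c IHp].
  rewrite deriv0 horner0; apply: (cdiff_near (d := 1)) (cdiff_cst 0 a) => // h _.
  by rewrite horner0.
rewrite derivD derivM derivX derivC addr0 !hornerE.
apply: (cdiff_near (d := 1) (f := fun x => p.[x] * x + c)) => //.
  by move=> h _; rewrite !hornerE.
rewrite -[X in cdiff _ _ X]addr0; apply: cdiffD (cdiff_cst _ _).
by have := cdiffM IHp (cdiff_id a); rewrite mulr1.
Qed.

Lemma cdiff_lip f a L (B : R) (d : R) : 0 < d ->
  (forall h, cmod h < d -> cmod (f (a + h) - f a) <= B * cmod h) -> cdiff f a L -> cmod L <= B.
Proof.
move=> d0 fB H; rewrite leNgt; apply/negP => BL.
have e0 : 0 < (cmod L - B) / 2 by lra.
have [d1 d10 Hd] := H _ e0.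
pose t := Order.min d d1 / 2.
have t0 : 0 < t by rewrite divr_gt0 // lt_min d0.
have ht : cmod (t%:C%C : C) = t by rewrite cmod_real gtr0_norm.
have [td td1] : t < d /\ t < d1.
  have := half_lt (e := Order.min d d1); rewrite lt_min d0 d10 -/t => /(_ isT).
  by rewrite lt_min => /andP[].
have := fB t%:C%C; have := Hd t%:C%C; rewrite ht => /(_ td1) h1 /(_ td) h2.
have : cmod (L * t%:C%C) <= B * t + (cmod L - B) / 2 * t.
  have -> : L * t%:C%C = (f (a + t%:C%C) - f a) - (f (a + t%:C%C) - f a - L * t%:C%C) by ring.
  by apply: le_trans (cmodB _ _) _; exact: lerD.
rewrite cmodM ht -mulrDl ler_pM2r //; lra.
Qed.

Section Expansion.
Variables (f : C -> C) (r s : R).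
Hypotheses (s0 : 0 < s) (sr : s < r).
Hypothesis df : forall w, cmod w < r -> exists L, cdiff f w L.

Lemma on_dia_disc w : on_dia s w -> cmod w < r.
Proof. by move=> /(on_dia_le s0) /le_lt_trans; apply. Qed.

Lemma on_dia_ccont w : on_dia s w -> ccont f w.
Proof. by move=> /on_dia_disc /df[L]; exact: cdiff_cont. Qed.

(** From |w| >= 2s/3 and |a| < s/2 follows |w - a| >= s/6. Together with the 8s of [dia_bound] this
    yields the 48 of [rem_bound]. *)
Lemma kernel_bound w a : on_dia s w -> cmod a < s / 2 -> cmod (w - a)^-1 <= 6 / s.
Proof.
move=> wd as2; have wg := on_dia_ge s0 wd.
have H : s / 6 <= cmod (w - a).
  have := cmodD_ge w (- a); rewrite cmodN; have := wg; have := as2; lra.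
have H0 : 0 < s / 6 by rewrite divr_gt0.
rewrite cmodV -[6 / s]invf_div lef_pV2 // posrE //; exact: lt_le_trans H.
Qed.

Lemma pow_kernel_bound w n : on_dia s w -> cmod (w ^+ n)^-1 <= (3 / (2 * s)) ^+ n.
Proof.
move=> wd; have wg := on_dia_ge s0 wd.
have H0 : 0 < 2 / 3 * s by rewrite mulr_gt0.
have -> : 3 / (2 * s) = (2 / 3 * s)^-1 by field; rewrite lt0r_neq0.
rewrite -exprVn cmodX cmodV lerXn2r ?nnegrE ?invr_ge0 ?cmod_ge0 ?(ltW H0) //.
rewrite lef_pV2 // posrE //; exact: lt_le_trans wg.
Qed.

Lemma ccont_rem g N a w : (forall w, on_dia s w -> ccont g w) -> cmod a < s / 2 -> on_dia s w ->
  ccont (fun w => g w * (w ^+ N)^-1 * (w - a)^-1) w.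
Proof.
move=> cg as2 wd; apply: ccontM; first apply: ccontM; first exact: cg.
  exact/ccont_kernel/(on_dia_neq0 s0).
by apply: ccont_cauchy_kernel; exact: (on_dia_neq s0 wd as2).
Qed.

Lemma rem_bound g (M : R) N a : (forall w, on_dia s w -> ccont g w) -> 0 <= M ->
  (forall w, on_dia s w -> cmod (g w) <= M) -> cmod a < s / 2 ->
  cmod (dia s (fun w => g w * (w ^+ N)^-1 * (w - a)^-1)) <= 48 * M * (3 / (2 * s)) ^+ N.
Proof.
move=> cg M0 gM as2.
have -> : 48 * M * (3 / (2 * s)) ^+ N = 8 * s * (M * (3 / (2 * s)) ^+ N * (6 / s)).
  by move: (_ ^+ N) => q; field; exact: lt0r_neq0.
apply: dia_bound => //; first by apply: (dia_cont_near) => w; exact: ccont_rem.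
move=> w wd; rewrite !cmodM; apply: ler_pM; rewrite ?mulr_ge0 ?cmod_ge0 //; last exact: kernel_bound.
by apply: ler_pM; rewrite ?cmod_ge0 ?gM // pow_kernel_bound.
Qed.

Lemma small_ratio a : cmod a < s / 2 -> 0 <= cmod a * (3 / (2 * s)) < 1.
Proof.
move=> as2; rewrite mulr_ge0 ?cmod_ge0 ?divr_ge0 ?mulr_ge0 ?(ltW s0) //=.
by rewrite mulrA ltr_pdivrMr ?mulr_gt0 //; have := as2; have := s0; lra.
Qed.

(** In the geometric expansion of 1/(w - a) the terms with n >= 1 have primitives and integrate to
    0; the n = 0 term is [kappa], and the remainder tends to 0. *)
Lemma kappaE a : cmod a < s / 2 -> dia s (fun w => (w - a)^-1) = kappa s.
Proof.
move=> as2.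
have c1 w : on_dia s w -> ccont (fun=> 1 : C) w by move=> _; exact: cdiff_cont (cdiff_cst _ _).
have fE : (fun w : C => 1 * (w - a)^-1) = (fun w => (w - a)^-1) by apply/funext => w; rewrite mul1r.
have E0 : dia s (fun w => (w - a)^-1) = dia s (fun w => 1 * (w - a)^-1).
  by rewrite fE.
apply/eqP; rewrite -subr_eq0 -cmod_eq0; apply/eqP/le_anti; rewrite cmod_ge0 andbT leNgt; apply/negP => X0.
have [N HN] := geom_small_gen 48 (small_ratio as2) X0.
move: HN; apply/negP; rewrite -leNgt.
have : cmod (dia s (fun w => (w - a)^-1) - kappa s) <= 48 * (cmod a * (3 / (2 * s))) ^+ N.+1.
  rewrite E0 (dia_kernel_expansion s0 c1 as2 N.+1) big_ord_recl big1 => [|j _]; last first.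
    have -> : (fun w : C => 1 * (w ^+ (lift ord0 j).+1)^-1) = (fun w => (w ^+ j.+2)^-1).
      by apply/funext => w; rewrite mul1r.
    by rewrite dia_inv_pow ?mulr0.
  rewrite addr0 expr0 mul1r.
  have -> : dia s (fun w : C => 1 * (w ^+ 1)^-1) = kappa s.
    rewrite /kappa; have -> : (fun w : C => 1 * (w ^+ 1)^-1) = (fun w => w^-1) by apply/funext => w; rewrite mul1r.
    by [].
  rewrite [kappa s + _]addrC addrK cmodM cmodX exprMn mulrCA; apply: ler_wpM2l; first by rewrite exprn_ge0 ?cmod_ge0.
  by rewrite -[48]mulr1; apply: rem_bound => // w _; rewrite cmod1.
move/le_trans; apply; apply: ler_wpM2l => //.
have /andP[q0 q1] := small_ratio as2.
by apply: ler_wiXn2l => //; exact: ltW.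
Qed.

(** The difference quotient of f at a, completed by the derivative, is continuous everywhere and
    differentiable off a: exactly the situation of [dia_exceptional]. *)
Lemma cauchy_formula a : cmod a < s / 2 -> f a * kappa s = dia s (fun w => f w * (w - a)^-1).
Proof.
move=> as2.
have ar : cmod a < r by have := as2; have := s0; have := sr; lra.
have [L HL] := df ar.
pose g w := if w == a then L else (f w - f a) * (w - a)^-1.
have gd w : cmod w < r -> w != a -> exists L', cdiff g w L'.
  move=> wr wa; have [M HM] := df wr; have [M' HM'] := cdiff_cauchy_kernel wa.
  have d0 : 0 < cmod (w - a) by rewrite cmod_gt0 subr_eq0.
  eexists; apply: (cdiff_near (f := fun x => (f x - f a) * (x - a)^-1) d0).
    move=> h hd; rewrite /g ifN //; apply: contraTneq hd => E.
    by rewrite -leNgt cmodC -E addrC addKr.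
  by apply: cdiffM HM'; apply: cdiffD HM _; exact/cdiffN/cdiff_cst.
have gc w : cmod w < r -> ccont g w.
  move=> wr; have [->|/gd] := eqVneq w a; last by move=> /(_ wr)[L']; exact: cdiff_cont.
  move=> e e0; have [d d0 Hd] := HL e e0; exists d => // h hd.
  rewrite /g eqxx; case: eqP => [_|/eqP E]; first by rewrite subrr cmod0 ltW.
  have h0 : h != 0 by apply: contraNneq E => ->; rewrite addr0.
  rewrite -(ler_pM2r (_ : 0 < cmod h)) ?cmod_gt0 // -cmodM.
  have -> : ((f (a + h) - f a) / (a + h - a) - L) * h = f (a + h) - f a - L * h.
    by rewrite [a + h]addrC addrK; field.
  exact: Hd.
have G0 := dia_exceptional s0 sr as2 gc gd.
have ck w : on_dia s w -> ccont (fun w => (w - a)^-1) w.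
  by move=> wd; apply: ccont_cauchy_kernel; exact: (on_dia_neq s0 wd as2).
have cfk w : on_dia s w -> ccont (fun w => f w * (w - a)^-1) w.
  by move=> wd; apply: ccontM; [exact: on_dia_ccont|exact: ck].
have E : dia s (fun w => f w * (w - a)^-1 + - f a * (w - a)^-1) = 0.
  rewrite -[RHS]G0; symmetry; apply: dia_ext; first by apply: dia_cont_near => w /on_dia_disc; exact: gc.
  by move=> w wd; rewrite /g ifN ?(on_dia_neq s0 wd) // mulrBl mulNr.
move: E; rewrite diaD; last 2 first.
- exact: dia_cont_near.
- by apply: dia_cont_near => w wd; apply: ccontM; [exact: cdiff_cont (cdiff_cst _ _)|exact: ck].
rewrite diaZ; last exact: dia_cont_near.
by rewrite kappaE // mulNr => /eqP; rewrite subr_eq0 => /eqP.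
Qed.

Definition tcoef n : C := dia s (fun w => f w * (w ^+ n.+1)^-1) / kappa s.

(** The exact remainder divided by a^N. Its integral form gives a bound and a Lipschitz constant by
    the same kernel estimates. *)
Definition trem N a : C := dia s (fun w => f w * (w ^+ N)^-1 * (w - a)^-1) / kappa s.

Lemma taylor_eq N a : cmod a < s / 2 ->
  f a = (\poly_(n < N) tcoef n).[a] + a ^+ N * trem N a.
Proof.
move=> as2; have k0 := kappa_neq0 s0.
apply: (mulIf k0); rewrite (cauchy_formula as2) (dia_kernel_expansion s0 on_dia_ccont as2 N).
rewrite mulrDl -mulrA divfK //; congr (_ + _).
rewrite horner_poly mulr_suml; apply: eq_bigr => n _.
by rewrite mulrAC divfK // mulrC.
Qed.

Lemma trem_bound : exists2 B : R, 0 <= B & forall N a, cmod a < s / 2 ->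
  cmod (trem N a) <= B * (3 / (2 * s)) ^+ N.
Proof.
have k0 := kappa_neq0 s0.
have [M M0 fM] := dia_bounded (dia_cont_near on_dia_ccont).
exists (48 * M / cmod (kappa s)); first by rewrite divr_ge0 ?cmod_ge0 ?mulr_ge0.
move=> N a as2; rewrite cmodM cmodV mulrAC; apply: ler_wpM2r; first by rewrite invr_ge0 cmod_ge0.
by apply: rem_bound => //; exact: on_dia_ccont.
Qed.

(** A Lipschitz bound on the remainder bounds its derivative through [cdiff_lip]; this takes the
    place of differentiation under the integral sign. *)
Lemma trem_lip N : exists2 B : R, 0 <= B & forall a b, cmod a < s / 2 -> cmod b < s / 2 ->
  cmod (trem N a - trem N b) <= B * cmod (a - b).
Proof.
have k0 := kappa_neq0 s0.
have [M M0 fM] := dia_bounded (dia_cont_near on_dia_ccont).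
exists (8 * s * (M * (3 / (2 * s)) ^+ N * (6 / s) * (6 / s)) / cmod (kappa s)).
  have s1 := ltW s0; have q0 : 0 <= 3 / (2 * s) by rewrite divr_ge0 ?mulr_ge0.
  have s6 : 0 <= 6 / s by rewrite divr_ge0.
  apply: divr_ge0; last exact: cmod_ge0.
  by do ![apply: mulr_ge0 => //]; exact: exprn_ge0.
move=> a b as2 bs2; rewrite /trem -mulrBl cmodM cmodV [X in _ <= X]mulrAC.
apply: ler_wpM2r; first by rewrite invr_ge0 cmod_ge0.
have ca w := @ccont_rem f N a w on_dia_ccont as2.
have cb w := @ccont_rem f N b w on_dia_ccont bs2.
have cb' w : on_dia s w -> ccont (fun w => -1 * (f w * (w ^+ N)^-1 * (w - b)^-1)) w.
  by move=> wd; apply: ccontM; [exact: cdiff_cont (cdiff_cst _ _)|exact: cb].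
rewrite -mulN1r -diaZ; last exact: dia_cont_near.
rewrite -diaD; try exact: dia_cont_near.
rewrite -[X in _ <= X]mulrA; apply: dia_bound => //.
  apply: dia_cont_near => w wd; apply/ccontP; apply: continuousD; apply/ccontP.
    exact: ca.
  exact: cb'.
move=> w wd; have wa := on_dia_neq s0 wd as2; have wb := on_dia_neq s0 wd bs2.
have -> : f w * (w ^+ N)^-1 * (w - a)^-1 + -1 * (f w * (w ^+ N)^-1 * (w - b)^-1) =
   f w * (w ^+ N)^-1 * (w - a)^-1 * (w - b)^-1 * (a - b).
  have w0 := on_dia_neq0 s0 wd.
  by field; rewrite !subr_eq0 wa wb expf_neq0.
rewrite !cmodM; apply: ler_wpM2r; first exact: cmod_ge0.
apply: ler_pM; rewrite ?mulr_ge0 ?cmod_ge0 //; last exact: kernel_bound.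
apply: ler_pM; rewrite ?mulr_ge0 ?cmod_ge0 //; last exact: kernel_bound.
by apply: ler_pM; rewrite ?mulr_ge0 ?cmod_ge0 ?fM // pow_kernel_bound.
Qed.

Lemma taylor_zero : (forall n, tcoef n = 0) -> forall a, cmod a < s / 2 -> f a = 0.
Proof.
move=> c0 a as2; have [B B0 HB] := trem_bound.
apply/eqP; rewrite -cmod_eq0; apply/eqP/le_anti; rewrite cmod_ge0 andbT leNgt; apply/negP => X0.
have [N HN] := geom_small_gen B (small_ratio as2) X0.
move: HN; apply/negP; rewrite -leNgt.
rewrite (taylor_eq N as2) horner_poly big1 ?add0r => [|i _]; last by rewrite c0 mul0r.
rewrite cmodM cmodX exprMn mulrCA; apply: ler_wpM2l; first by rewrite exprn_ge0 ?cmod_ge0.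
exact: HB.
Qed.

Lemma taylor_jet N : exists B : R, forall a, cmod a < s / 2 ->
  cmod (f a - (\poly_(n < N) tcoef n).[a]) <= B * cmod a ^+ N.
Proof.
have [B B0 HB] := trem_bound; exists (B * (3 / (2 * s)) ^+ N) => a as2.
rewrite {1}(taylor_eq N as2) addrC addKr cmodM cmodX mulrC.
by apply: ler_wpM2r; [rewrite exprn_ge0 ?cmod_ge0|exact: HB].
Qed.

(** Off 0 the remainder equals (f - p)/x^N and is differentiable. The derivative of x^N times the
    remainder has two terms, controlled by [trem_bound] and [trem_lip], both O(|a|^(N-1)). *)
Lemma taylor_jet_deriv N : exists B : R, forall a L, cmod a < s / 2 -> a != 0 -> cdiff f a L ->
  cmod (L - (\poly_(n < N) tcoef n)^`().[a]) <= B * cmod a ^+ N.-1.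
Proof.
have [B B0 HB] := trem_bound; have [B' B'0 HB'] := trem_lip N.
exists (N%:R * (B * (3 / (2 * s)) ^+ N) + (s + 1) * B') => a L as2 a0 HL.
set p := \poly_(n < N) tcoef n.
have d0 : 0 < s / 2 - cmod a by rewrite subr_gt0.
have near h : cmod h < s / 2 - cmod a -> cmod (a + h) < s / 2.
  by move=> hd; apply: le_lt_trans (cmodD _ _) _; rewrite addrC -ltrBrDr.
have [M HM] : exists M, cdiff (trem N) a M.
  eexists; apply: (cdiff_near (f := fun x => (f x - p.[x]) * (x ^+ N)^-1) (d := Order.min (s / 2 - cmod a) (cmod a))).
  - by rewrite lt_min d0 cmod_gt0.
  - move=> h; rewrite lt_min => /andP[/near hd ha].
    rewrite {1}(taylor_eq N hd) addrC addKr mulrC mulKf // expf_neq0 //.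
    by apply: contraTneq ha => /eqP; rewrite addr_eq0 => /eqP ->; rewrite cmodN ltxx.
  apply: cdiffM; first by apply: cdiffD HL _; apply/cdiffN/cdiff_horner.
  by apply: cdiffV; [rewrite expf_neq0|exact: cdiffX (cdiff_id a)].
have MB : cmod M <= B'.
  apply: cdiff_lip d0 _ HM => h hd; have := HB' _ _ (near _ hd) as2.
  by rewrite [a + h]addrC addrK.
have LE : L = p^`().[a] + (1 * a ^+ N.-1 *+ N * trem N a + a ^+ N * M).
  apply: (cdiff_uniq HL).
  apply: (cdiff_near (f := fun x => p.[x] + x ^+ N * trem N x) d0).
    by move=> h /near hd; rewrite [RHS](taylor_eq N hd).
  apply: cdiffD; first exact: cdiff_horner.
  by apply: cdiffM HM; exact: cdiffX (cdiff_id a).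
rewrite LE addrC addKr mul1r mulrDl; apply: le_trans (cmodD _ _) _; apply: lerD.
  rewrite -mulr_natr [cmod (_ * trem _ _)]cmodM [cmod (_ * _%:R)]cmodM cmodX.
  have -> : cmod (N%:R : C) = N%:R by rewrite -(rmorph_nat (real_complex R)) cmod_real ger0_norm.
  rewrite -mulrA mulrC; apply: ler_wpM2r; first by rewrite exprn_ge0 ?cmod_ge0.
  by apply: ler_wpM2l => //; exact: HB.
rewrite cmodM cmodX; case: (N) => [|m] /=.
  by rewrite expr0 mul1r mulr1; apply: le_trans MB _; rewrite ler_peMl // -[X in X <= _]add0r lerD // ltW.
rewrite exprSr -mulrA [X in _ <= X]mulrC; apply: ler_wpM2l; first by rewrite exprn_ge0 ?cmod_ge0.
by apply: ler_pM; rewrite ?cmod_ge0 //; have := as2; have := s0; lra.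
Qed.

End Expansion.
End Taylor.

(** * Valuation rings *)

Section DomainOfIntegralRing.
Variables (A : comNzRingType) (Aint : GRing.integral_domain_axiom A).

(** An [idomainType] carries a total inverse operation; here it is supplied by choice, with the
    identity as value on non-units. *)
Definition integral_ring : Type := A.
HB.instance Definition _ := GRing.ComNzRing.on integral_ring.

Definition iunit : pred integral_ring := fun x => `[< exists y, y * x = 1 >].
Definition iinv (x : integral_ring) : integral_ring :=
  if x \in iunit then xget 0 [set y | y * x = 1] else x.

Lemma iinvP : {in iunit, left_inverse 1 iinv *%R}.
Proof.
move=> x xu; rewrite /iinv xu.
by move: xu => /asboolP ex; exact: (xgetPex 0 ex).
Qed.

Lemma iunitP (x y : integral_ring) : y * x = 1 -> iunit x.
Proof. by move=> yx; apply/asboolP; exists y. Qed.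

Lemma iinv_out : {in [predC iunit], iinv =1 id}.
Proof. by move=> x; rewrite inE /= /iinv => /negbTE ->. Qed.

HB.instance Definition _ :=
  GRing.ComNzRing_hasMulInverse.Build integral_ring iinvP iunitP iinv_out.
HB.instance Definition _ := GRing.ComUnitRing_isIntegral.Build integral_ring Aint.

Lemma domain_of_integral_ring : exists (D : idomainType) (h : {rmorphism A -> D}), injective h.
Proof. by exists integral_ring, (idfun : {rmorphism A -> A}). Qed.

End DomainOfIntegralRing.

Section QuotientDomain.
Variables (A : comNzRingType) (I : A -> Prop).
Hypotheses (I0 : I 0) (IB : forall a b, I a -> I b -> I (a - b)) (I1 : ~ I 1).
Hypotheses (IM : forall a b, I b -> I (a * b)) (Iprime : forall a b, I (a * b) -> I a \/ I b).

Definition ideal_pred : A -> bool := fun a => `[< I a >].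

Lemma ideal_pred_closed : idealr_closed ideal_pred.
Proof.
split; first exact/asboolP.
  by apply/asboolP.
move=> a b c /asboolP Ib /asboolP Ic; apply/asboolP.
rewrite -[c]opprK; apply: IB; first exact: IM.
by rewrite -sub0r; apply: IB.
Qed.

HB.instance Definition _ := isIdealr.Build A ideal_pred ideal_pred_closed.

Lemma ideal_pred_prime : prime_idealr_closed ideal_pred.
Proof.
by move=> a b /asboolP /Iprime[?|?]; apply/orP; [left|right]; apply/asboolP.
Qed.

HB.instance Definition _ := isPrimeIdealrClosed.Build A ideal_pred ideal_pred_prime.

(** Serves twice: for the functions vanishing on a member of an ultrafilter, and for the non-units
    of a valuation ring. *)
Lemma quotient_domain : exists (D : idomainType) (h : {rmorphism A -> D}),
  forall a, h a = 0 <-> I a.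
Proof.
pose J : prime_idealr A := ideal_pred.
have [D [h hi]] := domain_of_integral_ring (@Quotient.rquot_IdomainAxiom A J).
pose q : {rmorphism A -> {ideal_quot J}} := (\pi_({ideal_quot J}))%qT.
exists D, (h \o q) => a /=; split.
  rewrite -[X in _ = X -> _](rmorph0 h) => /hi.
  rewrite -(rmorph0 q) => /eqP; rewrite -Quotient.idealrBE subr0 => /asboolP; exact.
move=> Ia; rewrite -(rmorph0 h); congr (h _); rewrite -(rmorph0 q); apply/eqP.
by rewrite -Quotient.idealrBE subr0; apply/asboolP.
Qed.

End QuotientDomain.

Section Subring.
Variables (K : comNzRingType) (S : K -> Prop).
Hypotheses (S1 : S 1) (SB : forall a b, S a -> S b -> S (a - b)) (SM : forall a b, S a -> S b -> S (a * b)).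

Definition subring_pred : {pred K} := fun a => `[< S a >].

Lemma subring_pred_closed : subring_closed subring_pred.
Proof.
split; first exact/asboolP.
  by move=> a b /asboolP Sa /asboolP Sb; apply/asboolP; exact: SB.
by move=> a b /asboolP Sa /asboolP Sb; apply/asboolP; exact: SM.
Qed.

HB.instance Definition _ := GRing.isSubringClosed.Build K subring_pred subring_pred_closed.

Definition subring_type : Type := {x : K | subring_pred x}.
HB.instance Definition _ := SubChoice.on subring_type.
HB.instance Definition _ := [SubChoice_isSubComNzRing of subring_type by <:].

Lemma subring_exists : exists (A : comNzRingType) (i : {rmorphism A -> K}),
  injective i /\ forall x, S x <-> exists a, i a = x.
Proof.
exists subring_type, (val : {rmorphism subring_type -> K}); split; first exact: val_inj.
move=> x; split => [/asboolP Sx|[a <-]]; first by exists (exist _ x Sx).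
by case: a => a /= /asboolP.
Qed.

End Subring.

Lemma rmorphism_factor (B A K : comNzRingType) (i : {rmorphism A -> K}) (g : {rmorphism B -> K}) :
  injective i -> (forall b, exists a, i a = g b) ->
  exists h : {rmorphism B -> A}, forall b, i (h b) = g b.
Proof.
move=> i_inj /choice[h hE].
have hB : zmod_morphism h by move=> x y; apply: i_inj; rewrite rmorphB !hE rmorphB.
have hM : monoid_morphism h.
  by split => [|x y]; apply: i_inj; rewrite ?rmorph1 ?rmorphM !hE ?rmorph1 ?rmorphM.
pose hA := GRing.isZmodMorphism.Build B A h hB.
pose hR := GRing.isMonoidMorphism.Build B A h hM.
pose H : {rmorphism B -> A} := HB.pack h hA hR.
by exists H.
Qed.

Lemma frac_sub (L : fieldType) (a b c d : L) : b != 0 -> d != 0 ->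
  a / b - c / d = (a * d - c * b) / (b * d).
Proof. by move=> b0 d0; field; rewrite b0 d0. Qed.

Section FractionExtension.
Variables (B : idomainType) (K : fieldType) (g : {rmorphism B -> K}).
Hypothesis g_inj : injective g.
Local Notation "x %:F" := (@tofrac B x).

Lemma fraction_rep (x : {fraction B}) : exists nd : B * B, nd.2 != 0 /\ x = nd.1%:F / nd.2%:F.
Proof.
exists (frac (repr x)); split; first exact: denom_ratioP.
apply: (@mulIf _ (tofrac (frac (repr x)).2)); first by rewrite tofrac_eq0 denom_ratioP.
rewrite divfK ?tofrac_eq0 ?denom_ratioP // -{1}[x]reprK; unlock tofrac.
rewrite -[LHS]FracField.pi_mul; apply/eqmodP => /=.
rewrite FracField.equivfE /FracField.mulf !numden_Ratio ?mulf_neq0 ?oner_neq0 ?denom_ratioP //.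
by rewrite !mulr1 mulrC.
Qed.

Lemma fraction_extension :
  exists h : {rmorphism {fraction B} -> K}, forall b, h b%:F = g b.
Proof.
have [rep repE] := choice fraction_rep.
have gn0 d : d != 0 -> g d != 0 by move=> d0; rewrite -(rmorph0 g) (inj_eq g_inj).
pose h x := g (rep x).1 / g (rep x).2.
have hE n d : d != 0 -> h (n%:F / d%:F) = g n / g d.
  move=> d0; rewrite /h; case: (repE (n%:F / d%:F)); case: (rep _) => n' d' /= d'0 E.
  apply/eqP; rewrite eqr_div ?gn0 // -!rmorphM (inj_eq g_inj) -tofrac_eq !rmorphM /=.
  by rewrite -eqr_div ?tofrac_eq0 // E.
have hB : zmod_morphism h.
  move=> x y; have [x0 xE] := repE x; have [y0 yE] := repE y.
  rewrite xE yE; set a := (rep x).1 in xE *; set b := (rep x).2 in x0 xE *.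
  set c := (rep y).1 in yE *; set d := (rep y).2 in y0 yE *.
  have -> : a%:F / b%:F - c%:F / d%:F = (a * d - c * b)%:F / (b * d)%:F.
    by rewrite rmorphB !rmorphM /= frac_sub ?tofrac_eq0.
  rewrite !hE ?mulf_neq0 // rmorphB !rmorphM /=.
  by rewrite frac_sub ?gn0.
have hM : monoid_morphism h.
  split; first by rewrite -[1]divr1 -{1 2}(rmorph1 (@tofrac B)) hE ?oner_neq0 // rmorph1 divr1.
  move=> x y; have [x0 xE] := repE x; have [y0 yE] := repE y.
  rewrite xE yE mulf_div -!rmorphM /= !hE ?mulf_neq0 // !rmorphM /=.
  by rewrite mulf_div.
pose hA := GRing.isZmodMorphism.Build {fraction B} K h hB.
pose hR := GRing.isMonoidMorphism.Build {fraction B} K h hM.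
pose H : {rmorphism {fraction B} -> K} := HB.pack h hA hR.
exists H => b /=.
by have := hE b 1 (oner_neq0 _); rewrite !rmorph1 !divr1.
Qed.

End FractionExtension.

(** * A valuation ring that omits a transcendental element *)

Section ValuationRing.
Variables (F K : fieldType) (iota : {rmorphism F -> K}) (x : K).
Hypothesis x_transc : forall p : {poly F}, p != 0 -> (map_poly iota p).[x] != 0.

Definition is_subring (S : set K) :=
  [/\ S 1, forall a b, S a -> S b -> S (a - b) & forall a b, S a -> S b -> S (a * b)].

(** Requiring x^-1 in the ring while x is outside makes every 1 - x^-1 b a unit of a maximal such
    ring ([maximal_unit]); this is what drives the valuation property. *)
Definition admissible (S : set K) :=
  [/\ is_subring S, forall c, S (iota c), S x^-1 & ~ S x].

Lemma subring0 S : is_subring S -> S 0.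
Proof. by case=> S1 SB _; rewrite -(subrr 1); exact: SB. Qed.

Lemma subringN S a : is_subring S -> S a -> S (- a).
Proof. by move=> HS Sa; rewrite -sub0r; case: (HS) => _ SB _; apply: SB => //; exact: subring0. Qed.

Lemma subringD S a b : is_subring S -> S a -> S b -> S (a + b).
Proof. by move=> HS Sa Sb; rewrite -[b]opprK; case: (HS) => _ SB _; apply: SB => //; exact: subringN. Qed.

Lemma subringX S a n : is_subring S -> S a -> S (a ^+ n).
Proof. by move=> [S1 _ SM] Sa; elim: n => [|n IHn]; rewrite ?expr0 // exprS; exact: SM. Qed.

Lemma subring_sum S (I : Type) (r : seq I) (P : pred I) (f : I -> K) : is_subring S ->
  (forall i, P i -> S (f i)) -> S (\sum_(i <- r | P i) f i).
Proof.
move=> HS Sf; elim/big_rec: _ => [|i a Pi Sa]; first exact: subring0.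
by apply: subringD => //; exact: Sf.
Qed.

Lemma x_neq0 : x != 0.
Proof. by have := x_transc (p := 'X); rewrite polyX_eq0 map_polyX hornerX; apply. Qed.

(* F[x^-1] *)
Definition base_ring : set K := [set a | exists (p : {poly F}) (n : nat),
  (size p <= n.+1)%N /\ a * x ^+ n = (map_poly iota p).[x]].

(** If x were in F[x^-1], then x^(n+1) = p(x) with deg p <= n, and X^(n+1) - p would be a nonzero
    polynomial vanishing at x. *)
Lemma base_ring_admissible : admissible base_ring.
Proof.
have sz (p : {poly F}) n k : (size p <= n.+1)%N -> (size (p * 'X^k)%R <= (n + k).+1)%N.
  move=> sp; apply: leq_trans (size_polyMleq _ _) _.
  by rewrite size_polyXn addnS /= -addSn leq_add2r.
split.
- split.
  + by exists 1, 0%N; rewrite size_poly1 rmorph1 hornerC mulr1.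
  + move=> a b [p [n [sp pE]]] [q [k [sq qE]]].
    exists (p * 'X^k - q * 'X^n), (n + k)%N; split.
      by rewrite (leq_trans (size_polyD _ _)) // geq_max size_polyN sz //= addnC sz.
    rewrite rmorphB !rmorphM /= !map_polyXn !hornerE ?hornerXn -pE -qE exprD; ring.
  + move=> a b [p [n [sp pE]]] [q [k [sq qE]]].
    exists (p * q), (n + k)%N; split.
      apply: leq_trans (size_polyMleq _ _) _.
      by rewrite -subn1 leq_subLR add1n (leq_trans (leq_add sp sq)) // addSn addnS.
    by rewrite rmorphM /= hornerM -pE -qE exprD mulrACA.
- move=> c; exists c%:P, 0%N; rewrite expr0 mulr1 map_polyC hornerC; split => //.
  by rewrite size_polyC; case: (c != 0).
- exists 1, 1%N; rewrite size_poly1 rmorph1 hornerC expr1 mulVf //; exact: x_neq0.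
move=> [p [n [sp pE]]].
have q0 : 'X^(n.+1) - p != 0.
  rewrite -size_poly_eq0 size_polyDl ?size_polyXn // size_polyN; exact: leq_trans sp _.
by have := x_transc q0; rewrite rmorphB /= map_polyXn !hornerE ?hornerXn -pE exprS subrr eqxx.
Qed.

Lemma maximal_admissible : exists2 S, admissible S & forall S', admissible S' -> S `<=` S' -> S' = S.
Proof.
(* The union with [base_ring] makes the empty set acceptable, and with it the union of the empty
   chain. *)
pose P (S : set K) := admissible (base_ring `|` S).
(* A maximal admissible ring is a valuation ring. *)
have [|S [PS maxS]] := @Zorn_bigcup K P.
  move=> U UP Utot; rewrite /P.
  have [->|/set0P[X0 UX0]] := eqVneq U set0.
    by rewrite bigcup_set0 setU0; exact: base_ring_admissible.
  have mem a : (base_ring `|` \bigcup_(X in U) X) a -> exists2 X, U X & (base_ring `|` X) a.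
    by move=> [Ba|[X UX Xa]]; [exists X0 => //; left|exists X => //; right].
  have mem2 a b : (base_ring `|` \bigcup_(X in U) X) a -> (base_ring `|` \bigcup_(X in U) X) b ->
      exists X, [/\ U X, (base_ring `|` X) a & (base_ring `|` X) b].
    move=> /mem[X UX Xa] /mem[Y UY Yb].
    by have [XY|YX] := Utot X Y UX UY; [exists Y|exists X]; split=> //;
      [case: Xa => [?|/XY ?]|case: Yb => [?|/YX ?]]; by [left|right].
  have sub X : U X -> (base_ring `|` X) `<=` (base_ring `|` \bigcup_(X in U) X).
    by move=> UX a [?|Xa]; [left|right; exists X].
  have [[B1 _ _] BF Bx _] := base_ring_admissible.
  split; [split|..].
  - by left.
  - move=> a b /mem2 H /H [X [UX Xa Xb]]; apply: (sub X UX).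
    by have [[_ XB _] _ _ _] := UP X UX; exact: XB.
  - move=> a b /mem2 H /H [X [UX Xa Xb]]; apply: (sub X UX).
    by have [[_ _ XM] _ _ _] := UP X UX; exact: XM.
  - by move=> c; left.
  - by left.
  by move=> /mem[X UX Xx]; have [_ _ _] := UP X UX; apply.
exists (base_ring `|` S) => // S' AS' SS'.
apply/seteqP; split => //.
have PS' : P S'.
  rewrite /P; suff -> : base_ring `|` S' = S' by [].
  by apply/seteqP; split => [a [Ba|//]|a]; [apply: SS'; left|right].
have SsS' : S `<=` S' by move=> a Sa; apply: SS'; right.
have [->|neq] := pselect (S' = S); first by move=> a; right.
exfalso; apply: (maxS S' _ PS'); split; first exact: SsS'.
by move=> S'S; apply: neq; apply/seteqP; split.
Qed.

Definition adjoin (S : set K) (w : K) : set K :=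
  [set a | exists2 p : {poly K}, (forall i, S p`_i) & a = p.[w]].

Lemma adjoin_subring S w : is_subring S -> is_subring (adjoin S w).
Proof.
move=> HS; case: (HS) => S1 SB SM; split.
- exists 1; last by rewrite hornerC.
  by move=> i; rewrite coef1; case: eqP => _; [exact: S1|exact: subring0].
- move=> _ _ [p Sp ->] [q Sq ->]; exists (p - q); last by rewrite !hornerE.
  by move=> i; rewrite coefB; exact: SB.
move=> _ _ [p Sp ->] [q Sq ->]; exists (p * q); last by rewrite hornerM.
by move=> i; rewrite coefM; apply: subring_sum => // j _; exact: SM.
Qed.

Lemma adjoin_sub S w : is_subring S -> S `<=` adjoin S w.
Proof.
move=> HS a Sa; exists a%:P; last by rewrite hornerC.
by move=> i; rewrite coefC; case: eqP => _ //; exact: subring0.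
Qed.

Lemma adjoin_self S w : is_subring S -> adjoin S w w.
Proof.
move=> HS; exists 'X; last by rewrite hornerX.
by case: (HS) => S1 _ _ i; rewrite coefX; case: eqP => _ //; exact: subring0.
Qed.

Lemma maximal_adjoin S w : admissible S -> (forall S', admissible S' -> S `<=` S' -> S' = S) ->
  ~ S w -> adjoin S w x.
Proof.
move=> [HS SF Sx nSx] maxS nSw; apply: contrapT => nx; apply: nSw.
rewrite -(maxS (adjoin S w)); first exact: adjoin_self.
  split => //; first exact: adjoin_subring.
  - by move=> c; apply: adjoin_sub.
  - exact: adjoin_sub.
exact: adjoin_sub.
Qed.

(** Let u = 1 - x^-1 b. If u^-1 were missing, maximality would make x a polynomial in u^-1, so u^k x
    is in S for some k. Since u^k = 1 - x^-1 c with c in S, x = u^k x + c would be in S. *)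
Lemma maximal_unit S b : admissible S -> (forall S', admissible S' -> S `<=` S' -> S' = S) ->
  S b -> S (1 - x^-1 * b)^-1.
Proof.
move=> AS maxS Sb; have [HS SF Sy nSx] := AS; case: (HS) => S1 SB SM.
set u := 1 - x^-1 * b; have Su : S u by apply: SB => //; exact: SM.
have u0 : u != 0.
  apply/eqP => /eqP; rewrite subr_eq0 eq_sym => /eqP E; apply: nSx.
  by have <- : b = x by rewrite -[b]mul1r -(mulfV x_neq0) -mulrA E mulr1.
apply: contrapT => nSu; have [p Sp E] := maximal_adjoin AS maxS nSu.
have [q Sq pE] : exists2 q, S q & u ^+ (size p).-1 * x = q.
  exists (u ^+ (size p).-1 * x) => //; rewrite E horner_coef mulr_sumr.
  apply: subring_sum => // i _; rewrite mulrCA; apply: SM => //.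
  have -> : u ^+ (size p).-1 * u^-1 ^+ i = u ^+ ((size p).-1 - i).
    have ip : (i <= (size p).-1)%N by rewrite -ltnS prednK // (leq_ltn_trans _ (ltn_ord i)).
    by rewrite -{1}(subnK ip) exprD -mulrA -exprMn divff // expr1n mulr1.
  exact: subringX.
have uN n : exists2 c, S c & u ^+ n = 1 - x^-1 * c.
  elim: n => [|n [c Sc cE]]; first by exists 0; [exact: subring0|rewrite mulr0 subr0].
  exists (c + b * (1 - x^-1 * c)); last by rewrite exprS cE /u; ring.
  by apply: subringD => //; apply: (SM) => //; apply: SB => //; exact: SM.
have [c Sc cE] := uN (size p).-1.
apply: nSx; have -> : x = u ^+ (size p).-1 * x + c.
  by rewrite cE mulrBl mul1r mulrAC mulVf ?x_neq0 // mul1r subrK.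
by apply: subringD => //; rewrite pE.
Qed.

(** If w and w^-1 are both missing, maximality gives x = p(w) = q(w^-1) over S. Let deg q = m <= deg
    p, up to exchanging w and w^-1. Multiplying the second relation by w^m and dividing by the unit
    1 - x^-1 q_0 expresses w^m through lower powers; this lowers the degree of p, and descent on the
    total size ends in a contradiction. *)
Lemma maximal_valuation S w : admissible S -> (forall S', admissible S' -> S `<=` S' -> S' = S) ->
  S w \/ S w^-1.
Proof.
move=> AS maxS; have [HS SF Sy nSx] := AS; case: (HS) => S1 SB SM.
have [|nSw] := pselect (S w); first by left.
have [|nSwi] := pselect (S w^-1); first by right.
have w0 : w != 0 by apply/eqP => w0; apply: nSw; rewrite w0; exact: subring0.
exfalso.
have key (n : nat) : forall v, v != 0 -> ~ S v -> ~ S v^-1 -> forall p q : {poly K},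
    (forall i, S p`_i) -> (forall i, S q`_i) -> x = p.[v] -> x = q.[v^-1] ->
    (size p + size q <= n)%N -> False.
  elim: n => [|n IHn] v v0 nv nvi p q Sp Sq pE qE pqn.
    move: pE; have -> : p = 0 by apply/eqP; rewrite -size_poly_eq0; case: (size p) pqn.
    by rewrite horner0 => /eqP; rewrite (negbTE x_neq0).
  wlog qp : v p q v0 nv nvi Sp Sq pE qE pqn / (size q <= size p)%N.
    move=> H; case: (leqP (size q) (size p)) => [|/ltnW] qp; first exact: (H v p q).
    by apply: (H v^-1 q p) => //; rewrite ?invr_neq0 ?invrK // addnC.
  set m := (size q).-1.
  have sq : size q = m.+1.
    rewrite prednK // lt0n size_poly_eq0; apply/eqP => q0.
    by move: qE; rewrite q0 horner0 => /eqP; rewrite (negbTE x_neq0).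
  have Hq : x * v ^+ m = \sum_(j < m) q`_(m - j) * v ^+ j + q`_0 * v ^+ m.
    rewrite {1}qE horner_coef sq mulr_suml (reindex_inj rev_ord_inj) big_ord_recr /= subnn.
    rewrite expr0 mulr1; congr (_ + _); apply: eq_bigr => j _; rewrite subSS.
    have -> : v ^+ m = v ^+ (m - j) * v ^+ j by rewrite -exprD subnK // ltnW.
    by rewrite -mulrA exprVn mulKf ?expf_neq0.
  case: (posnP m) => [m0|m_gt0].
    by apply: nSx; move: Hq; rewrite m0 big_ord0 add0r !expr0 !mulr1 => ->.
  set d := (size p).-1.
  have sp : size p = d.+1 by rewrite prednK // (leq_trans _ qp) // sq.
  have md : (m <= d)%N by rewrite -ltnS -sq -sp.
  set u := (1 - x^-1 * q`_0)^-1; have Su : S u by exact: maximal_unit.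
  have u0 : 1 - x^-1 * q`_0 != 0.
    apply/eqP => /eqP; rewrite subr_eq0 eq_sym => /eqP E; apply: nSx.
    by have <- : q`_0 = x by rewrite -[q`_0]mul1r -(mulfV x_neq0) -mulrA E mulr1.
  pose r := \poly_(j < m) (u * x^-1 * q`_(m - j)).
  have rE : r.[v] = v ^+ m.
    apply: (mulfI u0); rewrite horner_poly mulr_sumr.
    transitivity (x^-1 * (x * v ^+ m - q`_0 * v ^+ m)); last first.
      by rewrite mulrBr mulKf ?x_neq0 // mulrBl mul1r mulrA.
    rewrite Hq addrK mulr_sumr; apply: eq_bigr => j _.
    by rewrite /u !mulrA mulfV // mul1r.
  pose p' := (p - p`_d *: 'X^d) + p`_d *: ('X^(d - m) * r).
  have Sp' i : S p'`_i.
    rewrite /p' coefD coefB !coefZ coefXn coefXnM; apply: subringD => //.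
      by apply: SB => //; apply: (SM) => //; case: eqP => _; [exact: S1|exact: subring0].
    apply: (SM) => //; case: ifP => _; first exact: subring0.
    rewrite coef_poly; case: ifP => _; last exact: subring0.
    by apply: (SM) => //; apply: SM.
  apply: (IHn v v0 nv nvi p' q Sp' Sq _ qE).
    by rewrite /p' 2!hornerD hornerN !hornerZ hornerM !hornerXn rE -exprD subnK // -pE subrK.
  rewrite -ltnS (leq_trans _ pqn) // ltn_add2r sp ltnS.
  apply/leq_sizeP => i di; rewrite /p' coefD coefB !coefZ coefXn coefXnM.
  rewrite ltnNge (leq_trans (leq_subr _ _) di) /= coef_poly ltnNge.
  have -> : (m <= i - (d - m))%N by rewrite leq_subRL ?(leq_trans (leq_subr _ _) di) // subnK.
  rewrite mulr0 addr0; case: eqP => [->|/eqP id]; first by rewrite mulr1 subrr.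
  by rewrite mulr0 subr0 nth_default // sp ltn_neqAle eq_sym id.
have [p Sp pE] := maximal_adjoin AS maxS nSw.
have [q Sq qE] := maximal_adjoin AS maxS nSwi.
exact: (key _ w w0 nSw nSwi p q Sp Sq pE qE (leqnn _)).
Qed.

Lemma valuation_ring_exists : exists S : set K,
  [/\ is_subring S, forall c, S (iota c), ~ S x & forall w, S w \/ S w^-1].
Proof.
have [S AS maxS] := maximal_admissible; exists S.
by case: (AS) => HS SF _ nSx; split => // w; exact: maximal_valuation.
Qed.

(** If a^-1 is in S, dividing an equation of degree d by its leading coefficient and by a^(d-1)
    writes a as a polynomial in a^-1 over F. *)
Lemma valuation_ring_algebraic (S : set K) a : is_subring S -> (forall c, S (iota c)) ->
  (forall w, S w \/ S w^-1) -> algebraicOver iota a -> S a.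
Proof.
move=> HS SF Sval [p p0 pa]; have [S1 SB SM] := HS.
have [//|Sai] := Sval a; have [->|a0] := eqVneq a 0; first exact: subring0.
set d := (size p).-1.
have sp : size p = d.+1 by rewrite prednK // lt0n size_poly_eq0.
have lc0 : iota p`_d != 0 by rewrite fmorph_eq0 -[d]/(_.-1) -lead_coefE lead_coef_eq0.
move: pa; rewrite /root horner_coef size_map_poly sp big_ord_recr /= coef_map => /eqP E.
have [d0|d0] := posnP d.
  by move: E lc0; rewrite d0 big_ord0 add0r expr0 mulr1 => ->; rewrite eqxx.
have -> : a = - \sum_(i < d) iota (p`_d)^-1 * iota p`_i * a^-1 ^+ (d.-1 - i).
  apply: (@mulIf _ (iota p`_d * a ^+ d.-1)); first by rewrite mulf_neq0 ?expf_neq0.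
  have -> : a * (iota p`_d * a ^+ d.-1) = iota p`_d * a ^+ d.
    by rewrite mulrCA -exprS prednK.
  move/eqP: E; rewrite addrC addr_eq0 => /eqP ->; rewrite mulNr; congr (- _).
  rewrite mulr_suml; apply: eq_bigr => i _; rewrite coef_map /= fmorphV.
  have -> : a ^+ d.-1 = a ^+ (d.-1 - i) * a ^+ i.
    by rewrite -exprD subnK // -ltnS prednK.
  by rewrite exprVn; field; rewrite lc0 expf_neq0.
apply: subringN => //; apply: subring_sum => // i _.
by apply: (SM); [exact: SM|exact: subringX].
Qed.

End ValuationRing.

(** * Coefficients of algebraic power series *)

Section AlgebraicSeries.
Variables (F K : fieldType) (iota : {rmorphism F -> K}).

Definition algpred : {pred K} := fun a => `[< algebraicOver iota a >].

Lemma algpred_divring : divring_closed algpred.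
Proof.
split; first by apply/asboolP; exact: algebraic1.
  by move=> a b /asboolP Ha /asboolP Hb; apply/asboolP; exact: algebraic_sub.
by move=> a b /asboolP Ha /asboolP Hb; apply/asboolP; exact: algebraic_div.
Qed.

HB.instance Definition _ := GRing.isDivringClosed.Build K algpred algpred_divring.

Lemma algpred_root (p : {poly K}) a : p != 0 -> root p a -> p \is a polyOver algpred -> a \in algpred.
Proof.
move=> p0 pa /polyOverP pS; apply/asboolP/integral_algebraic.
apply: (integral_root p0 pa) => b /(nthP 0)[i _ <-].
by apply/integral_algebraic/asboolP; exact: pS.
Qed.

(** The largest power of the inner variable is divided out, so that setting this variable to 0
    leaves a nonzero polynomial. *)
Lemma poly2_divX (L : idomainType) (Q : {poly {poly L}}) : Q != 0 ->
  exists (e : nat) (Q1 : {poly {poly L}}), Q = ('X^e)%:P * Q1 /\ map_poly (horner_eval 0) Q1 != 0.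
Proof.
move=> Q0; set P := swapXY Q.
have P0 : P != 0 by rewrite swapXY_eq0.
have exP : exists e, P`_e != 0 by exists (size P).-1; rewrite -lead_coefE lead_coef_eq0.
case: (ex_minnP exP) => e Pe mine.
have PE : P = drop_poly e P * 'X^e.
  rewrite -{1}(poly_take_drop e P); suff -> : take_poly e P = 0 by rewrite add0r.
  apply/polyP => i; rewrite coef_take_poly coef0; case: ltnP => // ie.
  by apply/eqP; apply: contraLR ie; rewrite -leqNgt; exact: mine.
exists e, (swapXY (drop_poly e P)); split.
  by rewrite -[LHS]swapXYK -/P {1}PE rmorphM /= rmorphXn /= swapXY_X mulrC rmorphXn.
by rewrite -horner_polyC horner_coef0 coef_drop_poly.
Qed.

Lemma algebraic_series0 (Q : {poly {poly K}}) (y : nat -> K) : Q != 0 ->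
  Q \is a polyOver (polyOver algpred) ->
  (forall N j, (j < N)%N -> (Q.[\poly_(i < N) y i])`_j = 0) -> y 0%N \in algpred.
Proof.
move=> Q0 Qalg Qy; have [e [Q1 [QE Q10]]] := poly2_divX Q0.
apply: (algpred_root Q10).
  rewrite /root; have := Qy e.+1 e (ltnSn e).
  rewrite QE hornerM hornerC coefXnM ltnn subnn -horner_coef0.
  rewrite -[X in X = 0]/(horner_eval 0 _) -horner_map /= => E.
  by rewrite /horner_eval in E *; rewrite horner_coef0 coef_poly /= in E; apply/eqP.
apply/polyOverP => i; rewrite coef_map /= /horner_eval horner_coef0.
have /polyOverP/(_ i)/polyOverP/(_ e) := Qalg.
by rewrite QE coefCM coefXnM ltnn subnn.
Qed.

(** The constant term of a root is algebraic by setting the variable to 0. Substituting y = y_0 + X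
    y_1 gives a nonzero equation, still with algebraic coefficients, for the shifted series. The
    series enters only through its truncations. *)
Lemma algebraic_series (n : nat) (Q : {poly {poly K}}) (y : nat -> K) : Q != 0 ->
  Q \is a polyOver (polyOver algpred) ->
  (forall N j, (j < N)%N -> (Q.[\poly_(i < N) y i])`_j = 0) -> y n \in algpred.
Proof.
elim: n Q y => [|n IHn] Q y Q0 Qalg Qy; first exact: algebraic_series0 Qy.
have y0 := algebraic_series0 Q0 Qalg Qy.
pose T : {poly {poly K}} := ('X)%:P * 'X + (y 0%N)%:P%:P.
apply: (IHn (Q \Po T) (fun i => y i.+1)).
- rewrite comp_poly_eq0 // /T size_MXaddC.
  by rewrite polyC_eq0 polyX_eq0 /= size_polyC polyX_eq0.
- apply: polyOver_comp => //; rewrite /T rpredD ?rpredM ?polyOverC ?polyOverX //.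
move=> N j jN; have := Qy N.+1 j (leq_trans jN (leqnSn N)).
rewrite horner_comp; congr ((Q.[_])`_j = 0).
rewrite /T !hornerE; apply/polyP => i; rewrite coefD coefXM coefC !coef_poly.
by case: i => [|i] /=; rewrite ?add0r ?addr0.
Qed.

End AlgebraicSeries.

(** * A field of germs *)

Section GenericField.
Variables (R : realType) (n : nat).
Local Notation C := R[i].
Local Notation V := 'rV[C]_n.

(* An alias, since only [GRing.ComPzRing] is canonical on a plain function type. *)
Definition germ : Type := V -> C.
HB.instance Definition _ := GRing.ComPzRing.on germ.

Lemma germ1_neq0 : (1 : germ) != 0.
Proof. by apply/eqP => /(congr1 (fun f => f 0)) /eqP; rewrite oner_eq0. Qed.

HB.instance Definition _ := GRing.PzSemiRing_isNonZero.Build germ germ1_neq0.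

Definition mev (z : V) : {mpoly C[n]} -> C := meval (fun j => z ord0 j).

Definition pev (P : {poly {mpoly C[n]}}) (z : V) (y : C) : C := (map_poly (mev z) P).[y].

HB.instance Definition _ z := GRing.RMorphism.on (mev z).

Lemma pevM P Q z y : pev (P * Q) z y = pev P z y * pev Q z y.
Proof. by rewrite /pev rmorphM /= hornerM. Qed.

(** As f is not algebraic, the sets where P(z, f(z)) <> 0 are nonempty, and a product of polynomials
    corresponds to an intersection, so they generate a proper filter. An ultrafilter above it makes
    vanishing almost everywhere a prime ideal that contains no P(z, f(z)) with P <> 0. *)
Lemma generic_domain (D : set V) (f : V -> C) : ~ algebraic_on D f ->
  exists (B : idomainType) (cl : {rmorphism germ -> B}),
    (forall g : V -> C, (forall z, D z -> g z = 0) -> cl g = 0) /\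
    forall P : {poly {mpoly C[n]}}, P != 0 -> cl (fun z => pev P z (f z)) != 0.
Proof.
move=> nalg.
pose U P := [set z | D z /\ pev P z (f z) != 0].
have U0 P : P != 0 -> U P !=set0.
  move=> P0; apply: contrapT => UP; apply: nalg; exists P; split => // z Dz.
  by apply: contrapT => nz; apply: UP; exists z; split => //; exact/eqP.
pose FF : set_system V := [set A | exists2 P, P != 0 & U P `<=` A].
have FFilter : ProperFilter FF.
  apply: Build_ProperFilter.
    by move=> [P P0 PA]; have [z Uz] := U0 P P0; exact: (PA z Uz).
  split.
  - by exists 1 => //; exact: oner_neq0.
  - move=> A B [P P0 PA] [Q Q0 QB]; exists (P * Q); first exact: (mulf_neq0 P0 Q0).
    move=> z [Dz]; rewrite pevM mulf_eq0 negb_or => /andP[pz qz].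
    by split; [apply: PA|apply: QB].
  - by move=> A B AB [P P0 PA]; exists P => //; exact: subset_trans AB.
have [W [WU FW]] := ultraFilterLemma FFilter.
pose I (g : V -> C) := W [set z | g z = 0].
have [|||||B [h hE]] := @quotient_domain germ I.
- by apply: filterS (filterT) => z.
- by move=> a b Ia Ib; apply: filterS2 Ia Ib => z /= az bz; rewrite /GRing.add /= /GRing.opp /= az bz subrr.
- move=> I1; have [z] := filter_ex I1; rewrite /= => /eqP; rewrite oner_eq0 //.
- by move=> a b Ib; apply: filterS Ib => z /= bz; rewrite /GRing.mul /= bz mulr0.
- move=> a b Iab; have [|Ia] := in_ultra_setVsetC [set z | a z = 0] WU; first by left.
  right; apply: filterS2 Ia Iab => z /= az /eqP; rewrite mulf_eq0 => /orP[/eqP //|/eqP //].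
exists B, h; split.
  move=> g g0; apply/hE; apply: FW; exists 1; first exact: oner_neq0.
  by move=> z [Dz _]; exact: g0.
move=> P P0; apply/eqP => /hE IP.
have UP : W (U P) by apply: FW; exists P.
by have [z [[Dz /eqP]]] := filter_ex (filterI UP IP).
Qed.

Lemma clear_denominators (B : idomainType) (p : {poly {fraction B}}) :
  exists (d : B) (q : {poly B}), d != 0 /\ (tofrac d) *: p = map_poly (@tofrac B) q.
Proof.
elim/poly_ind: p => [|p c [d [q [d0 dq]]]].
  by exists 1, 0; rewrite oner_neq0 scaler0 rmorph0.
have [[a b] /= [b0 cE]] := fraction_rep c.
exists (d * b), (b *: q * 'X + (d * a)%:P); split; first by rewrite mulf_neq0.
rewrite rmorphM /= scalerDr rmorphD rmorphM /= map_polyX map_polyC /= map_polyZ /= -dq.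
rewrite -mulrC -scalerA -!scalerAl; congr (_ + _).
rewrite rmorphM /= -!mul_polyC -polyCM; congr _%:P.
rewrite cE [tofrac b * _]mulrC -mulrA; congr (_ * _).
by rewrite mulrC divfK ?tofrac_eq0.
Qed.

Lemma horner_class (K : comNzRingType) (cl : {rmorphism germ -> K})
  (g : {rmorphism {mpoly C[n]} -> K}) (gE : forall p, g p = cl (fun z => mev z p))
  (P : {poly {mpoly C[n]}}) (f : V -> C) :
  (map_poly g P).[cl f] = cl (fun z => pev P z (f z)).
Proof.
elim/poly_ind: P => [|P c IHP].
  rewrite rmorph0 horner0 -(rmorph0 cl); congr (cl _).
  by apply/funext => z; rewrite /pev rmorph0 horner0.
rewrite rmorphD rmorphM /= map_polyX map_polyC /= hornerMXaddC IHP gE.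
rewrite -rmorphM -rmorphD; congr (cl _); apply/funext => z.
by rewrite /pev rmorphD rmorphM /= map_polyX map_polyC /= hornerMXaddC.
Qed.

Lemma generic_field (D : set V) (f : V -> C) : ~ algebraic_on D f ->
  exists (K : fieldType) (cl : {rmorphism germ -> K})
    (iota : {rmorphism {fraction {mpoly C[n]}} -> K}),
  [/\ forall g : V -> C, (forall z, D z -> g z = 0) -> cl g = 0,
      forall p, iota (tofrac p) = cl (fun z => mev z p) &
      forall p : {poly {fraction {mpoly C[n]}}}, p != 0 -> (map_poly iota p).[cl f] != 0].
Proof.
move=> /generic_domain[B [h [hD hP]]].
pose cl : {rmorphism germ -> {fraction B}} := @tofrac B \o h.
pose ev (p : {mpoly C[n]}) : germ := fun z => mev z p.
have evB : zmod_morphism ev by move=> p q; apply/funext => z; rewrite /ev rmorphB.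
have evM : monoid_morphism ev.
  by split => [|p q]; apply/funext => z; rewrite /ev ?rmorph1 ?rmorphM.
pose evA := GRing.isZmodMorphism.Build _ _ ev evB.
pose evR := GRing.isMonoidMorphism.Build _ _ ev evM.
pose E : {rmorphism {mpoly C[n]} -> germ} := HB.pack ev evA evR.
pose g : {rmorphism {mpoly C[n]} -> {fraction B}} := cl \o E.
have hg := @horner_class _ cl g (fun=> erefl).
have gP P : P != 0 -> (map_poly g P).[cl f] != 0.
  by move=> P0; rewrite hg /= tofrac_eq0; exact: hP.
have g_inj : injective g.
  apply: raddf_inj => p /eqP gp0; apply/eqP; apply: contraTT gp0 => p0.
  by have := gP p%:P; rewrite polyC_eq0 map_polyC hornerC; apply.
have [iota iotaE] := fraction_extension g_inj.
exists {fraction B}, cl, iota; split.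
- by move=> k /hD /= ->; rewrite rmorph0.
- by move=> p; rewrite iotaE.
move=> p p0; have [d [q [d0 dq]]] := clear_denominators p.
have q0 : q != 0.
  apply: contraNneq p0 => q0; move: dq; rewrite q0 rmorph0 => /eqP.
  by rewrite scaler_eq0 tofrac_eq0 (negbTE d0).
have := gP q q0; have -> : map_poly g q = map_poly iota (map_poly (@tofrac _) q).
  by rewrite -map_poly_comp; apply: eq_map_poly => a /=; rewrite iotaE.
by rewrite -dq map_polyZ hornerZ mulf_eq0 negb_or => /andP[].
Qed.

End GenericField.

(** * Logarithmic derivatives and jets *)

Section LogDerivativePolynomial.
Variable T : finType.

(* Numerator of the logarithmic derivative of Y^-1 * prod_s U_s^(e_s), up to sign. *)
Definition Lam (B : comNzRingType) (U : T -> {poly B}) (Y : {poly B}) (e : T -> B) : {poly B} :=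
  Y^`() * \prod_s U s - Y * \sum_s e s *: ((U s)^`() * \prod_(s' | s' != s) U s').

Lemma Lam_map (B B' : comNzRingType) (g : {rmorphism B -> B'}) U Y e :
  map_poly g (Lam U Y e) = Lam (fun s => map_poly g (U s)) (map_poly g Y) (fun s => g (e s)).
Proof.
rewrite /Lam rmorphB !rmorphM /= deriv_map rmorph_prod rmorph_sum /=.
congr (_ - _ * _); apply: eq_bigr => s _.
by rewrite map_polyZ rmorphM /= deriv_map rmorph_prod.
Qed.

(** [Lam] is homogeneous of degree 1 in each U_s; hence dividing each U_s by its dominant
    coefficient preserves the vanishing of its coefficients. *)
Lemma Lam_scale (B : comNzRingType) (U : T -> {poly B}) Y e (c : T -> B) :
  Lam (fun s => c s *: U s) Y e = (\prod_s c s) *: Lam U Y e.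
Proof.
have scale_prod (P : pred T) : \prod_(s | P s) (c s *: U s) = (\prod_(s | P s) c s) *: \prod_(s | P s) U s.
  rewrite -mul_polyC rmorph_prod /= -big_split /=.
  by apply: eq_bigr => s _; rewrite mul_polyC.
rewrite /Lam scalerBr; congr (_ - _); first by rewrite scale_prod scalerAr.
rewrite [RHS]scalerAr; congr (_ * _); rewrite scaler_sumr; apply: eq_bigr => s _.
rewrite scale_prod derivZ -scalerAl -scalerAr !scalerA; congr (_ *: _).
by rewrite [RHS]mulrC [in RHS](bigD1 s) //= mulrA.
Qed.

Lemma X_deriv_identity (A : comNzRingType) (x p w w' : A) n :
  x * (p *+ n * w + x * p * w') = x * p * (w *+ n + x * w').
Proof. by rewrite -[p *+ n]mulr_natr -[w *+ n]mulr_natr; ring. Qed.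

(** With U_s = X^(k_s) W_s, the product X Lam equals X^(sum k_s) Z, where Z(0) = - Y(0) (sum e_s
    k_s) prod W_s(0). The extra factor X spares the exponents k_s - 1; coefficient sum k_s of X Lam
    is coefficient sum k_s - 1 of Lam, hence the bound by M. *)
Lemma Lam_order (B : idomainType) (U : T -> {poly B}) (Y : {poly B}) (e : T -> B) (k : T -> nat) (M : nat) :
  (forall s, (U s)`_(k s) != 0) -> (forall s j, (j < k s)%N -> (U s)`_j = 0) -> Y`_0 != 0 ->
  (forall j, (j < M)%N -> (Lam U Y e)`_j = 0) -> (\sum_s k s <= M)%N ->
  \sum_s e s *+ k s = 0.
Proof.
move=> Uk Uj Y0 LM kM.
pose W s := drop_poly (k s) (U s).
have UE s : U s = 'X^(k s) * W s.
  rewrite mulrC -[LHS](poly_take_drop (k s)); suff -> : take_poly (k s) (U s) = 0 by rewrite add0r.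
  by apply/polyP => j; rewrite coef_take_poly coef0; case: ltnP => // /Uj.
have W0 s : (W s).[0] != 0 by rewrite horner_coef0 coef_drop_poly.
have prodE (P : pred T) : \prod_(s | P s) U s = 'X^(\sum_(s | P s) k s) * \prod_(s | P s) W s.
  by rewrite (eq_bigr _ (fun s _ => UE s)) big_split /= prodrXr.
have XU' s : 'X * (U s)^`() = 'X^(k s) * (W s *+ k s + 'X * (W s)^`()).
  rewrite UE derivM derivXn; case: (k s) => [|j].
    by rewrite !mulr0n mul0r !add0r expr0 !mul1r.
  by rewrite /= exprS X_deriv_identity.
pose S := (\sum_s k s)%N.
pose Z := 'X * Y^`() * \prod_s W s
  - Y * \sum_s e s *: ((W s *+ k s + 'X * (W s)^`()) * \prod_(s' | s' != s) W s').
have XL : 'X * Lam U Y e = 'X^S * Z.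
  rewrite /Lam /Z !mulrBr; congr (_ - _).
    by rewrite prodE -/S; ring.
  rewrite mulrCA [in RHS]mulrCA; congr (_ * _); rewrite !mulr_sumr; apply: eq_bigr => s _.
  rewrite -!scalerAr; congr (_ *: _); rewrite mulrA XU' prodE.
  have -> : S = (k s + \sum_(s0 | s0 != s) k s0)%N by rewrite /S (bigD1 s).
  by rewrite exprD -!mulrA; congr (_ * _); exact: mulrCA.
have Z0 : Z.[0] = 0.
  rewrite horner_coef0; have := congr1 (fun p : {poly B} => p`_S) XL.
  rewrite coefXM coefXnM ltnn subnn => <-; case: eqP => // /eqP S0.
  by apply: LM; rewrite -ltnS prednK ?lt0n // ltnS.
move: Z0; rewrite /Z hornerD hornerN !hornerM hornerX !mul0r add0r => /eqP.
rewrite oppr_eq0 mulf_eq0 horner_coef0 (negbTE Y0) /= horner_sum => /eqP E.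
apply: (@mulIf _ (\prod_s (W s).[0])); first by apply/prodf_neq0 => s _; exact: W0.
rewrite mul0r -[RHS]E mulr_suml; apply: eq_bigr => s _.
rewrite hornerZ hornerM hornerD hornerMn hornerM hornerX mul0r addr0 horner_prod.
by rewrite (bigD1 s) //= mulrnAl -!mulrnAr mulrnAl -mulrnAr || rewrite (bigD1 s) //= -mulr_natr -[_ *+ k s]mulr_natr; ring.
Qed.

End LogDerivativePolynomial.

(** * Expansions of finite order at 0 *)

Section Jets.
Variable R : realType.
Local Notation C := R[i].
Implicit Types (f g : C -> C) (p q : {poly C}) (M : nat).

(** The relation f = p + O(t^M), with p of any degree. The point t = 0 is left out because the
    expansion of a derivative is established off 0 ([taylor_jet_deriv]). *)
Definition jet M f p := exists B d : R, [/\ 0 <= B, 0 < d &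
  forall t, t != 0 -> cmod t < d -> cmod (f t - p.[t]) <= B * cmod t ^+ M].

Lemma poly_bounded p : exists2 b : R, 0 <= b & forall t, cmod t <= 1 -> cmod p.[t] <= b.
Proof.
exists (\sum_(i < size p) cmod p`_i); first by apply: sumr_ge0 => i _; exact: cmod_ge0.
move=> t t1; rewrite horner_coef; apply: le_trans (cmod_sum _ _ _) _.
apply: ler_sum => i _; rewrite cmodM cmodX -[X in _ <= X]mulr1.
by apply: ler_wpM2l; [exact: cmod_ge0|apply: exprn_ile1 => //; exact: cmod_ge0].
Qed.

Lemma jet_poly M p : jet M (horner p) p.
Proof.
by exists 0, 1; split => // t _ _; rewrite subrr cmod0 mul0r.
Qed.

Lemma jet_ext M f g p : (exists2 d : R, 0 < d & forall t, t != 0 -> cmod t < d -> f t = g t) ->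
  jet M f p -> jet M g p.
Proof.
move=> [d d0 fg] [B [d' [B0 d'0 H]]]; exists B, (Order.min d d'); split => //; first by rewrite lt_min d0.
by move=> t t0; rewrite lt_min => /andP[td td']; rewrite -fg //; exact: H.
Qed.

Lemma jet_cst M c : jet M (fun=> c) c%:P.
Proof.
by apply: jet_ext (jet_poly M c%:P); exists 1 => // t _ _; rewrite hornerC.
Qed.

Lemma jetD M f g p q : jet M f p -> jet M g q -> jet M (fun t => f t + g t) (p + q).
Proof.
move=> [B [d [B0 d0 H]]] [B' [d' [B'0 d'0 H']]].
exists (B + B'), (Order.min d d'); split; [exact: addr_ge0|by rewrite lt_min d0|].
move=> t t0; rewrite lt_min => /andP[td td']; rewrite hornerD.
have -> : f t + g t - (p.[t] + q.[t]) = (f t - p.[t]) + (g t - q.[t]) by ring.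
by apply: le_trans (cmodD _ _) _; rewrite mulrDl lerD // ?H ?H'.
Qed.

Lemma jetM M f g p q : jet M f p -> jet M g q -> jet M (fun t => f t * g t) (p * q).
Proof.
move=> [B [d [B0 d0 H]]] [B' [d' [B'0 d'0 H']]].
have [b b0 pb] := poly_bounded p; have [b' b'0 qb] := poly_bounded q.
exists (B * (B' + b') + b * B'), (Order.min 1 (Order.min d d')); split.
- by rewrite addr_ge0 ?mulr_ge0 ?addr_ge0.
- by rewrite !lt_min ltr01 d0.
move=> t t0; rewrite !lt_min => /and3P[t1 td td']; rewrite hornerM.
have -> : f t * g t - p.[t] * q.[t] = (f t - p.[t]) * g t + p.[t] * (g t - q.[t]) by ring.
have gb : cmod (g t) <= B' + b'.
  have -> : g t = (g t - q.[t]) + q.[t] by ring.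
  apply: le_trans (cmodD _ _) _; apply: lerD; last by apply: qb; exact: ltW.
  apply: le_trans (H' t t0 td') _; rewrite -[X in _ <= X]mulr1; apply: ler_wpM2l => //.
  by apply: exprn_ile1; [exact: cmod_ge0|exact: ltW].
apply: le_trans (cmodD _ _) _; rewrite !cmodM mulrDl; apply: lerD.
  by rewrite mulrAC; apply: ler_pM; rewrite ?cmod_ge0 ?H.
by rewrite -mulrA; apply: ler_pM; rewrite ?cmod_ge0 ?H' // pb // ltW.
Qed.

Lemma jetZ M c f p : jet M f p -> jet M (fun t => c * f t) (c *: p).
Proof. by move=> H; rewrite -mul_polyC; apply: jetM H; exact: jet_cst. Qed.

Lemma jetB M f g p q : jet M f p -> jet M g q -> jet M (fun t => f t - g t) (p - q).
Proof.
move=> Hf Hg; rewrite -[- q]scaleN1r.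
by apply: jet_ext (jetD Hf (jetZ (-1) Hg)); exists 1 => // t _ _; rewrite mulN1r.
Qed.

Lemma jet_sum M (I : Type) (r : seq I) (P : pred I) (f : I -> C -> C) (p : I -> {poly C}) :
  (forall i, P i -> jet M (f i) (p i)) ->
  jet M (fun t => \sum_(i <- r | P i) f i t) (\sum_(i <- r | P i) p i).
Proof.
move=> H; elim: r => [|i r IHr].
  rewrite big_nil; apply: jet_ext (jet_cst M 0); exists 1 => // t _ _; by rewrite big_nil.
rewrite big_cons; case: ifPn => Pi.
  apply: jet_ext (jetD (H i Pi) IHr); exists 1 => // t _ _; by rewrite big_cons Pi.
by apply: jet_ext IHr; exists 1 => // t _ _; rewrite big_cons (negbTE Pi).
Qed.

Lemma jet_prod M (I : Type) (r : seq I) (P : pred I) (f : I -> C -> C) (p : I -> {poly C}) :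
  (forall i, P i -> jet M (f i) (p i)) ->
  jet M (fun t => \prod_(i <- r | P i) f i t) (\prod_(i <- r | P i) p i).
Proof.
move=> H; elim: r => [|i r IHr].
  rewrite big_nil; apply: jet_ext (jet_cst M 1); exists 1 => // t _ _; by rewrite big_nil.
rewrite big_cons; case: ifPn => Pi.
  apply: jet_ext (jetM (H i Pi) IHr); exists 1 => // t _ _; by rewrite big_cons Pi.
by apply: jet_ext IHr; exists 1 => // t _ _; rewrite big_cons (negbTE Pi).
Qed.

(** Uniqueness of expansions, by strong induction on j: once the lower coefficients vanish, p = q
    X^j with |q(t)| <= B |t|, and q(0) = 0 by continuity. *)
Lemma jet_zero M f p : (exists2 d : R, 0 < d & forall t, t != 0 -> cmod t < d -> f t = 0) ->
  jet M f p -> forall j, (j < M)%N -> p`_j = 0.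
Proof.
move=> [d d0 f0] [B [d' [B0 d'0 H]]] j; have [n] := ubnP j; elim: n j => // n IHn j.
rewrite ltnS => jn jM.
have lowj i : (i < j)%N -> p`_i = 0 by move=> ij; apply: IHn; [exact: leq_trans ij jn|exact: ltn_trans jM].
pose q := drop_poly j p.
have pE : p = q * 'X^j.
  rewrite -[LHS](poly_take_drop j); suff -> : take_poly j p = 0 by rewrite add0r.
  by apply/polyP => i; rewrite coef_take_poly coef0; case: ltnP => // /lowj.
have -> : p`_j = q.[0] by rewrite horner_coef0 coef_drop_poly add0n.
have qb t : t != 0 -> cmod t < d -> cmod t < d' -> cmod t < 1 -> cmod q.[t] <= B * cmod t.
  move=> t0 td td' t1; have := H t t0 td'; rewrite f0 // sub0r cmodN pE hornerM hornerXn cmodM cmodX.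
  have tj0 : 0 < cmod t ^+ j by rewrite exprn_gt0 // cmod_gt0.
  have -> : cmod t ^+ M = cmod t ^+ (M - j) * cmod t ^+ j by rewrite -exprD subnK // ltnW.
  rewrite mulrA ler_pM2r // => /le_trans; apply; apply: ler_wpM2l => //.
  rewrite -[X in _ <= X]expr1; apply: ler_wiXn2l; rewrite ?cmod_ge0 ?(ltW t1) //.
  by rewrite subn_gt0.
apply/eqP; rewrite -cmod_eq0; apply/eqP/le_anti; rewrite cmod_ge0 andbT leNgt; apply/negP => X0.
have [d1 d10 H1] := cdiff_cont (cdiff_horner q 0) (half_pos X0).
pose X := cmod q.[0].
(* At this point |q(x)| <= B x < X/4 while |q(x) - q(0)| <= X/2, which is incompatible with |q(0)| =
   X. *)
pose x := Order.min (X / (4 * (B + 1))) (Order.min d1 (Order.min 1 (Order.min d d'))) / 2.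
have B1 : 0 < 4 * (B + 1) by rewrite mulr_gt0 // ltr_wpDl.
have m0 : 0 < Order.min (X / (4 * (B + 1))) (Order.min d1 (Order.min 1 (Order.min d d'))).
  by rewrite !lt_min ltr01 d0 d'0 d10 divr_gt0.
have x0 : 0 < x by rewrite divr_gt0.
have := half_lt m0; rewrite -/x !lt_min => /and5P[xX xd1 x1 xd xd'].
have cx : cmod (x%:C%C : C) = x by rewrite cmod_real gtr0_norm.
have := H1 x%:C%C; rewrite add0r cx => /(_ xd1) h1.
have xn0 : x%:C%C != 0 :> C by rewrite -cmod_gt0 cx.
have := qb x%:C%C xn0; rewrite cx => /(_ xd xd' x1) h2.
have h3 := cmodB q.[x%:C%C] (q.[x%:C%C] - q.[0]); rewrite subKr in h3.
rewrite ltr_pdivlMr // in xX; rewrite -/X in h1 h3 X0; nra.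
Qed.

Lemma jet_weak M M' f p : (M' <= M)%N -> jet M f p -> jet M' f p.
Proof.
move=> MM [B [d [B0 d0 H]]]; exists B, (Order.min d 1); split; rewrite ?lt_min ?d0 ?ltr01 //.
move=> t t0; rewrite lt_min => /andP[td t1]; apply: le_trans (H t t0 td) _.
by apply: ler_wpM2l => //; apply: ler_wiXn2l; rewrite ?cmod_ge0 ?ltW.
Qed.

Lemma Lam_jet (T : finType) M (u u' : T -> C -> C) (y y' : C -> C) U Y e :
  (forall s, jet M (u s) (U s)) -> (forall s, jet M (u' s) (U s)^`()) ->
  jet M y Y -> jet M y' Y^`() ->
  (exists2 d : R, 0 < d & forall t, t != 0 -> cmod t < d ->
    y' t * \prod_s u s t = y t * \sum_s e s * (u' s t * \prod_(s' | s' != s) u s' t)) ->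
  forall j, (j < M)%N -> (Lam U Y e)`_j = 0.
Proof.
move=> Hu Hu' Hy Hy' [d d0 E].
apply: (@jet_zero M (fun t => y' t * \prod_s u s t -
    y t * \sum_s e s * (u' s t * \prod_(s' | s' != s) u s' t))).
  by exists d => // t t0 td; rewrite E // subrr.
apply: jetB; apply: jetM => //; first by apply: jet_prod.
by apply: jet_sum => s _; apply: jetZ; apply: jetM => //; exact: jet_prod.
Qed.

End Jets.

(** * The logarithmic derivative of a product of real powers *)

Section LogDerivative.
Variable R : realType.
Local Notation C := R[i].
Implicit Types (w : C) (u y : C -> C).

Lemma cmod_cpow w (a : R) : w != 0 -> cmod (cpow w a) = expR (a * ln (cmod w)).
Proof.
move=> w0; rewrite /cpow (negbTE w0) cmodM -[Complex (_ `^ _) 0]/((cmod w `^ a)%:C%C).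
rewrite cmod_real ger0_norm ?powR_ge0 // /powR cmod_eq0 (negbTE w0).
have -> : cmod (Complex (cos (a * carg w)) (sin (a * carg w))) = 1.
  by rewrite /cmod /= cos2Dsin2 sqrtr1.
by rewrite mulr1.
Qed.

(** The squared modulus avoids the square root; it is the sum of the squares of Re (1 y) and Re (-i
    y), to which [rdiff_lin] applies. *)
Lemma is_derive_ln_cmod y (t d L : C) : y t != 0 -> cdiff y t L ->
  is_derive (0 : R) 1 (fun x : R => ln (cmod (y (t + x%:C%C * d)) ^+ 2)) (2 * complex.Re (L * d / y t)).
Proof.
move=> y0 H.
have S0 : seg t (t + d) 0 = t by rewrite seg0.
have Hr : rdiff (fun x => y (seg t (t + d) x)) 0 (L * d).
  by have := @rdiff_seg R y t (t + d) 0 L; rewrite S0 [t + d]addrC addrK; apply.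
have D1 := rdiff_lin 1 Hr; have D2 := rdiff_lin (- 'i%C) Hr.
have E x : y (t + x%:C%C * d) = y (seg t (t + d) x) by rewrite /seg [t + d]addrC addrK.
have -> : (fun x : R => ln (cmod (y (t + x%:C%C * d)) ^+ 2)) =
  (fun x : R => ln (complex.Re (1 * y (seg t (t + d) x)) ^+ 2 + complex.Re (- 'i%C * y (seg t (t + d) x)) ^+ 2)).
  by apply/funext => x; rewrite E cmod_sqr mul1r; congr (ln (_ + _ ^+ 2)); rewrite !ReImE /=; ring.
set f1 := fun x : R => complex.Re (1 * y (seg t (t + d) x)) in D1 *.
set f2 := fun x : R => complex.Re (- 'i%C * y (seg t (t + d) x)) in D2 *.
have f10 : f1 0 = complex.Re (y t) by rewrite /f1 mul1r S0.
have f20 : f2 0 = complex.Im (y t) by rewrite /f2 S0 !ReImE /=; ring.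
have pos : 0 < f1 0 ^+ 2 + f2 0 ^+ 2 by rewrite f10 f20 -cmod_sqr exprn_gt0 // cmod_gt0.
have D : is_derive (0 : R) 1 (fun x => f1 x ^+ 2 + f2 x ^+ 2)
    (2 * (f1 0 * complex.Re (1 * (L * d)) + f2 0 * complex.Re (- 'i%C * (L * d)))).
  apply: is_derive_eq; rewrite /GRing.scale /=; ring.
have Dl := is_derive1_ln pos.
have := @is_derive1_comp R (@ln R) (fun x => f1 x ^+ 2 + f2 x ^+ 2) 0 _ _ Dl D => H1; apply: (is_derive_eq H1).
rewrite f10 f20 in pos *; move: pos; case: (y t) y0 => a b /= _ pos.
case: (L * d) => p q; rewrite !ReImE /=.
by field; rewrite !lt0r_neq0.
Qed.

Lemma is_derive_near_uniq (f g : R -> R) (a b : R) : (exists2 d : R, 0 < d & forall x, `|x| < d -> f x = g x) ->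
  is_derive (0 : R) 1 f a -> is_derive (0 : R) 1 g b -> a = b.
Proof.
move=> [d d0 fg] /rdiff_real Hf Hg.
suff : is_derive (0 : R) 1 g a by move=> [_ <-]; case: Hg => _ <-.
apply/rdiff_real => e e0; have [d' d'0 H] := Hf e e0.
exists (Order.min d d'); first by rewrite lt_min d0.
move=> h; rewrite lt_min => /andP[hd hd'].
by rewrite add0r -!fg ?normr0 //; have := H h hd'; rewrite add0r.
Qed.

Lemma is_derive_bigsum (I : Type) (r : seq I) (f : I -> R -> R) (df : I -> R) (x : R) :
  (forall i, is_derive x 1 (f i) (df i)) ->
  is_derive x 1 (fun x => \sum_(i <- r) f i x) (\sum_(i <- r) df i).
Proof.
move=> H; elim: r => [|i r IHr].
  rewrite big_nil; have -> : (fun x => \sum_(i <- [::]) f i x) = cst 0.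
    by apply/funext => z; rewrite big_nil.
  exact: is_derive_cst.
rewrite big_cons; have -> : (fun x => \sum_(j <- i :: r) f j x) = f i \+ (fun x => \sum_(j <- r) f j x).
  by apply/funext => z; rewrite big_cons.
exact: is_deriveD.
Qed.

Variable T : finType.

(* Moduli suffice: |cpow w a| = |w|^a has no branch cut, and differentiating
   log |.| in the directions 1 and i recovers the complex logarithmic derivative. *)
Lemma log_derivative (u : T -> C -> C) (u' : T -> C) (y : C -> C) (y' t : C) (a : T -> R) (r : R) :
  0 < r -> (forall h, cmod h < r -> (forall s, u s (t + h) != 0) /\ y (t + h) = \prod_s cpow (u s (t + h)) (a s)) ->
  (forall s, cdiff (u s) t (u' s)) -> cdiff y t y' ->
  y' * \prod_s u s t = y t * \sum_s (a s)%:C%C * (u' s * \prod_(s' | s' != s) u s' t).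
Proof.
move=> r0 Hu du dy.
have u0 s : u s t != 0 by have := (Hu 0 _).1 s; rewrite addr0 cmod0; apply.
have cy h : cmod h < r -> cmod (y (t + h)) = expR (\sum_s a s * ln (cmod (u s (t + h)))).
  move=> /Hu[un ->]; rewrite cmod_prod.
  rewrite (eq_bigr (fun s => expR (a s * ln (cmod (u s (t + h)))))) => [|s _]; last by rewrite cmod_cpow.
  by rewrite (big_morph _ (@expRD R) (@expR0 R)).
have y0 : y t != 0.
  by rewrite -cmod_gt0 -[t]addr0 cy ?cmod0 // expR_gt0.
have lnE h : cmod h < r -> ln (cmod (y (t + h)) ^+ 2) = \sum_s a s * ln (cmod (u s (t + h)) ^+ 2).
  move=> hr; have un s := (Hu h hr).1 s; rewrite lnXn ?cmod_gt0; last by rewrite -cmod_gt0 cy // expR_gt0.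
  rewrite cy // expRK -mulr_natl mulr_sumr; apply: eq_bigr => s _.
  by rewrite lnXn ?cmod_gt0 // -mulr_natl; ring.
pose Q := y' / y t - \sum_s (a s)%:C%C * (u' s / u s t).
have key d : complex.Re (Q * d) = 0.
  have D1 := is_derive_ln_cmod d y0 dy.
  have D2 : is_derive (0 : R) 1 (fun x : R => \sum_s a s * ln (cmod (u s (t + x%:C%C * d)) ^+ 2))
     (\sum_s a s * (2 * complex.Re (u' s * d / u s t))).
    apply: is_derive_bigsum => s; have D := is_derive_ln_cmod d (u0 s) (du s).
    by apply: is_derive_eq; rewrite /GRing.scale /= ?mulr0 ?mul0r ?addr0 ?add0r.
  have := is_derive_near_uniq _ D1 D2.
  have -> : complex.Re (Q * d) = complex.Re (y' * d / y t) - \sum_s a s * complex.Re (u' s * d / u s t).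
    rewrite /Q mulrBl Re_add Re_opp mulrAC; congr (_ - _).
    rewrite mulr_suml (big_morph _ (@Re_add R) (erefl : complex.Re 0 = 0)); apply: eq_bigr => s _.
    have -> : (a s)%:C%C * (u' s / u s t) * d = (a s)%:C%C * (u' s * d / u s t).
      by rewrite -(mulrA (a s)%:C%C) (mulrAC (u' s)).
    by rewrite (Re_mul (a s)%:C%C) /= mul0r subr0.
  move=> H; apply/eqP; rewrite subr_eq0; apply/eqP/(@mulfI _ 2); first by rewrite pnatr_eq0.
  rewrite H; last first.
    exists (r / (cmod d + 1)); first by rewrite divr_gt0 // ltr_wpDl ?cmod_ge0.
    move=> x xr; apply: lnE; rewrite cmodM cmod_real.
    rewrite ltr_pdivlMr ?ltr_wpDl ?cmod_ge0 // in xr; apply: le_lt_trans xr.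
    by apply: ler_wpM2l => //; rewrite lerDl.
  by rewrite mulr_sumr; apply: eq_bigr => s _; rewrite mulrCA.
have Q0 : Q = 0.
  have := key 1; have := key (- 'i%C); rewrite mulr1 => h1 h2; apply: complex_ext => //.
  by rewrite -[RHS]/0 -h1; case: (Q) => p q /=; ring.
have y'E : y' = y t * \sum_s (a s)%:C%C * (u' s / u s t).
  by move/eqP: Q0; rewrite subr_eq0 => /eqP <-; rewrite mulrC divfK.
rewrite y'E -mulrA; congr (_ * _); rewrite mulr_suml; apply: eq_bigr => s _.
by rewrite -mulrA; congr (_ * _); rewrite (bigD1 s) //= mulrA divfK.
Qed.

End LogDerivative.

(** * Linear relations with coefficients in an extension ring *)

Section SeparatingFunctional.
Variables (F : fieldType) (B : comNzRingType) (g : {rmorphism F -> B}).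

(* An F-linear relation among the c_i is detected by a functional with coefficients in F. *)
Lemma separating_functional (N : nat) (c : 'I_N -> B) (v : 'I_N -> F) :
  \sum_i c i * g (v i) != 0 ->
  exists gam : 'I_N -> F, \sum_i gam i * v i != 0 /\
    forall h : 'I_N -> F, \sum_i c i * g (h i) = 0 -> \sum_i gam i * h i = 0.
Proof.
move=> cv.
(* Matrices whose rows are relations. One of maximal rank contains every relation in its row space,
   and the columns of its cokernel are the functionals killing that space; some column does not kill
   v. *)
pose W := fun M : 'M[F]_N => forall i, \sum_j c j * g (M i j) = 0.
pose P := fun k : nat => `[< exists2 M : 'M[F]_N, W M & \rank M = k >].
have P0 : exists k, P k.
  exists 0%N; apply/asboolP; exists 0; last by rewrite mxrank0.
  by move=> i; rewrite big1 // => j _; rewrite mxE rmorph0 mulr0.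
have Pb k : P k -> (k <= N)%N by move=> /asboolP[M _ <-]; exact: rank_leq_row.
case: (ex_maxnP P0 Pb) => k /asboolP[M WM rM] maxk.
have Wlin (x : 'rV[F]_N) : (x <= M)%MS -> \sum_j c j * g (x 0 j) = 0.
  move=> /submxP[D ->]; under eq_bigr do rewrite mxE rmorph_sum mulr_sumr.
  rewrite exchange_big big1 //= => i _.
  under eq_bigr do rewrite rmorphM mulrCA.
  by rewrite -mulr_sumr WM mulr0.
have WM' (h : 'I_N -> F) : \sum_j c j * g (h j) = 0 -> (\row_j h j <= M)%MS.
  move=> ch; apply: contraT => nhM.
  have : (\rank M < \rank (M + \row_j h j)%MS)%N.
    by rewrite ltn_neqAle mxrankS ?addsmxSl // andbT; apply: contra nhM => /eqP E;
       apply: submx_trans (addsmxSr M _) _; rewrite -(geq_leqif (mxrank_leqif_sup (addsmxSl M _))) E.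
  rewrite ltnNge rM; case/negP; apply: maxk; apply/asboolP.
  exists (M + \row_j h j)%MS => // i.
  have /sub_addsmxP[[D1 D2] /= E] : (row i (M + \row_j h j)%MS <= M + \row_j h j)%MS by exact: row_sub.
  have E' j : (M + \row_j h j)%MS i j = (D1 *m M) 0 j + D2 0 0 * h j.
    have := congr1 (fun X : 'rV_N => X 0 j) E; rewrite mxE => ->.
    by rewrite mxE; congr (_ + _); rewrite mxE big_ord1 mxE.
  under eq_bigr do rewrite E' rmorphD rmorphM mulrDr mulrCA.
  by rewrite big_split /= -mulr_sumr ch mulr0 addr0 Wlin // submxMl.
pose x := \row_j v j.
have xM : ~~ (x <= M)%MS.
  apply: contra cv => /Wlin; under eq_bigr do rewrite mxE.
  by move=> ->.
have [k0 Hk] : exists k0, (x *m cokermx M) 0 k0 != 0.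
  apply/existsP; rewrite -negb_forall; apply: contra xM => /forallP H.
  by rewrite submxE; apply/eqP/rowP => j; rewrite (eqP (H j)) mxE.
exists (fun i => cokermx M i k0); split.
  by move: Hk; rewrite mxE; under eq_bigr do rewrite mxE mulrC.
move=> h /WM'; rewrite submxE => /eqP /rowP /(_ k0); rewrite !mxE => E.
by rewrite -[RHS]E; apply: eq_bigr => i _; rewrite [(\row_j h j) 0 i]mxE mulrC.
Qed.

End SeparatingFunctional.

Section HermitianPositivity.
Variable R : realType.
Local Notation C := R[i].
Variables (B : comNzRingType) (g : {rmorphism C -> B}).

Lemma sum_conj_eq0 (N : nat) (gam : 'I_N -> C) :
  \sum_i gam i * conjc (gam i) = 0 -> forall i, gam i = 0.
Proof.
move=> E i; have : complex.Re (\sum_i gam i * conjc (gam i)) = 0 by rewrite E.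
rewrite (big_morph _ (@Re_add R) (erefl : complex.Re 0 = 0)).
have RE j : complex.Re (gam j * conjc (gam j)) = cmod (gam j) ^+ 2.
  by rewrite cmod_sqr; case: (gam j) => a b /=; ring.
under eq_bigr do rewrite RE.
move/eqP; rewrite psumr_eq0 => [/allP/(_ i)|j _]; last exact: sqr_ge0.
by rewrite mem_index_enum => /(_ isT); rewrite sqrf_eq0 cmod_eq0 => /eqP.
Qed.

(* c lies in the span of the values F(z); if it is orthogonal to all of them it is zero. *)
Lemma hermitian_nondegenerate (N : nat) (Z : Type) (D : Z -> Prop) (F : Z -> 'I_N -> C) (c : 'I_N -> B) :
  (forall b : 'I_N -> C, (forall z, D z -> \sum_i b i * F z i = 0) -> \sum_i c i * g (b i) = 0) ->
  (forall z, D z -> \sum_i c i * g (conjc (F z i)) = 0) -> forall i, c i = 0.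
Proof.
move=> span orth i; apply: contrapT => /eqP ci0.
have : \sum_j c j * g ((j == i)%:R) != 0.
  rewrite (bigD1 i) //= eqxx rmorph1 mulr1 big1 ?addr0 // => j /negbTE ->.
  by rewrite rmorph0 mulr0.
move=> /separating_functional[gam [gi gW]].
have gF z : D z -> \sum_j conjc (gam j) * F z j = 0.
  move=> /orth/gW E.
  have E' : conjc (\sum_j gam j * conjc (F z j)) = 0 :> C by rewrite E rmorph0.
  rewrite (rmorph_sum (@conjc R)) in E'; rewrite -[RHS]E'.
  by apply: eq_bigr => j _; rewrite rmorphM /= conjcK.
have /gW/sum_conj_eq0 g0 := span _ gF.
by move: gi; rewrite big1 ?eqxx // => j _; rewrite g0 mul0r.
Qed.

End HermitianPositivity.

(** * Algebraicity of phi on coordinate lines *)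

Section MPolyHomomorphisms.

Lemma mpoly_hom_ext (n : nat) (F S : comNzRingType) (g h : {rmorphism {mpoly F[n]} -> S}) :
  (forall c, g c%:MP = h c%:MP) -> (forall i, g (mpolyX F U_(i)%MM) = h (mpolyX F U_(i)%MM)) -> g =1 h.
Proof.
move=> gC gX p; rewrite [p]mpolyE !rmorph_sum; apply: eq_bigr => m _.
rewrite -mul_mpolyC !rmorphM gC /=; congr (_ * _).
rewrite mpolyXE_id !rmorph_prod; apply: eq_bigr => i _.
by rewrite !rmorphXn /= gX.
Qed.

Lemma nonroot_exists (L : idomainType) (F : numFieldType) (g : {rmorphism F -> L}) (q : {poly L}) :
  q != 0 -> exists a : F, q.[g a] != 0.
Proof.
move=> q0; apply: contrapT => /forallNP H.
pose rs := [seq g i%:R | i <- iota 0 (size q)].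
have : (size rs < size q)%N.
  apply: max_poly_roots => //.
    by apply/allP => _ /mapP[i _ ->]; apply/rootP/eqP/negPn/negP; exact: H.
  rewrite map_inj_uniq ?iota_uniq // => i j /fmorph_inj /eqP.
  by rewrite eqr_nat => /eqP.
by rewrite size_map size_iota ltnn.
Qed.

(** Variables are specialised one at a time: [h] has replaced the first k by constants, [th] reads
    the result as a polynomial in the next variable, and some natural number is not a root of it. *)
Lemma mpoly_nonroot (F : numFieldType) (n : nat) (p : {mpoly F[n]}) : p != 0 ->
  exists v : 'I_n -> F, meval v p != 0.
Proof.
move=> p0.
have step k : (k <= n)%N -> exists (v : 'I_n -> F) (h : {rmorphism {mpoly F[n]} -> {mpoly F[n]}}),
    [/\ forall c, h c%:MP = c%:MP,
        forall j : 'I_n, h (mpolyX F U_(j)%MM) = if (j < k)%N then (v j)%:MP else mpolyX F U_(j)%MM &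
        h p != 0].
  elim: k => [|k IHk] kn; first by exists (fun=> 0), idfun.
  have [v [h [hC hX hp]]] := IHk (ltnW kn).
  pose ik := Ordinal kn.
  pose th : {rmorphism {mpoly F[n]} -> {poly {mpoly F[n]}}} :=
    mmap (polyC \o @mpolyC n F) (fun j => if j == ik then 'X else (mpolyX F U_(j)%MM)%:P).
  have thC c : th c%:MP = (c%:MP)%:P by rewrite /= mmapC.
  have thX j : th (mpolyX F U_(j)%MM) = if j == ik then 'X else (mpolyX F U_(j)%MM)%:P.
    by rewrite /= mmapX mmap1U.
  have thp : th (h p) != 0.
    apply: contra_neq hp => E.
    have := @mpoly_hom_ext n F _ (horner_eval (mpolyX F U_(ik)%MM) \o th) idfun _ _ (h p).
    rewrite /= -[X in _ -> _ -> X = _]/(horner_eval _ (th (h p))) E rmorph0 => <- //.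
      by move=> c; rewrite -[LHS]/((th c%:MP).[_]) thC hornerC.
    move=> j; rewrite -[LHS]/((th (mpolyX F U_(j)%MM)).[_]) thX.
    by case: eqP => [->|_]; rewrite ?hornerX ?hornerC.
  have [a qa] := nonroot_exists (@mpolyC n F) thp.
  exists (fun j => if j == ik then a else v j), (horner_eval (a%:MP) \o (th \o h)); split.
  - by move=> c; rewrite -[LHS]/((th (h c%:MP)).[_]) hC thC hornerC.
  - move=> j; rewrite -[LHS]/((th (h (mpolyX F U_(j)%MM))).[_]) hX ltnS.
    rewrite -[j == ik]/((j : nat) == k).
    have [jk|jk|jk] := ltngtP (j : nat) k.
    + by rewrite thC hornerC.
    + by rewrite thX -[j == ik]/((j : nat) == k) gtn_eqF // hornerC.
    by rewrite thX -[j == ik]/((j : nat) == k) jk eqxx hornerX.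
  exact: qa.
have [v [h [hC hX hp]]] := step n (leqnn n).
exists v; apply: contra_neq hp => E.
have -> : h p = (@mpolyC n F \o meval v) p.
  apply: mpoly_hom_ext => [c|j] /=; first by rewrite hC mevalC.
  by rewrite hX ltn_ord mevalXU.
by rewrite /= E mpolyC0.
Qed.

End MPolyHomomorphisms.

(** * Specialising a polynomial relation by a limit *)

Section Perturbation.
Variable R : realType.
Local Notation C := R[i].

Lemma ccontD (f g : C -> C) w : ccont f w -> ccont g w -> ccont (fun x => f x + g x) w.
Proof. by move=> /ccontP cf /ccontP cg; apply/ccontP; exact: (cvgD cf cg). Qed.

Lemma ccont_eq0 (f : C -> C) (d : R) : 0 < d -> ccont f 0 ->
  (forall s, s != 0 -> cmod s < d -> f s = 0) -> f 0 = 0.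
Proof.
move=> d0 cf f0; apply/eqP; rewrite -cmod_eq0; apply/negPn/negP => fn.
have fp : 0 < cmod (f 0) by rewrite lt_def fn cmod_ge0.
have [d1 d10 H] := cf _ (half_pos fp).
have m0 : 0 < Order.min d d1 by rewrite lt_min d0.
have := H (Order.min d d1 / 2)%:C%C; rewrite cmod_real gtr0_norm ?half_pos //.
rewrite add0r f0; last first.
- by rewrite cmod_real gtr0_norm ?half_pos // (lt_le_trans (half_lt m0)) // ge_min lexx.
- by rewrite eq_complex /= eqxx andbT gt_eqF // half_pos.
rewrite sub0r cmodN leNgt half_lt // => H1; suff: false by [].
by apply: H1; rewrite (lt_le_trans (half_lt m0)) // ge_min lexx orbT.
Qed.

Lemma horner_map_affine (L S : comNzRingType) (e : {rmorphism L -> S}) (a b : L) s :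
  (map_poly e (a%:P + b%:P * 'X)).[s] = e a + e b * s.
Proof. by rewrite rmorphD rmorphM /= !map_polyC map_polyX !hornerE. Qed.

(** Nested as [hev (hev e t) s], it puts s for the outer variable, t for the inner one and applies e
    to the coefficients. Being a ring morphism, it can itself be applied coefficientwise. *)
Definition hev (L S : comNzRingType) (e : {rmorphism L -> S}) (s : S) : {rmorphism {poly L} -> S} :=
  horner_eval s \o map_poly e.

Lemma hevE (L S : comNzRingType) (e : {rmorphism L -> S}) s q : hev e s q = (map_poly e q).[s].
Proof. by []. Qed.

Lemma hev0 (L S : comNzRingType) (e : {rmorphism L -> S}) q : hev e 0 q = e (horner_eval 0 q).
Proof. by rewrite hevE /horner_eval -{1}(rmorph0 e) horner_map. Qed.

Lemma ccont_horner (L : idomainType) (e : {rmorphism L -> C}) (Q1 : {poly {poly L}}) (y : C -> C) s :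
  ccont y s -> ccont (fun s => (map_poly (hev e s) Q1).[y s]) s.
Proof.
move=> cy; elim/poly_ind: Q1 => [|q c IHq].
  by under eq_fun => x do rewrite rmorph0 horner0; apply: cdiff_cont (cdiff_cst 0 s).
have -> : (fun s => (map_poly (hev e s) (q * 'X + c%:P)).[y s]) =
    fun s => (map_poly (hev e s) q).[y s] * y s + (map_poly e c).[s].
  by apply/funext => x; rewrite rmorphD rmorphM /= map_polyX map_polyC /= hornerMXaddC.
by apply: ccontD; [exact: ccontM|exact: cdiff_cont (cdiff_horner _ _)].
Qed.

(** At s = 0 the relation P may degenerate to 0 = 0. Dividing out the largest power of s leaves a
    relation that still holds for small s <> 0, and by continuity at s = 0. [Q] is chosen before [e]
    and [y], so one polynomial serves all z and t. *)
Lemma perturbation_limit (L : idomainType) (P : {poly {poly L}}) : P != 0 ->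
  exists Q : {poly L}, Q != 0 /\
  forall (e : {rmorphism L -> C}) (y : C -> C) (d : R), 0 < d -> ccont y 0 ->
    (forall s, cmod s < d -> (map_poly (hev e s) P).[y s] = 0) -> (map_poly e Q).[y 0] = 0.
Proof.
move=> P0; have [k [Q1 [PE Q10]]] := poly2_divX P0.
exists (map_poly (horner_eval 0) Q1); split => // e y d d0 cy Py.
have := @ccont_eq0 (fun s => (map_poly (hev e s) Q1).[y s]) d d0 (ccont_horner _ _ cy).
rewrite -map_poly_comp => H; rewrite -[RHS]H.
  by congr (_.[_]); apply: eq_map_poly => q; rewrite /= -hev0.
move=> s s0 sd; have := Py s sd.
rewrite PE rmorphM /= map_polyC hornerM hornerC.
move=> /eqP; rewrite mulf_eq0 => /orP[|/eqP//].
by rewrite -[_ 'X^k]/(hev e s 'X^k) hevE map_polyXn hornerXn expf_eq0 (negbTE s0) andbF.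
Qed.

Lemma perturbation_algebraic (M : idomainType) (B : comNzRingType)
  (h : {rmorphism B -> {poly {poly M}}}) (P : {poly B}) (e0 : {rmorphism M -> C}) t0 s0 :
  hev (hev e0 t0) s0 (h (lead_coef P)) != 0 ->
  exists Q : {poly {poly M}}, Q != 0 /\
  forall (e : {rmorphism M -> C}) t (y : C -> C) (d : R), 0 < d -> ccont y 0 ->
    (forall s, cmod s < d -> (map_poly (fun b => hev (hev e t) s (h b)) P).[y s] = 0) ->
    (map_poly (hev e t) Q).[y 0] = 0.
Proof.
move=> lP; have Ph : map_poly h P != 0.
  apply: contra_neq lP => E.
  have := congr1 (fun q : {poly {poly {poly M}}} => hev (hev e0 t0) s0 q`_(size P).-1) E.
  by rewrite coef0 rmorph0 coef_map -lead_coefE.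
have [Q [Q0 HQ]] := perturbation_limit Ph.
exists Q; split => // e t y d d0 cy Py; apply: (HQ _ y d d0 cy) => s sd.
rewrite -[RHS](Py s sd) -map_poly_comp; congr (_.[_]).
Qed.

End Perturbation.

Section AlgebraicOnLines.
Variables (R : realType) (n : nat).
Local Notation C := R[i].

Definition upd (z : 'rV[C]_n) (i : 'I_n) (t : C) : 'rV[C]_n :=
  \row_j (if j == i then t else z ord0 j).

(* [M] is the ring of polynomials in z, kept abstract to keep unification on nested polynomial rings tractable. *)
Variables (M : idomainType) (cst : {rmorphism C -> M}) (X : 'I_n -> M)
  (ev : 'rV[C]_n -> {rmorphism M -> C}).
Hypotheses (ev_cst : forall z c, ev z (cst c) = c) (evX : forall z j, ev z (X j) = z ord0 j).

(* The coordinates xi_j (j <> i) move along the segment from xi' (s = 0) to a generic point eta (s = 1). *)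
Definition perturbation (xi eta : 'rV[C]_n) (i : 'I_n) : {rmorphism {mpoly C[n + n]} -> {poly {poly M}}} :=
  mmap (polyC \o (polyC \o cst)) (fun k => match fintype.split k with
    | inl j => (X j)%:P%:P
    | inr j => if j == i then ('X)%:P
               else (cst (xi ord0 j))%:P%:P + (cst (eta ord0 j - xi ord0 j))%:P%:P * 'X
    end).

Lemma hev_perturbation xi eta i z t s p :
  hev (hev (ev z) t) s (perturbation xi eta i p) =
  meval (fun k => (row_mx z (upd (xi + s *: (eta - xi)) i t)) ord0 k) p.
Proof.
rewrite -[LHS]/((hev (hev (ev z) t) s \o perturbation xi eta i) p).
apply: mpoly_hom_ext => [c|k].
  rewrite -[LHS]/(hev (hev (ev z) t) s (mmap _ _ c%:MP)) mmapC -[RHS]/(meval _ c%:MP) mevalC.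
  by rewrite -[LHS]/(hev (hev (ev z) t) s (cst c)%:P%:P) hevE map_polyC hornerC [LHS]hevE map_polyC hornerC [LHS]ev_cst.
rewrite -[LHS]/(hev (hev (ev z) t) s (mmap _ _ (mpolyX C U_(k)%MM))) mmapX mmap1U.
rewrite -[RHS]/(meval _ (mpolyX C U_(k)%MM)) mevalXU hevE.
case: splitP => j kj.
  have -> : k = lshift n j by apply: val_inj.
  by rewrite row_mxEl map_polyC hornerC [LHS]hevE map_polyC hornerC [LHS]evX.
have -> : k = rshift n j by apply: val_inj.
rewrite row_mxEr mxE; case: eqP => _; first by rewrite map_polyC hornerC [LHS]hevE map_polyX hornerX.
have hc c : hev (ev z) t (cst c)%:P = c by rewrite hevE map_polyC hornerC; exact: ev_cst.
by rewrite horner_map_affine !hc !mxE [X in _ + X]mulrC.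
Qed.

Lemma line_algebraic (D : set 'rV[C]_n) (T : set C) (P : {poly {mpoly C[n + n]}})
  (phi : 'rV[C]_n -> 'rV[C]_n -> C) xi i : P != 0 ->
  (forall z w, D z -> D w ->
    (map_poly (meval (fun k => (row_mx z w) ord0 k)) P).[phi z w] = 0) ->
  (forall t d, T t -> exists2 e : R, 0 < e & forall s, cmod s < e -> D (upd (xi + s *: d) i t)) ->
  (forall z t d, D z -> T t -> ccont (fun s => phi z (upd (xi + s *: d) i t)) 0) ->
  exists Q : {poly {poly M}}, Q != 0 /\
    forall z t, D z -> T t -> (map_poly (hev (ev z) t) Q).[phi z (upd xi i t)] = 0.
Proof.
move=> P0 Pphi Dopen cphi.
have lP : lead_coef P != 0 by rewrite lead_coef_eq0.
have [v vP] := mpoly_nonroot lP.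
(* A point where the leading coefficient of P does not vanish, split into its z and xi halves. At s
   = 1 and t = eta_i the moved line passes through it, so P stays nonzero under [perturbation]. *)
pose z0 : 'rV[C]_n := \row_j v (lshift n j); pose eta : 'rV[C]_n := \row_j v (rshift n j).
have [|Q [Q0 HQ]] := perturbation_algebraic (h := perturbation xi eta i) (P := P) (e0 := ev z0) (t0 := eta ord0 i) (s0 := 1) _.
  rewrite [X in X != 0]hev_perturbation scale1r subrKC.
  suff -> : (fun k => row_mx z0 (upd eta i (eta ord0 i)) ord0 k) = v by [].
  apply/funext => k.
  case: (splitP k) => j kj.
    have -> : k = lshift n j by apply: val_inj.
    by rewrite row_mxEl mxE.
  have -> : k = rshift n j by apply: val_inj.
  by rewrite row_mxEr !mxE; case: eqP => [->|].
exists Q; split; first exact: Q0.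
move=> z t Dz Tt.
have [d d0 Hd] := Dopen t (eta - xi) Tt.
have cy := cphi z t (eta - xi) Dz Tt.
have := HQ (ev z) t _ d d0 cy; rewrite scale0r addr0; apply => s sd.
rewrite -[RHS](Pphi z (upd (xi + s *: (eta - xi)) i t) Dz (Hd s sd)).
by congr (_.[_]); apply: eq_map_poly => p; rewrite [LHS]hev_perturbation.
Qed.

End AlgebraicOnLines.

(** * Reduction modulo the valuation ideal *)

Section Place.
Variables (F K : fieldType) (iota : {rmorphism F -> K}).

(** [S] is the valuation ring as a subset of [K], [A] the same ring as a type with inclusion [i],
    and [h] the reduction. Its kernel, the non-units, reads as: zero, or with inverse outside
    [S]. *)
Lemma place_exists (x : K) :
  (forall p : {poly F}, p != 0 -> (map_poly iota p).[x] != 0) ->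
  exists (S : set K) (A : comNzRingType) (i : {rmorphism A -> K}) (kappa : idomainType)
    (h : {rmorphism A -> kappa}),
  [/\ is_subring S /\ ~ S x, forall w, S w \/ S w^-1, forall a, algebraicOver iota a -> S a,
      injective i /\ (forall w, S w <-> exists a, i a = w) &
      forall a, h a = 0 <-> i a = 0 \/ ~ S (i a)^-1].
Proof.
move=> /valuation_ring_exists[S [Ssub Siota Sx Sval]].
have [S1 SB SM] := Ssub.
have [A [i [i_inj iS]]] := subring_exists S1 SB SM.
have Si a : S (i a) by apply/iS; exists a.
have [|||||kappa [h hE]] := @quotient_domain A (fun a => i a = 0 \/ ~ S (i a)^-1).
- by left; rewrite rmorph0.
- move=> a b Ia Ib; apply: contrapT => /not_orP[/eqP]; rewrite rmorphB => ab0 /contrapT Sab.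
  case: (eqVneq (i a) 0) => [a0|a0].
    move: ab0 Sab; rewrite a0 sub0r oppr_eq0 invrN => b0 Sb.
    case: Ib => [/eqP|]; [by rewrite (negbTE b0)|apply].
    by rewrite -[_^-1]opprK; exact: subringN.
  case: (eqVneq (i b) 0) => [b0|b0].
    by move: Sab; rewrite b0 subr0 => Sa; case: Ia => [/eqP|]; [rewrite (negbTE a0)|apply].
  case: Ia => [/eqP|Sa']; first by rewrite (negbTE a0).
  case: Ib => [/eqP|Sb']; first by rewrite (negbTE b0).
  (* Stability of the non-units under subtraction is where the valuation property enters: if a/b is
     in S and a - b is a unit, then b^-1 = (a - b)^-1 (a/b - 1) is in S; symmetrically for a^-1. *)
  case: (Sval (i a / i b)) => Sq.
    apply: Sb'; have -> : (i b)^-1 = (i a - i b)^-1 * (i a / i b - 1).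
      by rewrite -{1}[1](divff b0) -mulrBl mulrA mulVf // mul1r.
    by apply: SM => //; exact: SB.
  apply: Sa'; have -> : (i a)^-1 = (i a - i b)^-1 * (1 - (i a / i b)^-1).
    by rewrite invf_div -{1}[1](divff a0) -mulrBl mulrA mulVf // mul1r.
  by apply: SM => //; exact: SB.
- by rewrite rmorph1 invr1 => -[/eqP|/(_ S1)//]; rewrite oner_eq0.
- move=> a b [b0|Sb]; first by left; rewrite rmorphM b0 mulr0.
  rewrite rmorphM; case: (eqVneq (i a) 0) => [->|a0]; first by left; rewrite mul0r.
  right => Sab; apply: Sb; have -> : (i b)^-1 = i a * (i a * i b)^-1 by rewrite invfM mulrA divff // mul1r.
  exact: SM.
- move=> a b; rewrite rmorphM => Iab; apply: contrapT => /not_orP[/not_orP[/eqP a0 /contrapT Sa]].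
  move=> /not_orP[/eqP b0 /contrapT Sb]; case: Iab => [/eqP|]; first by rewrite mulf_eq0 (negbTE a0) (negbTE b0).
  by rewrite invfM; apply; exact: SM.
by exists S, A, i, kappa, h; split => // a; exact: valuation_ring_algebraic.
Qed.

(** An element of least valuation, found by comparing two at a time. Putting 1 in the list
    guarantees that it is nonzero. *)
Lemma dominant_element (S : set K) (ws : seq K) : is_subring S -> (forall w, S w \/ S w^-1) ->
  exists f, [/\ f \in 1 :: ws, f != 0 & forall w, w \in 1 :: ws -> S (w / f)].
Proof.
move=> Ssub Sval; have [S1 _ SM] := Ssub; have S0 := subring0 Ssub.
elim: ws => [|w ws [f [fws f0 Hf]]].
  by exists 1; rewrite mem_seq1 eqxx oner_neq0; split => // w; rewrite mem_seq1 => /eqP ->; rewrite divr1.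
have sub : {subset 1 :: ws <= [:: 1, w & ws]}.
  by move=> y; rewrite !inE => /orP[->//|->]; rewrite !orbT.
case: (Sval (w / f)) => Swf.
  exists f; split => // [|y]; first exact: sub.
  rewrite !inE => /or3P[/eqP->|/eqP->//|yws]; apply: Hf; rewrite inE ?eqxx ?yws ?orbT //.
case: (eqVneq w 0) => [w0|w0].
  exists f; split => // [|y]; first exact: sub.
  rewrite !inE => /or3P[/eqP->|/eqP->|yws]; rewrite ?w0 ?mul0r //; apply: Hf; rewrite inE ?eqxx ?yws ?orbT //.
exists w; split => //; first by rewrite !inE eqxx orbT.
move: Swf; rewrite invf_div => Swf.
have scale y : y \in 1 :: ws -> S (y / w).
  move=> /Hf Sy; have -> : y / w = y / f * (f / w) by rewrite mulrA divfK.
  exact: SM.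
move=> y; rewrite !inE => /or3P[y1|/eqP->|yws]; last 1 first.
- by apply: scale; rewrite inE yws orbT.
- by apply: scale; rewrite inE y1.
by rewrite divff.
Qed.

End Place.

(** * Taylor coefficients of functions on a disc *)

Section DiscFunctions.
Variables (R : realType) (rho : R).
Hypothesis rho0 : 0 < rho.
Local Notation C := R[i].
Implicit Types (f g : C -> C).

(* Differentiable on |w| < 3 rho; the Taylor coefficients [tc] are integrals over the square of half-diagonal 2 rho,
   and the expansion holds on |w| < rho. *)
Definition hol f := forall w, cmod w < 3 * rho -> exists L, cdiff f w L.
Definition tc f n := tcoef f (2 * rho) n.

Let s0 : 0 < 2 * rho. Proof. by rewrite mulr_gt0. Qed.
Let sr : 2 * rho < 3 * rho. Proof. by rewrite ltr_pM2r // ltr_nat. Qed.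
Let half : 2 * rho / 2 = rho. Proof. by rewrite mulrC mulKf // pnatr_eq0. Qed.

Lemma hol_zero f : hol f -> (forall n, tc f n = 0) -> forall a, cmod a < rho -> f a = 0.
Proof. by move=> Hf f0 a ar; apply: (taylor_zero s0 sr Hf f0); rewrite half. Qed.

Lemma jet_bound N f p : (exists B : R, forall a, a != 0 -> cmod a < rho ->
  cmod (f a - p.[a]) <= B * cmod a ^+ N) -> jet N f p.
Proof.
move=> [B HB]; exists `|B|, rho; split; rewrite ?normr_ge0 // => t t0 tr.
apply: le_trans (HB t t0 tr) _; apply: ler_wpM2r; last exact: ler_norm.
by rewrite exprn_ge0 ?cmod_ge0.
Qed.

Lemma hol_jet N f : hol f -> jet N f (\poly_(n < N) tc f n).
Proof.
move=> Hf; apply: jet_bound; have [B HB] := taylor_jet s0 sr Hf N.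
by exists B => a _ ar; apply: HB; rewrite half.
Qed.

Lemma hol_jet_deriv N f f' : hol f -> (forall t, cmod t < rho -> cdiff f t (f' t)) ->
  jet N f' (\poly_(n < N.+1) tc f n)^`().
Proof.
move=> Hf Hf'; apply: jet_bound; have [B HB] := taylor_jet_deriv s0 sr Hf N.+1.
by exists B => a a0 ar; apply: HB; rewrite ?half //; exact: Hf'.
Qed.

Lemma tc0 f : hol f -> tc f 0 = f 0.
Proof.
move=> Hf; have [B HB] := taylor_jet s0 sr Hf 1.
have := HB 0; rewrite cmod0 half expr1 mulr0 => /(_ rho0) H.
have /eqP : cmod (f 0 - (\poly_(n < 1) tcoef f (2 * rho) n).[0]) = 0 by apply/eqP; rewrite eq_le H cmod_ge0.
by rewrite cmod_eq0 subr_eq0 => /eqP ->; rewrite horner_coef0 coef_poly.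
Qed.

(** Any expansion determines the Taylor coefficients, so their linearity is read off from jets
    rather than from integrals. *)
Lemma tc_jet N f p : hol f -> jet N f p -> forall j, (j < N)%N -> tc f j = p`_j.
Proof.
move=> Hf Hp j jN; have Hj := jetB (hol_jet N Hf) Hp.
have := @jet_zero R N (fun t => f t - f t) _ _ Hj j jN; rewrite coefB coef_poly jN.
by move=> H; apply/eqP; rewrite -subr_eq0; apply/eqP/H; exists 1 => // t _ _; rewrite subrr.
Qed.

Lemma hol_lincomb (I : finType) (c : I -> C) (f : I -> C -> C) :
  (forall i, hol (f i)) -> hol (fun t => \sum_i c i * f i t).
Proof.
move=> Hf w wr; have /choice[L HL] : forall i, exists L, cdiff (f i) w L by move=> i; exact: Hf.
by exists (\sum_i c i * L i); apply: cdiff_sum => i _; exact: cdiffZ.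
Qed.

Lemma tc_lincomb (I : finType) (c : I -> C) (f : I -> C -> C) n :
  (forall i, hol (f i)) -> tc (fun t => \sum_i c i * f i t) n = \sum_i c i * tc (f i) n.
Proof.
move=> Hf; have H : jet n.+1 (fun t => \sum_i c i * f i t) (\sum_i c i *: \poly_(k < n.+1) tc (f i) k).
  by apply: jet_sum => i _; apply/jetZ/hol_jet.
rewrite (tc_jet (hol_lincomb c Hf) H (ltnSn n)) coef_sum.
by apply: eq_bigr => i _; rewrite coefZ coef_poly ltnSn.
Qed.

(** The point t0 shows that some Taylor coefficient is nonzero. The first such one, of index k,
    dominates the O(t^(k+1)) remainder near 0. *)
Lemma hol_punctured f t0 : hol f -> cmod t0 < rho -> f t0 != 0 ->
  exists2 d : R, 0 < d & forall t, t != 0 -> cmod t < d -> f t != 0.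
Proof.
move=> Hf t0r ft0.
have ex : exists n, tc f n != 0.
  apply: contrapT => /forallNP H; move/eqP: ft0; apply; apply: (hol_zero Hf) => // n.
  by apply/eqP/negPn/negP; exact: H.
case: (ex_minnP ex) => k ck mink.
have [B [d [B0 d0 HB]]] := hol_jet k.+1 Hf.
have B1 : 0 < B + 1 by rewrite ltr_wpDl.
have c0 : 0 < cmod (tc f k) by rewrite cmod_gt0.
exists (Order.min d (cmod (tc f k) / (B + 1))); first by rewrite lt_min d0 divr_gt0.
move=> t tn0; rewrite lt_min => /andP[td tc1]; apply/eqP => ft.
have := HB t tn0 td; rewrite ft sub0r cmodN.
have -> : \poly_(n < k.+1) tc f n = tc f k *: 'X^k.
  apply/polyP => j; rewrite coef_poly coefZ coefXn ltnS.
  have [jk|jk|->] := ltngtP j k; rewrite ?mulr0 ?mulr1 //.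
  by apply/eqP; apply: contraLR jk; rewrite -leqNgt; exact: mink.
rewrite hornerZ hornerXn cmodM cmodX exprS mulrA ler_pM2r ?exprn_gt0 ?cmod_gt0 //.
rewrite leNgt => /negP; apply.
move: tc1; rewrite ltr_pdivlMr // mulrC; apply: le_lt_trans.
by rewrite ler_wpM2r ?cmod_ge0 // lerDl.
Qed.

Lemma jet_double_horner (M : comNzRingType) (e : {rmorphism M -> C}) N (Q : {poly {poly M}}) f p :
  jet N f p -> jet N (fun t => (map_poly (hev e t) Q).[f t]) (map_poly (map_poly e) Q).[p].
Proof.
move=> Hf; elim/poly_ind: Q => [|Q c IHQ].
  rewrite rmorph0 horner0; apply: jet_ext (jet_cst N 0); exists 1 => // t _ _.
  by rewrite rmorph0 horner0.
rewrite rmorphD rmorphM /= map_polyX map_polyC /= hornerMXaddC.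
apply: jet_ext (jetD (jetM IHQ Hf) (jet_poly N (map_poly e c))); exists 1 => // t _ _.
by rewrite rmorphD rmorphM /= map_polyX map_polyC /= hornerMXaddC.
Qed.

End DiscFunctions.

Definition polydisc (R : realType) (n : nat) (rho : R) : set 'rV[R[i]]_n :=
  [set z | forall j, cmod (z ord0 j) < rho].

Section Polydisc.
Variables (R : realType) (n : nat) (rho : R).
Local Notation C := R[i].
Implicit Types (z xi : 'rV[C]_n).

Lemma upd_id xi i : upd xi i (xi ord0 i) = xi.
Proof. by apply/rowP => j; rewrite mxE; case: eqP => [->|]. Qed.

Lemma polydisc_upd xi i t : polydisc rho xi -> cmod t < rho -> polydisc rho (upd xi i t).
Proof. by move=> Dxi tr j; rewrite mxE; case: eqP. Qed.

Lemma common_radius (T : finType) (d : T -> R) : 0 < rho -> (forall s, 0 < d s) ->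
  exists delta : R, [/\ 0 < delta, delta <= rho & forall s, delta <= d s].
Proof.
move=> rho0 d0; have : exists delta : R, [/\ 0 < delta, delta <= rho & forall s, s \in enum T -> delta <= d s].
  elim: (enum T) => [|s ss [delta [p1 p2 p3]]]; first by exists rho.
  exists (Order.min delta (d s)); split; rewrite ?lt_min ?p1 ?d0 //; first by rewrite ge_min p2.
  by move=> s'; rewrite inE => /orP[/eqP->|/p3 H]; rewrite ge_min ?lexx ?orbT ?H.
by move=> [delta [p1 p2 p3]]; exists delta; split => // s; apply: p3; rewrite mem_enum.
Qed.

End Polydisc.

(** * Non-vanishing of the reduced functions, down to the origin *)

Section Descent.
Variables (R : realType) (n : nat) (T : finType) (rho : R).
Local Notation C := R[i].
Local Notation V := 'rV[C]_n.
Variables (d : T -> nat) (Eb : forall s, V -> 'I_(d s) -> C).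
Hypothesis rho0 : 0 < rho.
Hypothesis holEb : forall s xi i j, polydisc rho xi -> hol rho (fun t => Eb (upd xi i t) (j : 'I_(d s))).
Variables (kappa : idomainType) (gam : {rmorphism C -> kappa}) (c : forall s, 'I_(d s) -> kappa).

(* [c] holds residues of the components of a map, so [resval] is the reduction of 1 + H(z).Hbar(xi)
   and [restc] its Taylor coefficients in xi_i. *)
Definition resval s xi := \sum_j c j * gam (@Eb s xi j).

Definition restc s xi i m := \sum_j c j * gam (tc rho (fun t => @Eb s (upd xi i t) j) m).

Lemma resval_punctured s xi i : polydisc rho xi -> resval s xi != 0 ->
  exists2 delta : R, 0 < delta & forall t, t != 0 -> cmod t < delta -> resval s (upd xi i t) != 0.
Proof.
move=> Dxi /separating_functional[a [a0 Ha]].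
have := @hol_punctured R rho rho0 (fun t => \sum_j a j * @Eb s (upd xi i t) j) (xi ord0 i).
case=> [|||delta delta0 Hd]; [|exact: Dxi|by rewrite upd_id|].
  by apply: hol_lincomb => j; exact: holEb.
by exists delta => // t t0 td; apply: contra_neq (Hd t t0 td); exact: Ha.
Qed.

Lemma restc_neq0 s xi i : polydisc rho xi -> resval s xi != 0 -> exists m, restc s xi i m != 0.
Proof.
move=> Dxi /separating_functional[a [/eqP a0 Ha]]; apply: contrapT => /forallNP H; apply: a0.
have Hh j : hol rho (fun t => @Eb s (upd xi i t) j) by exact: holEb.
have := @hol_zero R rho rho0 (fun t => \sum_j a j * @Eb s (upd xi i t) j) (hol_lincomb a Hh) _ (xi ord0 i).
rewrite upd_id; apply => // m; rewrite tc_lincomb //; apply: Ha.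
by apply/eqP/negPn/negP; exact: H.
Qed.

Lemma restc0 s xi i : polydisc rho xi -> restc s xi i 0 = resval s (upd xi i 0).
Proof. by move=> Dxi; apply: eq_bigr => j _; rewrite tc0 //; exact: holEb. Qed.

(** Each s keeps its own non-zero, and coordinates are made common one by one: near 0 in the k-th
    coordinate each function is nonzero off 0, so a single small t suits all s. The vector [a]
    collects the coordinates already fixed. *)
Lemma resval_common : (forall s, exists2 xi, polydisc rho xi & resval s xi != 0) ->
  exists2 xi, polydisc rho xi & forall s, resval s xi != 0.
Proof.
move=> H0.
have step k : (k <= n)%N -> exists2 a, polydisc rho a & forall s, exists xi,
    [/\ polydisc rho xi, forall j : 'I_n, (j < k)%N -> xi ord0 j = a ord0 j & resval s xi != 0].
  elim: k => [_|k IHk kn].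
    exists 0 => [j|s]; first by rewrite mxE cmod0.
    by have [xi Dxi xi0] := H0 s; exists xi.
  have [a Da /choice[F HF]] := IHk (ltnW kn).
  pose ik := Ordinal kn.
  have /choice[dl Hdl] : forall s, exists dl : R, 0 < dl /\
      forall t, t != 0 -> cmod t < dl -> resval s (upd (F s) ik t) != 0.
    by move=> s; have [DF _ /(resval_punctured ik DF)[dl ? ?]] := HF s; exists dl.
  have [delta [p1 p2 p3]] := common_radius (d := dl) rho0 (fun s => proj1 (Hdl s)).
  pose t : C := (delta / 2)%:C%C.
  have td : cmod t < delta by rewrite cmod_real gtr0_norm ?half_pos // half_lt.
  have tr : cmod t < rho by exact: lt_le_trans td p2.
  have t0 : t != 0 by rewrite eq_complex /= eqxx andbT gt_eqF // half_pos.
  exists (upd a ik t); first exact: polydisc_upd.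
  move=> s; have [DF Fa _] := HF s; exists (upd (F s) ik t); split.
  - exact: polydisc_upd.
  - move=> j; rewrite ltnS leq_eqVlt => jk; rewrite !mxE -[j == ik]/((j : nat) == k).
    by case: eqVneq jk => //= _; exact: Fa.
  by have [_ H] := Hdl s; apply: H => //; exact: lt_le_trans td (p3 s).
have [a Da Ha] := step n (leqnn n); exists a => // s.
have [xi [_ xia]] := Ha s; have -> // : xi = a.
by apply/rowP => j; apply: xia.
Qed.

Variable e : T -> R.
Hypothesis nonresonant : forall k : T -> nat, \sum_s e s *+ k s = 0 -> forall s, k s = 0%N.
Hypothesis order_relation : forall xi i (k : T -> nat), polydisc rho xi ->
  (forall s, restc s xi i (k s) != 0) -> (forall s j, (j < k s)%N -> restc s xi i j = 0) ->
  \sum_s e s *+ k s = 0.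

Lemma resval_descent xi i : polydisc rho xi -> (forall s, resval s xi != 0) ->
  forall s, resval s (upd xi i 0) != 0.
Proof.
move=> Dxi uxi.
have /choice[k Hk] : forall s, exists k, restc s xi i k != 0 /\ forall j, (j < k)%N -> restc s xi i j = 0.
  move=> s; case: (ex_minnP (restc_neq0 i Dxi (uxi s))) => k Hk mink; exists k; split => // j jk.
  by apply/eqP; apply: contraLR jk; rewrite -leqNgt; exact: mink.
have k0 := nonresonant (order_relation (i := i) (k := k) Dxi (fun s => proj1 (Hk s)) (fun s => proj2 (Hk s))).
by move=> s; have [] := Hk s; rewrite k0 restc0.
Qed.

Lemma resval_origin : (forall s, exists2 xi, polydisc rho xi & resval s xi != 0) ->
  forall s, resval s 0 != 0.
Proof.
move=> /resval_common[xi0 Dxi0 uxi0].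
have step k : (k <= n)%N -> exists xi, [/\ polydisc rho xi, forall s, resval s xi != 0 &
    forall j : 'I_n, (j < k)%N -> xi ord0 j = 0].
  elim: k => [_|k IHk kn]; first by exists xi0.
  have [xi [Dxi uxi xik]] := IHk (ltnW kn); pose ik := Ordinal kn.
  exists (upd xi ik 0); split; first by apply: polydisc_upd => //; rewrite cmod0.
    exact: resval_descent.
  move=> j; rewrite ltnS leq_eqVlt => jk; rewrite mxE -[j == ik]/((j : nat) == k).
  by case: eqVneq jk => //= _; exact: xik.
have [xi [_ uxi xi00]] := step n (leqnn n).
by have -> : 0 = xi by apply/rowP => j; rewrite mxE xi00.
Qed.

End Descent.

Section GermMorphisms.
Variables (R : realType) (n : nat).
Local Notation C := R[i].

(** Evaluation at z turns an identity over germs into a numerical identity at z. As functions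
    vanishing on the polydisc have class 0 in [K], relations in [K] reduce to pointwise ones. *)
Lemma germ_eval_exists (z : 'rV[C]_n) : exists g : {rmorphism germ R n -> C}, forall f, g f = f z.
Proof.
pose h (f : germ R n) : C := f z.
have hB : zmod_morphism h by [].
have hM : monoid_morphism h by [].
pose hA := GRing.isZmodMorphism.Build _ _ h hB.
pose hR := GRing.isMonoidMorphism.Build _ _ h hM.
pose H : {rmorphism germ R n -> C} := HB.pack h hA hR.
by exists H.
Qed.

Lemma germ_const_exists : exists g : {rmorphism C -> germ R n}, forall c, g c = fun=> c.
Proof.
pose h (c : C) : germ R n := fun=> c.
have hB : zmod_morphism h by [].
have hM : monoid_morphism h by [].
pose hA := GRing.isZmodMorphism.Build _ _ h hB.
pose hR := GRing.isMonoidMorphism.Build _ _ h hM.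
pose H : {rmorphism C -> germ R n} := HB.pack h hA hR.
by exists H.
Qed.

Lemma germ_poly_exists (M : comNzRingType) (ev : 'rV[C]_n -> {rmorphism M -> C}) :
  exists g : {rmorphism M -> germ R n}, forall p, g p = fun z => ev z p.
Proof.
pose h (p : M) : germ R n := fun z => ev z p.
have hB : zmod_morphism h by move=> p q; apply/funext => z; rewrite /h rmorphB.
have hM : monoid_morphism h by split => [|p q]; apply/funext => z; rewrite /h ?rmorph1 ?rmorphM.
pose hA := GRing.isZmodMorphism.Build _ _ h hB.
pose hR := GRing.isMonoidMorphism.Build _ _ h hM.
pose H : {rmorphism M -> germ R n} := HB.pack h hA hR.
by exists H.
Qed.

End GermMorphisms.

(** * The linear relation between vanishing orders *)

Section OrderRelation.
Variables (R : realType) (n : nat) (T : finType) (rho : R).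
Local Notation C := R[i].
Local Notation V := 'rV[C]_n.
Local Notation D := (@polydisc R n rho).
Variables (e : T -> R) (d : T -> nat) (E Eb : forall s, V -> 'I_(d s) -> C) (phi : V -> V -> C).
Definition bilin s z xi := \sum_j @E s z j * @Eb s xi j.
Hypothesis rho0 : 0 < rho.
Hypothesis holEb : forall s xi i j, D xi -> hol rho (fun t => @Eb s (upd xi i t) j).
Hypothesis holphi : forall z xi i, D z -> D xi -> hol rho (fun t => phi z (upd xi i t)).
Hypothesis bilin_neq0 : forall s z xi, D z -> D xi -> bilin s z xi != 0.
Hypothesis phiE : forall z xi, D z -> D xi -> phi z xi = \prod_s cpow (bilin s z xi) (e s).

Lemma hol_bilin s z xi i : D xi -> hol rho (fun t => bilin s z (upd xi i t)).
Proof. by move=> Dxi; apply: hol_lincomb => j; exact: holEb. Qed.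

Lemma hol_derivative (f : C -> C) : hol rho f -> exists f' : C -> C, forall t, cmod t < rho -> cdiff f t (f' t).
Proof.
move=> Hf; have /choice[f' Hf'] : forall t, exists L, cmod t < rho -> cdiff f t L.
  move=> t; case: (ltP (cmod t) rho) => tr; last by exists 0.
  have [|L HL] := Hf t; last by exists L.
  by apply: lt_trans tr _; rewrite ltr_pMl // ltr1n.
by exists f'.
Qed.

(** The Taylor polynomials keep L + 1 coefficients because differentiation costs one order. On the
    disc of radius rho - |t| around t the functional equation still holds, as [log_derivative]
    requires. *)
Lemma Lam_line z xi i L j : D z -> D xi -> (j < L)%N ->
  (Lam (fun s => \poly_(m < L.+1) tc rho (fun t => bilin s z (upd xi i t)) m)
       (\poly_(m < L.+1) tc rho (fun t => phi z (upd xi i t)) m)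
       (fun s => (e s)%:C%C))`_j = 0.
Proof.
move=> Dz Dxi jL.
have hu s := hol_bilin s z i Dxi.
have hy := holphi i Dz Dxi.
have /choice[u' Hu'] : forall s, exists f' : C -> C, forall t, cmod t < rho ->
    cdiff (fun t => bilin s z (upd xi i t)) t (f' t).
  by move=> s; exact: hol_derivative.
have [y' Hy'] := hol_derivative hy.
apply: (Lam_jet (M := L) (u := fun s t => bilin s z (upd xi i t)) (u' := u')
  (y := fun t => phi z (upd xi i t)) (y' := y')) jL.
- by move=> s; apply: jet_weak (leqnSn L) _; exact: hol_jet.
- by move=> s; exact: (hol_jet_deriv rho0 L (hu s) (Hu' s)).
- by apply: jet_weak (leqnSn L) _; exact: hol_jet.
- exact: (hol_jet_deriv rho0 L hy Hy').
exists rho => // t _ tr.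
apply: (log_derivative (u := fun s t => bilin s z (upd xi i t)) (u' := fun s => u' s t)
  (y := fun t => phi z (upd xi i t)) (a := e) (r := rho - cmod t)); rewrite ?subr_gt0 //.
- move=> h hr; have Dth : D (upd xi i (t + h)).
    by apply: polydisc_upd => //; apply: le_lt_trans (cmodD _ _) _; rewrite -ltrBrDl.
  by split; [move=> s; exact: bilin_neq0|exact: phiE].
- by move=> s; exact: Hu'.
- exact: Hy'.
Qed.

Variables (M : idomainType) (ev : V -> {rmorphism M -> C}).
Hypothesis phi_alg : forall xi i, D xi -> exists Q : {poly {poly M}}, Q != 0 /\
  forall z t, D z -> cmod t < rho -> (map_poly (hev (ev z) t) Q).[phi z (upd xi i t)] = 0.
Variables (K : fieldType) (cl : {rmorphism germ R n -> K}) (iota : {rmorphism {fraction M} -> K}).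
Hypothesis clD : forall g : V -> C, (forall z, D z -> g z = 0) -> cl g = 0.
Hypothesis iotaE : forall p, iota (tofrac p) = cl (fun z => ev z p).

(** For each z the relation Q holds between t and the Taylor polynomial of phi up to order N.
    Coefficient by coefficient this passes to classes in [K], where [algebraic_series] applies. *)
Lemma tc_phi_algebraic xi i m : D xi ->
  cl (fun z => tc rho (fun t => phi z (upd xi i t)) m) \in algpred iota.
Proof.
move=> Dxi; have [Q [Q0 HQ]] := phi_alg i Dxi.
have [Eg EgE] := germ_poly_exists ev.
pose g : {rmorphism M -> K} := iota \o @tofrac M.
have gE p : g p = cl (Eg p) by rewrite EgE -iotaE.
have g_inj : injective g by apply: raddf_inj => a /eqP; rewrite /= fmorph_eq0 tofrac_eq0 => /eqP.
have QE : map_poly (map_poly g) Q = map_poly (map_poly cl) (map_poly (map_poly Eg) Q).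
  rewrite -map_poly_comp; apply: eq_map_poly => p /=; rewrite -map_poly_comp.
  by apply: eq_map_poly => a; rewrite gE.
apply: (@algebraic_series _ _ iota m (map_poly (map_poly g) Q) (fun m => cl (fun z => tc rho (fun t => phi z (upd xi i t)) m))).
- have gp (q : {poly M}) : q != 0 -> map_poly g q != 0.
    by move=> q0; rewrite map_poly_eq0_id0 // raddf_eq0 // lead_coef_eq0.
  by rewrite map_poly_eq0_id0 // gp // lead_coef_eq0.
- apply/polyOverP => a; rewrite coef_map /=; apply/polyOverP => b; rewrite coef_map /=.
  by apply/asboolP; exact: algebraic_id.
move=> N j jN.
pose Yg : {poly germ R n} := \poly_(k < N) ((fun z => tc rho (fun t => phi z (upd xi i t)) k) : germ R n).
have -> : \poly_(k < N) cl (fun z => tc rho (fun t => phi z (upd xi i t)) k) = map_poly cl Yg.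
  by apply/polyP => k; rewrite coef_map !coef_poly; case: ifP => // _; exact/esym/(rmorph0 cl).
rewrite QE horner_map coef_map; apply: clD => z Dz.
have [evz evzE] := germ_eval_exists z.
rewrite -evzE -coef_map -horner_map -[X in _.[X]]/(map_poly evz Yg).
have -> : map_poly (map_poly evz) (map_poly (map_poly Eg) Q) = map_poly (map_poly (ev z)) Q.
  rewrite -map_poly_comp; apply: eq_map_poly => p /=; rewrite -map_poly_comp.
  by apply: eq_map_poly => a /=; rewrite evzE EgE.
have -> : map_poly evz Yg = \poly_(k < N) tc rho (fun t => phi z (upd xi i t)) k.
  by apply/polyP => k; rewrite coef_map !coef_poly; case: ifP => _; [exact: evzE|exact: (rmorph0 evz)].
have H := jet_double_horner (ev z) Q (hol_jet rho0 N (holphi i Dz Dxi)).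
by apply: (jet_zero _ H jN); exists rho => // t _ tr; exact: HQ.
Qed.

Variables (S : set K) (A : comNzRingType) (ia : {rmorphism A -> K}) (kappa : idomainType)
  (h : {rmorphism A -> kappa}).
Hypothesis S_alg : forall a, algebraicOver iota a -> S a.
Hypothesis ia_inj : injective ia.
Hypothesis iaS : forall w, S w -> exists a, ia a = w.
Hypothesis hE : forall a, h a = 0 <-> ia a = 0 \/ ~ S (ia a)^-1.
Variables (kC : {rmorphism C -> A}).
Hypothesis kCE : forall c, ia (kC c) = cl (fun=> c).
Variables (f : T -> K) (c : forall s, 'I_(d s) -> A).
Hypothesis cE : forall s j, ia (@c s j) = cl (fun z => @E s z j) / f s.

Lemma place_order_relation xi i (k : T -> nat) : D xi ->
  (forall s, restc rho Eb (h \o kC) (fun s j => h (@c s j)) s xi i (k s) != 0) ->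
  (forall s j, (j < k s)%N -> restc rho Eb (h \o kC) (fun s j => h (@c s j)) s xi i j = 0) ->
  \sum_s e s *+ k s = 0.
Proof.
move=> Dxi Hk Hj; pose L := (\sum_s k s).+1.
have kL s : (k s < L.+1)%N by rewrite ltnS ltnW // ltnS (bigD1 s) //= leq_addr.
have /choice[yA yAE] : forall m, exists a, ia a = cl (fun z => tc rho (fun t => phi z (upd xi i t)) m).
  by move=> m; apply/iaS/S_alg/asboolP; exact: tc_phi_algebraic.
(* The scaled Taylor polynomials, with coefficients in the valuation ring: in [K] they become (f
   s)^-1 times the class of those of [bilin], and under [h] their coefficients become [restc]. *)
pose UA s : {poly A} := \poly_(m < L.+1) \sum_j @c s j * kC (tc rho (fun t => @Eb s (upd xi i t) j) m).
pose YA : {poly A} := \poly_(m < L.+1) yA m.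
pose Ug s : {poly germ R n} := \poly_(m < L.+1) ((fun z => tc rho (fun t => bilin s z (upd xi i t)) m) : germ R n).
pose Yg : {poly germ R n} := \poly_(m < L.+1) ((fun z => tc rho (fun t => phi z (upd xi i t)) m) : germ R n).
have [kg kgE] := germ_const_exists R n.
have Lg j : (j < L)%N -> cl (Lam Ug Yg (fun s => kg (e s)%:C%C))`_j = 0.
  move=> jL; apply: clD => z Dz; have [evz evzE] := germ_eval_exists z.
  rewrite -evzE -coef_map Lam_map -[RHS](@Lam_line z xi i L j Dz Dxi jL).
  congr (_`_j); congr Lam.
  - apply/funext => s; apply/polyP => m; rewrite coef_map !coef_poly.
    by case: ifP => _; [exact: evzE|exact: (rmorph0 evz)].
  - by apply/polyP => m; rewrite coef_map !coef_poly; case: ifP => _; [exact: evzE|exact: (rmorph0 evz)].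
  - by apply/funext => s; rewrite evzE kgE.
have UAE s : map_poly ia (UA s) = (f s)^-1 *: map_poly cl (Ug s).
  apply/polyP => m; rewrite coefZ !coef_map !coef_poly; case: ifP => _; last first.
    by apply: etrans (rmorph0 ia) _; apply/esym; apply: etrans (congr1 _ (rmorph0 cl)) (mulr0 _).
  transitivity (\sum_j ia (@c s j * kC (tc rho (fun t => @Eb s (upd xi i t) j) m))); first exact: rmorph_sum.
  have -> : (fun z => tc rho (fun t => bilin s z (upd xi i t)) m) =
      \sum_j ((fun z => @E s z j) : germ R n) * kg (tc rho (fun t => @Eb s (upd xi i t) j) m).
    apply/funext => z; rewrite (tc_lincomb rho0); last by move=> j; exact: holEb.
    have [evz evzE] := germ_eval_exists z.
    by rewrite -[RHS]evzE rmorph_sum; apply: eq_bigr => j _; rewrite rmorphM !evzE kgE.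
  transitivity ((f s)^-1 * \sum_j cl (((fun z => @E s z j) : germ R n) * kg (tc rho (fun t => @Eb s (upd xi i t) j) m))); last first.
    by congr (_ * _); apply/esym; exact: rmorph_sum.
  rewrite mulr_sumr; apply: eq_bigr => j _.
  by rewrite [LHS]rmorphM cE kCE [X in _ = _ * X]rmorphM kgE mulrA [_ / _]mulrC.
have YAE : map_poly ia YA = map_poly cl Yg.
  apply/polyP => m; rewrite !coef_map !coef_poly; case: ifP => _; first exact: yAE.
  exact: etrans (rmorph0 ia) (esym (rmorph0 cl)).
have LA j : (j < L)%N -> (Lam UA YA (fun s => kC (e s)%:C%C))`_j = 0.
  move=> jL; apply: ia_inj; rewrite rmorph0 -coef_map Lam_map.
  have -> : (fun s => map_poly ia (UA s)) = fun s => (f s)^-1 *: map_poly cl (Ug s) by apply/funext => s.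
  rewrite Lam_scale YAE coefZ.
  have -> : (fun s => ia (kC (e s)%:C%C)) = fun s => cl (kg (e s)%:C%C) by apply/funext => s; rewrite kCE kgE.
  have Lj := congr1 (fun q : {poly K} => q`_j) (esym (Lam_map cl Ug Yg (fun s => kg (e s)%:C%C))).
  exact: etrans (congr1 _ (etrans Lj (etrans (coef_map cl _ _) (Lg j jL)))) (mulr0 _).
have hUA s m : (m < L.+1)%N -> (map_poly h (UA s))`_m =
    restc rho Eb (h \o kC) (fun s j => h (@c s j)) s xi i m.
  move=> mL; rewrite coef_map coef_poly mL.
  transitivity (\sum_j h (@c s j * kC (tc rho (fun t => @Eb s (upd xi i t) j) m))); first exact: rmorph_sum.
  by apply: eq_bigr => j _; rewrite rmorphM.
have H : \sum_s h (kC (e s)%:C%C) *+ k s = 0.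
  apply: (@Lam_order T kappa (fun s => map_poly h (UA s)) (map_poly h YA) (fun s => h (kC (e s)%:C%C)) k L).
  - by move=> s; rewrite hUA.
  - by move=> s j jk; rewrite hUA ?Hj // (ltn_trans jk).
  (* The constant coefficient is the class of z |-> phi(z, upd xi i 0), which has no zero on the
     polydisc. This class is nonzero and algebraic, hence so is its inverse; both lie in S, so its
     reduction is nonzero. *)
  - rewrite coef_map coef_poly /=; apply/eqP => /hE; rewrite yAE.
    have Dxi0 : D (upd xi i 0) by apply: polydisc_upd => //; rewrite cmod0.
    have phi0 z : D z -> phi z (upd xi i 0) != 0.
      move=> Dz; rewrite phiE //; apply/prodf_neq0 => s _.
      have U0 := bilin_neq0 s Dz Dxi0.
      by rewrite -cmod_gt0 cmod_cpow // expR_gt0.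
    have inv : cl (fun z => tc rho (fun t => phi z (upd xi i t)) 0) *
        cl (fun z => (tc rho (fun t => phi z (upd xi i t)) 0)^-1) = 1.
      apply/eqP; rewrite -subr_eq0 -rmorphM -(rmorph1 cl) -rmorphB; apply/eqP/clD => z Dz.
      apply/eqP; rewrite subr_eq0; apply/eqP.
      rewrite -[LHS]/(tc rho (fun t => phi z (upd xi i t)) 0 * (tc rho (fun t => phi z (upd xi i t)) 0)^-1).
      by rewrite divff // tc0 ?phi0 //; exact: holphi.
    case=> [y0|]; first by move/eqP: inv; rewrite y0 mul0r eq_sym oner_eq0.
    by apply; apply/S_alg/algebraic_inv/asboolP; exact: tc_phi_algebraic.
  - move=> j jL; have := congr1 h (LA j jL); rewrite rmorph0 -coef_map Lam_map; exact.
  - exact: leqnSn.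
(* A ring morphism out of the field C into a nonzero ring is injective, so the relation found in
   [kappa] already holds between the real exponents. *)
have : (h \o kC) (\sum_s (e s)%:C%C *+ k s) = 0.
  by rewrite rmorph_sum -[RHS]H; apply: eq_bigr => s _; rewrite rmorphMn.
rewrite -(rmorph0 (h \o kC)) => /fmorph_inj /(congr1 (@complex.Re R)).
have -> : \sum_s (e s)%:C%C *+ k s = (\sum_s e s *+ k s)%:C%C.
  by rewrite rmorph_sum; apply: eq_bigr => s _; rewrite rmorphMn.
by [].
Qed.

End OrderRelation.

Definition conjE (R : realType) (n N : nat) (E : 'rV[R[i]]_n -> 'I_N -> R[i]) xi j : R[i] :=
  conjc (E (map_mx (@conjc R) xi) j).

(** * The contradiction for a transcendental component *)

Section Core.
Variables (R : realType) (n : nat) (T : finType) (rho : R).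
Local Notation C := R[i].
Local Notation V := 'rV[C]_n.
Local Notation D := (@polydisc R n rho).
Variables (e : T -> R) (d : T -> nat) (o : forall s, 'I_(d s)) (E : forall s, V -> 'I_(d s) -> C) (phi : V -> V -> C).
Let Eb s := conjE (@E s).
Hypothesis rho0 : 0 < rho.
Hypothesis nonresonant : forall k : T -> nat, \sum_s e s *+ k s = 0 -> forall s, k s = 0%N.
Hypothesis Eo : forall s z, E z (o s) = 1.
Hypothesis E0 : forall s j, j != o s -> E 0 j = 0.
Hypothesis holEb : forall s xi i j, D xi -> hol rho (fun t => Eb (s := s) (upd xi i t) j).
Hypothesis holphi : forall z xi i, D z -> D xi -> hol rho (fun t => phi z (upd xi i t)).
Hypothesis bilin_neq0 : forall s z xi, D z -> D xi -> bilin E Eb s z xi != 0.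
Hypothesis phiE : forall z xi, D z -> D xi -> phi z xi = \prod_s cpow (bilin E Eb s z xi) (e s).
Variables (M : idomainType) (cst : {rmorphism C -> M}) (ev : V -> {rmorphism M -> C}).
Hypothesis ev_cst : forall z c, ev z (cst c) = c.
Hypothesis phi_alg : forall xi i, D xi -> exists Q : {poly {poly M}}, Q != 0 /\
  forall z t, D z -> cmod t < rho -> (map_poly (hev (ev z) t) Q).[phi z (upd xi i t)] = 0.
Variables (K : fieldType) (cl : {rmorphism germ R n -> K}) (iota : {rmorphism {fraction M} -> K}).
Hypothesis clD : forall g : V -> C, (forall z, D z -> g z = 0) -> cl g = 0.
Hypothesis iotaE : forall p, iota (tofrac p) = cl (fun z => ev z p).

Lemma polydisc_conj xi : D xi -> D (map_mx (@conjc R) xi).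
Proof. by move=> Dxi j; rewrite mxE cmod_conj. Qed.

Lemma map_conjK (z : V) : map_mx (@conjc R) (map_mx (@conjc R) z) = z.
Proof. by apply/rowP => j; rewrite !mxE conjcK. Qed.

Lemma no_transcendental_component s0 i0 :
  ~ (forall p : {poly {fraction M}}, p != 0 -> (map_poly iota p).[cl (fun z => @E s0 z i0)] != 0).
Proof.
move=> /place_exists[S [A [ia [kappa [h [[Ssub Sx] Sval S_alg [ia_inj iaS] hE]]]]]].
have [S1 SB SM] := Ssub.
have [kg kgE] := germ_const_exists R n.
have kg_iota a : cl (kg a) = iota (tofrac (cst a)).
  by rewrite iotaE kgE; congr (cl _); apply/funext => z; rewrite ev_cst.
have [|kC kCE] := @rmorphism_factor C A K ia (cl \o kg) ia_inj.
  by move=> a; apply/iaS/S_alg => /=; rewrite kg_iota; exact: algebraic_id.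
have kC_cl a : ia (kC a) = cl (fun=> a) by rewrite kCE /= kgE.
(* The component [o s] is the constant 1, so the dominant element is always the class of some
   component, and the corresponding scaled coefficient is 1. *)
have scale s : {fc : K * ('I_(d s) -> A) | [/\ fc.1 != 0,
    forall j, ia (fc.2 j) = cl (fun z => @E s z j) / fc.1 & exists j, fc.2 j = 1]}.
  apply: cid; pose ws := [seq cl (fun z => @E s z j) | j <- enum 'I_(d s)].
  have [f [fws f0 Hf]] := dominant_element ws Ssub Sval.
  have clws j : cl (fun z => @E s z j) \in 1 :: ws.
    by rewrite inE; apply/orP; right; apply/mapP; exists j; rewrite ?mem_enum.
  have /choice[c Hc] : forall j, exists a, ia a = cl (fun z => @E s z j) / f.
    by move=> j; apply/iaS/Hf.
  exists (f, c); split => //=.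
  have [j fj] : exists j, f = cl (fun z => @E s z j).
    move: fws; rewrite inE => /orP[/eqP ->|/mapP[j _ ->]]; last by exists j.
    exists (o s); rewrite -(rmorph1 cl); congr (cl _); apply/funext => z.
    by rewrite Eo.
  by exists j; apply: ia_inj; rewrite Hc -fj divff // rmorph1.
pose f s := (sval (scale s)).1; pose c s := (sval (scale s)).2.
have f0 s : f s != 0 by rewrite /f; case: (scale s) => ? [].
have cE s j : ia (c s j) = cl (fun z => @E s z j) / f s by rewrite /c /f; case: (scale s) => ? [].
have c1 s : exists j, c s j = 1 by rewrite /c; case: (scale s) => ? [].
pose cr s (j : 'I_(d s)) := h (c s j).
(* Complex linear relations between the components of E on D pass to the scaled coefficients. If the
   reduction vanished at every conjugate point, nondegeneracy would make all residues zero, against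
   the coefficient equal to 1. *)
have nz s : exists2 xi, D xi & resval Eb (h \o kC) cr s xi != 0.
  apply: contrapT => H; have [j cj] := c1 s.
  have : cr s j = 0; last by rewrite /cr cj rmorph1 => /eqP; rewrite oner_eq0.
  apply: (@hermitian_nondegenerate R kappa (h \o kC) (d s) V D (@E s) (cr s)) => [b Hb|z Dz].
    have -> : \sum_j cr s j * (h \o kC) (b j) = h (\sum_j c s j * kC (b j)).
      by rewrite rmorph_sum; apply: eq_bigr => k _; rewrite rmorphM.
    suff -> : \sum_j c s j * kC (b j) = 0 by rewrite rmorph0.
    apply: ia_inj; rewrite rmorph0 rmorph_sum.
    transitivity ((f s)^-1 * cl (\sum_j kg (b j) * ((fun z => @E s z j) : germ R n))).
      rewrite rmorph_sum mulr_sumr; apply: eq_bigr => k _.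
      by rewrite [LHS]rmorphM cE kCE /= [X in _ = _ * X]rmorphM mulrAC mulrC [cl (kg _) * _]mulrC.
    apply: etrans (congr1 _ (clD _)) (mulr0 _) => z Dz.
    have [evz evzE] := germ_eval_exists z.
    by rewrite -evzE rmorph_sum -[RHS](Hb z Dz); apply: eq_bigr => k _; rewrite rmorphM !evzE kgE.
  apply: contrapT => /eqP Hz; apply: H; exists (map_mx (@conjc R) z); first exact: polydisc_conj.
  by rewrite /resval /Eb /conjE map_conjK.
have orel := place_order_relation rho0 holEb holphi bilin_neq0 phiE phi_alg clD iotaE
  S_alg ia_inj (fun w => proj1 (iaS w)) hE kC_cl cE.
have := @resval_origin R n T rho d Eb rho0 holEb kappa (h \o kC) cr e nonresonant orel nz s0.
rewrite /resval (bigD1 (o s0)) //= big1 ?addr0 => [|j jo]; last first.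
  rewrite /Eb /conjE.
  have -> : map_mx (@conjc R) (0 : V) = 0 by apply/rowP => k; rewrite !mxE conjc0.
  by rewrite E0 // conjc0 !rmorph0 mulr0.
move=> nzo.
have : cr s0 (o s0) = 0; last by move=> c0; move: nzo; rewrite c0 mul0r eqxx.
apply/hE; right; rewrite cE.
have -> : cl (fun z => @E s0 z (o s0)) = 1.
  by rewrite -(rmorph1 cl); congr (cl _); apply/funext => z; rewrite Eo.
(* The quotient x / f is in S by the choice of f, so f in S would put x in S. *)
rewrite div1r invrK => Sf; apply: Sx.
rewrite -[X in S X](divfK (f0 s0)); apply: SM => //.
by rewrite -cE; apply/iaS; exists (c s0 i0).
Qed.

End Core.

(** * Identity theorem and conclusion *)

Section IdentityTheorem.
Variable R : realType.
Local Notation C := R[i].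

Lemma jet_eq0 N (f : C -> C) (delta : R) : 0 < delta ->
  (forall t, cmod t < delta -> f t = 0) -> jet N f 0.
Proof.
move=> d0 f0; apply: jet_ext (jet_cst N 0); exists delta => // t _ td.
by rewrite f0.
Qed.

(** The Taylor expansion at a centre c is available only on a third of the disc of
    differentiability, so 0 is joined to a by N steps shorter than delta/2. With delta = (r - |a|)/3
    the disc of radius 3 delta around every centre stays inside, and vanishing on the eta-disc
    propagates from each centre to the next. *)
Lemma disc_identity (h : C -> C) (r rho : R) : 0 < rho ->
  (forall t, cmod t < r -> exists L, cdiff h t L) ->
  (forall t, cmod t < rho -> h t = 0) -> forall a, cmod a < r -> h a = 0.
Proof.
move=> rho0 dh h0 a ar.
pose delta := (r - cmod a) / 3.
have delta0 : 0 < delta by rewrite divr_gt0 // subr_gt0.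
have delta3 : 3 * delta = r - cmod a by rewrite mulrC divfK // pnatr_eq0.
pose eta := Order.min rho (delta / 2).
have eta0 : 0 < eta by rewrite lt_min rho0 half_pos.
have step c c' : cmod c <= cmod a -> cmod (c' - c) < delta / 2 ->
    (forall x, cmod x < eta -> h (c + x) = 0) -> forall x, cmod x < eta -> h (c' + x) = 0.
  move=> ca cc' hc x xe.
  have Hh : hol delta (fun x => h (c + x)).
    move=> w; rewrite delta3 ltrBrDl => wr.
    have [|L HL] := dh (c + w); first by apply: le_lt_trans (cmodD _ _) _; apply: le_lt_trans wr; rewrite lerD2r.
    exists L => e1 e10; have [d1 d10 H1] := HL e1 e10; exists d1 => // k kd.
    by have := H1 k kd; rewrite !addrA.
  have -> : c' + x = c + ((c' - c) + x) by rewrite addrA subrKC.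
  apply: (hol_zero delta0 Hh).
    by move=> j; rewrite (tc_jet delta0 Hh (jet_eq0 j.+1 eta0 hc) (ltnSn j)) coef0.
  apply: le_lt_trans (cmodD _ _) _; rewrite [ltRHS](splitr delta) ltrD //.
  by apply: lt_le_trans xe _; rewrite ge_min lexx orbT.
have a1 : 0 <= cmod a / (delta / 2) by rewrite divr_ge0 ?cmod_ge0 // ltW // half_pos.
have [N aN] : exists N : nat, cmod a / (delta / 2) < N%:R by exists (Num.bound (cmod a / (delta / 2))); exact: archi_boundP.
have N0 : 0 < N%:R :> R by exact: le_lt_trans aN.
pose c (k : nat) : C := (k%:R / N%:R)%:C%C * a.
have cmodc k : cmod (c k) = k%:R / N%:R * cmod a by rewrite cmodM cmod_real ger0_norm // divr_ge0.
have all k : (k <= N)%N -> forall x, cmod x < eta -> h (c k + x) = 0.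
  elim: k => [_ x xe|k IHk kN].
    by rewrite /c mul0r mul0r add0r h0 // (lt_le_trans xe) // ge_min lexx.
  apply: (step (c k)); [|
    |exact: IHk (ltnW kN)].
    by rewrite cmodc ler_piMl ?cmod_ge0 // ler_pdivrMr // mul1r ler_nat ltnW.
  rewrite -mulrBl -rmorphB -mulrBl -natrB // subSnn cmodM cmod_real ger0_norm ?divr_ge0 //.
  by rewrite mul1r mulrC ltr_pdivrMr // mulrC -ltr_pdivrMr // half_pos.
have := all N (leqnn N) 0; rewrite cmod0 addr0 => /(_ eta0).
by rewrite /c divff ?mul1r // gt_eqF.
Qed.

Variable n : nat.
Local Notation V := 'rV[C]_n.

Lemma cnorm2E (z : V) : cnorm2 z = \sum_(j < n) cmod (z ord0 j) ^+ 2.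
Proof. by apply: eq_bigr => j _; rewrite cmod_sqr. Qed.

(** The squared norm is at most n q^2, and n + 1 in place of n makes the inequality strict. *)
Lemma polydisc_cball (r q : R) (z : V) : 0 < q -> q *+ n.+1 <= r -> polydisc q z -> cball n r z.
Proof.
move=> q0 qr Hz; rewrite /cball /= cnorm2E.
apply: (@le_lt_trans _ _ (q ^+ 2 *+ n)).
  rewrite -[X in _ *+ X]card_ord -sumr_const; apply: ler_sum => j _.
  by rewrite lerXn2r ?nnegrE ?cmod_ge0 ?(ltW q0) // ltW.
have rq : q *+ n.+1 * q <= r ^+ 2.
  rewrite expr2 ler_pM ?mulrn_wge0 ?(ltW q0) //; apply: le_trans qr.
  by rewrite mulrS lerDl mulrn_wge0 // ltW.
by apply: lt_le_trans rq; rewrite mulrnAl -expr2 ltr_pMn2l // exprn_gt0.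
Qed.

(** Slices of the ball along a coordinate are discs centred at 0, as [disc_identity] expects. *)
Lemma cball_upd (r : R) (z : V) i : cball n r z ->
  exists q : R, cmod (z ord0 i) < q /\ forall t, cmod t < q -> cball n r (upd z i t).
Proof.
rewrite /cball /= cnorm2E (bigD1 i) //= => zr.
pose s := \sum_(j < n | j != i) cmod (z ord0 j) ^+ 2.
have rs : 0 <= r ^+ 2 - s.
  by rewrite subr_ge0; apply: le_trans (ltW zr); rewrite lerDr sqr_ge0.
exists (Num.sqrt (r ^+ 2 - s)); split.
  have zm : cmod (z ord0 i) ^+ 2 < r ^+ 2 - s by rewrite ltrBrDr.
  by rewrite -[ltLHS]ger0_norm ?cmod_ge0 // -sqrtr_sqr ltr_sqrt // (le_lt_trans (sqr_ge0 _) zm).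
move=> t tq; rewrite cnorm2E (bigD1 i) //= mxE eqxx.
have -> : \sum_(j < n | j != i) cmod (upd z i t ord0 j) ^+ 2 = s.
  by apply: eq_bigr => j ji; rewrite mxE (negbTE ji).
rewrite -ltrBrDr -[ltRHS]sqr_sqrtr // ltrXn2r ?nnegrE ?cmod_ge0 ?sqrtr_ge0 //.
Qed.

Definition coordinatewise (D : set V) (f : V -> C) := forall z i t, D (upd z i t) ->
  exists L, cdiff (fun t => f (upd z i t)) t L.

(** Induction on the number k of leading coordinates allowed to leave the small polydisc; the last
    of them is treated by the one-variable theorem on its slice. *)
Lemma polydisc_identity (g : V -> C) (r rho : R) : 0 < rho -> coordinatewise (cball n r) g ->
  (forall z, polydisc rho z -> g z = 0) -> forall z, cball n r z -> g z = 0.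
Proof.
move=> rho0 hg g0.
have step k : (k <= n)%N -> forall z, cball n r z ->
    (forall j : 'I_n, (k <= j)%N -> cmod (z ord0 j) < rho) -> g z = 0.
  elim: k => [_ z _ Hz|k IHk kn z Dz Hz]; first by apply: g0 => j; exact: Hz.
  pose ik := Ordinal kn; have [q [zq Hq]] := cball_upd ik Dz.
  have q0 : 0 < q by exact: le_lt_trans (cmod_ge0 _) zq.
  rewrite -(upd_id z ik).
  apply: (@disc_identity (fun t => g (upd z ik t)) q (Order.min rho q)) zq; first by rewrite lt_min rho0.
    by move=> t tq; apply/hg/Hq.
  move=> t; rewrite lt_min => /andP[trho tq]; apply: (IHk (ltnW kn)); first exact: Hq.
  move=> j kj; rewrite mxE; case: eqP => // /eqP ji; apply: Hz.
  by rewrite ltn_neqAle kj andbT eq_sym.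
move=> z Dz; apply: (step n (leqnn n) z Dz) => j nj.
by have := ltn_ord j; rewrite ltnNge nj.
Qed.

Lemma cdiff_prod (I : Type) (s : seq I) (f : I -> C -> C) a :
  (forall i, exists L, cdiff (f i) a L) -> exists L, cdiff (fun x => \prod_(i <- s) f i x) a L.
Proof.
move=> H; elim: s => [|i s [L HL]].
  by exists 0; apply: (cdiff_near (d := 1)) (cdiff_cst 1 a) => // h _; rewrite big_nil.
have [L' HL'] := H i; eexists; apply: (cdiff_near (d := 1)) (cdiffM HL' HL) => // h _.
by rewrite big_cons.
Qed.

Lemma coordinatewise_mev (D : set V) (p : {mpoly C[n]}) : coordinatewise D (fun z => mev z p).
Proof.
move=> z i t _.
have mon (mm : 'X_{1..n}) : exists L, cdiff (fun t => \prod_(j < n) (upd z i t) ord0 j ^+ mm j) t L.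
  apply: (@cdiff_prod _ _ (fun j t => (upd z i t) ord0 j ^+ mm j)) => j.
  have [L HL] : exists L, cdiff (fun t => upd z i t ord0 j) t L.
    case: (eqVneq j i) => [->|ji].
      by exists 1; apply: (cdiff_near (d := 1)) (cdiff_id t) => // h _; rewrite mxE eqxx.
    exists 0; apply: (cdiff_near (d := 1)) (cdiff_cst (z ord0 j) t) => // h _.
    by rewrite mxE (negbTE ji).
  by eexists; apply: cdiffX HL.
have /choice[L HL] := mon.
exists (\sum_(mm <- msupp p) p@_mm * L mm).
have Hs : cdiff (fun t => \sum_(mm <- msupp p) p@_mm * \prod_(j < n) (upd z i t) ord0 j ^+ mm j) t
    (\sum_(mm <- msupp p) p@_mm * L mm).
  apply: (@cdiff_sum R _ (msupp p) predT
    (fun mm t => p@_mm * \prod_(j < n) (upd z i t) ord0 j ^+ mm j)) => mm _.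
  exact: cdiffZ.
by apply: (cdiff_near (d := 1)) Hs => // h _; rewrite /mev mevalE.
Qed.

Lemma coordinatewise_pev (D : set V) (P : {poly {mpoly C[n]}}) (f : V -> C) :
  coordinatewise D f -> coordinatewise D (fun z => pev P z (f z)).
Proof.
move=> Hf z i t Dz; have [L HL] := Hf z i t Dz.
elim/poly_ind: P => [|P c [L1 HL1]].
  exists 0; apply: (cdiff_near (d := 1)) (cdiff_cst 0 t) => // h _.
  by rewrite /pev rmorph0 horner0.
have [L2 HL2] := coordinatewise_mev c Dz.
eexists; apply: (cdiff_near (d := 1)) (cdiffD (cdiffM HL1 HL) HL2) => // h _.
by rewrite /pev rmorphD rmorphM /= map_polyX map_polyC /= hornerMXaddC.
Qed.

Lemma algebraic_on_cball (f : V -> C) (r rho : R) : 0 < rho -> coordinatewise (cball n r) f ->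
  algebraic_on (polydisc rho) f -> algebraic_on (cball n r) f.
Proof.
move=> rho0 Hf [P [P0 HP]]; exists P; split => //.
exact: (polydisc_identity rho0 (coordinatewise_pev P Hf)).
Qed.

End IdentityTheorem.

Section Holomorphy.
Variable R : realType.
Local Notation C := R[i].

Lemma holomorphic_coordinatewise (k : nat) (D : set 'rV[C]_k) (f : 'rV[C]_k -> C) :
  holomorphic_on D f -> coordinatewise D f.
Proof.
move=> Hf z i t Dz; have [_ /(_ i) df] := Hf _ Dz.
have /derivableP/cdiffP HL := df.
have [L HL'] : exists L, cdiff (fun w : C^o => f (upd z i t + w *: delta_mx ord0 i)) 0 L by eexists; exact: HL.
exists L => e e0; have [d d0 H] := HL' e e0; exists d => // h hd.
have upd_add x : upd z i t + x *: delta_mx ord0 i = upd z i (t + x).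
  by apply/rowP => j; rewrite !mxE eqxx /=; case: eqP => _; rewrite ?mulr1 ?mulr0 ?addr0.
by have := H h hd; rewrite add0r !upd_add addr0.
Qed.

Lemma holomorphic_continuous (k : nat) (D : set 'rV[C]_k) (f : 'rV[C]_k -> C) w0 (e : R) :
  holomorphic_on D f -> D w0 -> 0 < e -> exists2 d : R, 0 < d &
  forall w : 'rV[C]_k, (forall j, cmod (w ord0 j - w0 ord0 j) < d) -> cmod (f w - f w0) < e.
Proof.
move=> Hf Dw0 e0; have [cf _] := Hf _ Dw0.
have /(@cvgC_cont _ _ (nbhs (w0 : 'rV[C^o]_k)) _ f (f w0)) H := cf.
have /nbhs_ballP[d /= d0 Hd] := H _ e0.
have re : (complex.Re d)%:C%C = d by apply: RRe_real; exact: gtr0_real.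
exists (complex.Re d); first by rewrite -ltcR re.
move=> w Hw; rewrite cmodC; apply: Hd; rewrite /ball /=; split => // i j.
by rewrite ord1 /ball /= -cmod_normE cmodC -re ltcR.
Qed.

Lemma cdiff_conj (f : C -> C) a L : cdiff f (conjc a) L -> cdiff (fun t => conjc (f (conjc t))) a (conjc L).
Proof.
move=> H e e0; have [d d0 Hd] := H e e0; exists d => // h hd.
have := Hd (conjc h); rewrite cmod_conj => /(_ hd); apply: le_trans.
by rewrite -[leRHS]cmod_conj !rmorphB rmorphM /= !conjcK rmorphD.
Qed.

End Holomorphy.

(** * The maps F_l and G_j as one family *)

Section Family.
Variables (R : realType) (n : nat).
Local Notation C := R[i].
Local Notation V := 'rV[C]_n.

Lemma abstract_generic_field (D : set V) (f : V -> C) : ~ algebraic_on D f ->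
  exists (M : idomainType) (cst : {rmorphism C -> M}) (X : 'I_n -> M) (ev : V -> {rmorphism M -> C})
    (K : fieldType) (cl : {rmorphism germ R n -> K}) (iota : {rmorphism {fraction M} -> K}),
  [/\ (forall z c, ev z (cst c) = c) /\ (forall z j, ev z (X j) = z ord0 j),
      forall g : V -> C, (forall z, D z -> g z = 0) -> cl g = 0,
      forall p, iota (tofrac p) = cl (fun z => ev z p) &
      forall p : {poly {fraction M}}, p != 0 -> (map_poly iota p).[cl f] != 0].
Proof.
move=> /generic_field[K [cl [iota [clD iotaE tr]]]].
exists {mpoly C[n]}, (@mpolyC n C), (fun j => mpolyX C U_(j)%MM), (@mev R n), K, cl, iota; split => //.
by split => [z c|z j]; [exact: mevalC|exact: mevalXU].
Qed.

(* Prepending 1 to H turns 1 + H(z).Hbar(xi) into a bilinear expression. *)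
Definition pad N (H : V -> 'rV[C]_N) (z : V) (k : 'I_N.+1) : C :=
  if unlift ord0 k is Some j then H z ord0 j else 1.

Lemma pad0 N (H : V -> 'rV[C]_N) z : pad H z ord0 = 1.
Proof. by rewrite /pad unlift_none. Qed.

Lemma padS N (H : V -> 'rV[C]_N) z j : pad H z (lift ord0 j) = H z ord0 j.
Proof. by rewrite /pad liftK. Qed.

Lemma map_conj_upd (xi : V) i t :
  map_mx (@conjc R) (upd xi i t) = upd (map_mx (@conjc R) xi) i (conjc t).
Proof. by apply/rowP => j; rewrite !mxE; case: eqP. Qed.

Lemma cdot_barmap N (H : V -> 'rV[C]_N) z xi :
  cdot (H z) (barmap H xi) = \sum_j H z ord0 j * conjE (fun z j => H z ord0 j) xi j.
Proof. by apply: eq_bigr => j _; rewrite /barmap mxE. Qed.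

Lemma bilin_pad N (H : V -> 'rV[C]_N) z xi :
  \sum_k pad H z k * conjE (pad H) xi k = 1 + cdot (H z) (barmap H xi).
Proof.
rewrite big_ord_recl /conjE !pad0 conjc1 mulr1 cdot_barmap; congr (_ + _).
by apply: eq_bigr => j _; rewrite !padS.
Qed.

Lemma cmod_lt1 N (a b : 'I_N -> C) : (forall j, cmod (a j) < N.+1%:R^-1) ->
  (forall j, cmod (b j) < N.+1%:R^-1) -> cmod (\sum_j a j * b j) < 1.
Proof.
move=> Ha Hb; apply: le_lt_trans (cmod_sum _ _ _) _.
have N0 : 0 < N.+1%:R :> R by rewrite ltr0n.
apply: (@le_lt_trans _ _ (\sum_(j < N) (N.+1%:R^-1 : R))).
  apply: ler_sum => j _; rewrite cmodM -[leRHS]mulr1 ler_pM ?cmod_ge0 // ltW //.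
  by apply: lt_le_trans (Hb j) _; rewrite invf_le1 // ler1n.
by rewrite sumr_const card_ord -[_ *+ N]mulr_natl ltr_pdivrMr // mul1r ltr_nat.
Qed.

Lemma row_mx_upd (z xi : V) i t : upd (row_mx z xi) (rshift n i) t = row_mx z (upd xi i t).
Proof.
apply/rowP => k; rewrite mxE -(splitK k); case: (fintype.split k) => j /=.
  by rewrite !row_mxEl eq_lrshift.
by rewrite !row_mxEr eq_rshift mxE.
Qed.

Variables (T : finType) (e : T -> R) (N : T -> nat) (H : forall s, V -> 'rV[C]_(N s)).
Variables (phi : V -> V -> C) (r : R).
Hypothesis r0 : 0 < r.
Hypothesis nonresonant : forall k : T -> nat, \sum_s e s *+ k s = 0 -> forall s, k s = 0%N.
Hypothesis Hhol : forall s, holomorphic_map_on (cball n r) (H s).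
Hypothesis H0 : forall s, H s 0 = 0.
Hypothesis phihol : holomorphic_on (cball2 n r) (fun w => phi (lsubmx w) (rsubmx w)).
Hypothesis phialg : algebraic_on (cball2 n r) (fun w => phi (lsubmx w) (rsubmx w)).
Hypothesis phiE : forall z xi, cball n r z -> cball n r xi ->
  phi z xi = \prod_s cpow (1 + cdot (H s z) (barmap (H s) xi)) (e s).

Lemma cball0 : cball n r 0.
Proof. by rewrite /cball /= cnorm2E big1 ?exprn_gt0 // => j _; rewrite mxE cmod0 expr0n. Qed.

(** Components below 1/(N+1) in modulus give |H(z).Hbar(xi)| < 1, which keeps the factors off 0 and
    away from the convention for powers of 0. The factor 3 matches the radius in [hol]. *)
Lemma small_radius : exists2 rho : R, 0 < rho & [/\
  forall z, polydisc (3 * rho) z -> cball n r z &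
  forall s z xi, polydisc rho z -> polydisc rho xi -> 1 + cdot (H s z) (barmap (H s) xi) != 0].
Proof.
have N0 s : 0 < (N s).+1%:R^-1 :> R by rewrite invr_gt0 ltr0n.
have /choice[dl Hdl] : forall s, exists dl : R, 0 < dl /\
    forall z j, polydisc dl z -> cmod (H s z ord0 j) < (N s).+1%:R^-1.
  move=> s; have /choice[dj Hdj] : forall j, exists dj : R, 0 < dj /\
      forall z, polydisc dj z -> cmod (H s z ord0 j) < (N s).+1%:R^-1.
    move=> j; have [d d0 Hd] := holomorphic_continuous (@Hhol s j) cball0 (N0 s).
    exists d; split => // z Dz; have := Hd z; rewrite H0 mxE subr0; apply => i.
    by rewrite mxE subr0.
  have [d [d0 _ Hd]] := common_radius (d := dj) (@ltr01 R) (fun j => proj1 (Hdj j)).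
  exists d; split => // z j Dz; apply: (proj2 (Hdj j)) => i; exact: lt_le_trans (Dz i) (Hd j).
pose q := r / n.+1%:R / 3.
have q0 : 0 < q by rewrite !divr_gt0 ?ltr0n.
have [rho [rho0 rhoq Hrho]] := common_radius (d := dl) q0 (fun s => proj1 (Hdl s)).
exists rho => //; split => [z|s z xi Dz Dxi].
  apply: polydisc_cball; first by rewrite mulr_gt0.
  rewrite -[_ *+ n.+1]mulr_natr -ler_pdivlMr ?ltr0n // mulrC -ler_pdivlMr ?ltr0n //.
have small w j : polydisc rho w -> cmod (H s w ord0 j) < (N s).+1%:R^-1.
  by move=> Dw; apply: (proj2 (Hdl s)) => i; exact: lt_le_trans (Dw i) (Hrho s).
rewrite cdot_barmap -cmod_gt0; set c := \sum_j _.
have c1 : cmod c < 1.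
  apply: cmod_lt1 => j; first exact: small.
  by rewrite /conjE cmod_conj; apply: small => i; rewrite mxE cmod_conj; exact: Dxi.
by apply: lt_le_trans (cmodD_ge 1 c); rewrite cmod1 subr_gt0.
Qed.

(** Non-vanishing of the factors holds only on a small polydisc, so algebraicity is proved there;
    the polynomial relation then spreads to the ball by the identity theorem. *)
Lemma family_algebraic s i : algebraic_on (cball n r) (fun z => H s z ord0 i).
Proof.
have [rho rho0 [Hball Hne]] := small_radius.
have rho3 : rho < 3 * rho by rewrite ltr_pMl // ltr1n.
have Dball z : polydisc rho z -> cball n r z.
  by move=> Dz; apply: Hball => j; exact: lt_trans (Dz j) rho3.
have upd_ball z k t : polydisc rho z -> cmod t < 3 * rho -> cball n r (upd z k t).
  move=> Dz tr; apply: Hball => j; rewrite mxE; case: eqP => // _; exact: lt_trans (Dz j) rho3.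
apply: (algebraic_on_cball rho0 (holomorphic_coordinatewise (@Hhol s i))).
apply: contrapT => /abstract_generic_field[M [cst [X [ev [K [cl [iota [[ev_cst evX] clD iotaE tr]]]]]]]].
have [P [P0 HP]] := phialg.
have phi_row z xi : phi (lsubmx (row_mx z xi)) (rsubmx (row_mx z xi)) = phi z xi.
  by rewrite row_mxKl row_mxKr.
have phi_alg xi k : polydisc rho xi -> exists Q : {poly {poly M}}, Q != 0 /\
    forall z t, polydisc rho z -> cmod t < rho -> (map_poly (hev (ev z) t) Q).[phi z (upd xi k t)] = 0.
  move=> Dxi.
  have Dopen t dir : cmod t < rho ->
      exists2 e1 : R, 0 < e1 & forall x, cmod x < e1 -> cball n r (upd (xi + x *: dir) k t).
    (* q bounds every |dir_j|, so each coordinate moves by at most rho and stays below 3 rho; the 1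
       keeps q positive. *)
    move=> tr'; pose q := \sum_j cmod (dir ord0 j) + 1.
    have q0 : 0 < q by rewrite ltr_wpDl // sumr_ge0 // => j _; exact: cmod_ge0.
    exists (rho / q); first exact: divr_gt0.
    move=> x xq; apply: Hball => j; rewrite mxE; case: eqP => [_|_]; first exact: lt_trans tr' rho3.
    rewrite !mxE; apply: le_lt_trans (cmodD _ _) _.
    have -> : 3 * rho = rho + 2 * rho by rewrite -{2}[rho]mul1r -mulrDl nat1r.
    rewrite ltrD ?Dxi // cmodM; apply: (@le_lt_trans _ _ rho); last by rewrite ltr_pMl // ltr1n.
    apply: (@le_trans _ _ (rho / q * q)); last by rewrite divfK // gt_eqF.
    rewrite ler_pM ?cmod_ge0 // ?(ltW xq) // /q (bigD1 j) //= -addrA lerDl addr_ge0 //.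
    by rewrite sumr_ge0 // => j' _; exact: cmod_ge0.
  have [|||Q [Q0 HQ]] := @line_algebraic R n M cst X ev ev_cst evX (cball n r) [set t | cmod t < rho] P phi xi k P0.
  - by move=> z w Dz Dw; have := HP (row_mx z w); rewrite phi_row; apply; split; rewrite ?row_mxKl ?row_mxKr.
  - exact: Dopen.
  - move=> z t dir Dz tr' e1 e10; have [e2 e20 He2] := Dopen t dir tr'.
    have w0 : cball2 n r (row_mx z (upd (xi + 0 *: dir) k t)).
      by split; rewrite ?row_mxKl ?row_mxKr //; apply: He2; rewrite cmod0.
    have [e3 e30 He3] := holomorphic_continuous phihol w0 e10.
    pose q := \sum_j cmod (dir ord0 j) + 1.
    have q0 : 0 < q by rewrite ltr_wpDl // sumr_ge0 // => j _; exact: cmod_ge0.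
    exists (e3 / q); first exact: divr_gt0.
    move=> x xq; rewrite add0r; have := He3 (row_mx z (upd (xi + x *: dir) k t)).
    rewrite !phi_row => He; apply/ltW/He => j.
    rewrite -(splitK j); case: (fintype.split j) => j' /=; first by rewrite !row_mxEl subrr cmod0.
    rewrite !row_mxEr !mxE; case: eqP => _; first by rewrite subrr cmod0.
    rewrite mul0r addr0 [_ + x * _]addrC addrK cmodM.
    apply: le_lt_trans (_ : _ <= cmod x * q) _.
      rewrite ler_wpM2l ?cmod_ge0 // /q (bigD1 j') //= -addrA lerDl addr_ge0 //.
      by rewrite sumr_ge0 // => j'' _; exact: cmod_ge0.
    by rewrite -ltr_pdivlMr.
  by exists Q; split => // z t Dz tr'; apply: HQ => //; exact: Dball.
apply: (@no_transcendental_component R n T rho e (fun s => (N s).+1) (fun s => ord0)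
  (fun s => pad (H s)) phi rho0 nonresonant _ _ _ _ _ _ M cst ev ev_cst phi_alg K cl iota clD iotaE
  s (lift ord0 i)).
- by move=> s' z; exact: pad0.
- move=> s' j; case: (unliftP ord0 j) => [j' ->|->]; last by rewrite eqxx.
  by rewrite padS H0 mxE.
- move=> s' xi k j Dxi w wr; rewrite /conjE.
  case: (unliftP ord0 j) => [j' ->|->]; last first.
    exists 0; apply: (cdiff_near (d := 1)) (cdiff_cst 1 w) => // h _.
    by rewrite pad0 conjc1.
  have Dc : polydisc rho (map_mx (@conjc R) xi) by move=> jj; rewrite mxE cmod_conj; exact: Dxi.
  have [|L HL] := holomorphic_coordinatewise (@Hhol s' j') (z := map_mx (@conjc R) xi) (i := k) (t := conjc w).
    by apply: upd_ball => //; rewrite cmod_conj.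
  exists (conjc L); apply: (cdiff_near (d := 1)) (cdiff_conj HL) => // h _.
  by rewrite map_conj_upd padS.
- move=> z xi k Dz Dxi w wr.
  have [|L HL] := holomorphic_coordinatewise phihol (z := row_mx z xi) (i := rshift n k) (t := w).
    by rewrite row_mx_upd; split; rewrite ?row_mxKl ?row_mxKr; [exact: Dball|exact: upd_ball].
  exists L; apply: (cdiff_near (d := 1)) HL => // h _.
  by rewrite row_mx_upd phi_row.
- by move=> s' z xi Dz Dxi; rewrite /bilin bilin_pad; exact: Hne.
- move=> z xi Dz Dxi; rewrite phiE; [|exact: Dball|exact: Dball].
  by apply: eq_bigr => s' _; rewrite /bilin bilin_pad.
move=> p p0; have := tr p p0; congr ((_).[cl _] != 0).
by apply/funext => z; rewrite padS.
Qed.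

End Family.

Unset Implicit Arguments.

Theorem theorem3p1 (R : realType) (n v m : nat)
  (lambda : 'I_v -> R) (mu : 'I_m -> R)
  (Hlambda : forall j, 0 < lambda j) (Hmu : forall l, 0 < mu l)
  (Hspan : qspan_nonneg lambda `&` qspan_nonneg mu = [set 0])
  (r : R) (Hr : 0 < r)
  (N : 'I_m -> nat) (N' : 'I_v -> nat)
  (F : forall l : 'I_m, 'rV[R[i]]_n -> 'rV[R[i]]_(N l))
  (G : forall j : 'I_v, 'rV[R[i]]_n -> 'rV[R[i]]_(N' j))
  (phi : 'rV[R[i]]_n -> 'rV[R[i]]_n -> R[i])
  (HFhol : forall l, holomorphic_map_on (cball n r) (F l))
  (HGhol : forall j, holomorphic_map_on (cball n r) (G j))
  (HFnc : forall l, exists z, cball n r z /\ F l z != F l 0)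
  (HGnc : forall j, exists z, cball n r z /\ G j z != G j 0)
  (HF0 : forall l, F l 0 = 0) (HG0 : forall j, G j 0 = 0)
  (Hphihol : holomorphic_on (cball2 n r)
               (fun w => phi (lsubmx w) (rsubmx w)))
  (Hphialg : algebraic_on (cball2 n r)
               (fun w => phi (lsubmx w) (rsubmx w)))
  (Hid : forall z xi, cball n r z -> cball n r xi ->
     (\prod_(l < m) cpow (1 + cdot (F l z) (barmap (F l) xi)) (mu l)) *
     (\prod_(j < v) cpow (1 + cdot (G j z) (barmap (G j) xi)) (- lambda j))
     = phi z xi) :
  (forall l, nash_algebraic_on (cball n r) (F l)) /\
  (forall j, nash_algebraic_on (cball n r) (G j)).
Proof.
pose e (s : 'I_m + 'I_v) : R := match s with inl l => mu l | inr j => - lambda j end.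
pose NN (s : 'I_m + 'I_v) := match s with inl l => N l | inr j => N' j end.
pose H (s : 'I_m + 'I_v) : 'rV[R[i]]_n -> 'rV[R[i]]_(NN s) :=
  match s with inl l => F l | inr j => G j end.
have nonres (k : 'I_m + 'I_v -> nat) : \sum_s e s *+ k s = 0 -> forall s, k s = 0%N.
  rewrite big_sumType /=; under [X in _ + X]eq_bigr do rewrite mulNrn.
  rewrite sumrN => /eqP; rewrite subr_eq0 => /eqP E.
  have ratr_sum (I : finType) (x : I -> R) (c : I -> nat) :
      \sum_i ratr (c i)%:R * x i = \sum_i x i *+ c i.
    by apply: eq_bigr => i _; rewrite ratr_nat mulr_natl.
  (* The terms of the relation in mu and in lambda have equal sums, an element of both spans and
     therefore 0; positivity then makes every k s vanish. *)
  have : (qspan_nonneg lambda `&` qspan_nonneg mu) (\sum_l mu l *+ k (inl l)).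
    split; [exists (fun j => (k (inr j))%:R)|exists (fun l => (k (inl l))%:R)].
      by split=> [j|]; rewrite ?ler0n // ratr_sum E.
    by split=> [j|]; rewrite ?ler0n // ratr_sum.
  rewrite Hspan /= => E0.
  have zero (I : finType) (x : I -> R) (c : I -> nat) : (forall i, 0 < x i) ->
      \sum_i x i *+ c i = 0 -> forall i, c i = 0%N.
    move=> x0 /eqP; rewrite psumr_eq0 => [/allP xc i|i _]; last by rewrite mulrn_wge0 // ltW.
    have := xc i (mem_index_enum i); rewrite /= mulrn_eq0 (gt_eqF (x0 i)) orbF => /eqP; exact.
  case=> [l|j]; first exact: zero Hmu E0 l.
  by apply: (zero _ lambda (fun j => k (inr j)) Hlambda); rewrite -E.
have Hhol s : holomorphic_map_on (cball n r) (H s) by case: s => s; [exact: HFhol|exact: HGhol].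
have H0 s : H s 0 = 0 by case: s => s; [exact: HF0|exact: HG0].
have HphiE z xi : cball n r z -> cball n r xi ->
    phi z xi = \prod_s cpow (1 + cdot (H s z) (barmap (H s) xi)) (e s).
  by move=> Dz Dxi; rewrite -(Hid z xi Dz Dxi) big_sumType.
have alg := family_algebraic Hr nonres Hhol H0 Hphihol Hphialg HphiE.
by split=> [l i|j i]; [exact: (alg (inl l) i)|exact: (alg (inr j) i)].
Qed.
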